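(* Let $G$ be a finitely generated group which contains an undistorted subgroup $H$ such that either $H$ is nilpotent and not virtually cyclic, or $H$ is isomorphic to a Baumslag--Solitar group $BS(m,n) = \langle a,t \mid t a^m t^{-1} = a^n\rangle$ for some nonzero integers $m,n$. Then $G$ is chaotic (that is, $(G,S)$ is chaotic for every finite generating set $S$ of $G$), and in particular $G$ is not $\mathbb{Q}\mathbf{CF}$.
   Context: All groups are finitely generated and all generating sets are finite and symmetric (closed under inverses). For a group $G$ with finite generating set $S$, $d_S(g)$ denotes the word length of $g \in G$ with respect to $S$. A word $w \in S^*$ of length $|w|$ is also regarded as the element of $G$ it represents. A word $w\in S^*$ is $(\lambda,\epsilon)$-quasigeodesic in the Cayley graph $\Gamma(G,S)$ if $|u| \le \lambda d_S(u) + \epsilon$ for every contiguous subword $u$ of $w$. Undistorted (QI-embedded) subgroup: a finitely generated subgroup $H\le G$, with finite generating sets $T$ of $H$ and $S$ of $G$, such that there are constants $A\ge 1$, $B\ge 0$ with $\tfrac1A d_T(h) - B \le d_S(h) \le A d_T(h) + B$ for all $h \in H$ (this is independent of the choice of $T,S$). Chaotic: $(G,S)$ is chaotic if there exist $\lambda_0 \ge 1$ and $\epsilon_0 \ge 0$ such that for every context-free language $L \subseteq S^*$ containing all $(\lambda_0,\epsilon_0)$-quasigeodesic words of $\Gamma(G,S)$, and for all $\lambda\ge 1$ and $\epsilon \ge 0$, the language $L$ contains a word that is not $(\lambda,\epsilon)$-quasigeodesic in $\Gamma(G,S)$. $\mathbb{Q}\mathbf{CF}$: a finitely generated group $G$ is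 $\mathbb{Q}\mathbf{CF}$ if for all rational $\lambda \ge 1$, all real $\epsilon \ge 0$ and all finite generating sets $S$ of $G$, the set of $(\lambda,\epsilon)$-quasigeodesic words in $\Gamma(G,S)$ is a context-free language over $S$. A group is virtually cyclic if it has a cyclic subgroup of finite index (finite groups included). *)

(* Defs.v *)
From HB Require Import structures.
From Stdlib Require Import Relation_Operators.
From mathcomp Require Import all_boot all_order all_algebra.
From mathcomp Require Import boolp classical_sets functions cardinality reals.

Set Implicit Arguments.
Unset Strict Implicit.
Unset Printing Implicit Defensive.

Import Order.TTheory GRing.Theory Num.Theory.

Local Open Scope classical_set_scope.
Local Open Scope quotient_scope.

(** * Context-free languages *)

Record cfg (A : eqType) := Cfg {
  nonterminal : finType;
  start : nonterminal;
  rules : seq (nonterminal * seq (nonterminal + A))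
}.

Definition cfg_step (A : eqType) (D : cfg A)
    (u v : seq (nonterminal D + A)) : Prop :=
  exists (x y : seq (nonterminal D + A)) (r : nonterminal D * seq (nonterminal D + A)),
    [/\ r \in rules D, u = x ++ inl r.1 :: y & v = x ++ r.2 ++ y].

Definition cfg_language (A : eqType) (D : cfg A) : set (seq A) :=
  [set w | clos_refl_trans _ (@cfg_step A D) [:: inl (start D)] (map inr w)].

(* The carrier A may be infinite; the alphabet is the subset S of A, and all
   terminals of the grammar are required to lie in S. *)
Definition context_free (A : eqType) (S : set A) (L : set (seq A)) : Prop :=
  exists D : cfg A,
    (forall r, r \in rules D -> forall s : A, inr s \in r.2 -> S s) /\
    L = cfg_language D.

(** * Subgroups *)

Section Subgroups.
Variable G : groupType.
Implicit Types (H K A : set G) (x g : G).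

Definition subgroup H : Prop := group_closed (mem H).

Definition generated A : set G := smallest subgroup A.

Definition finite_generating_set H A : Prop :=
  [/\ finite_set A, forall x, A x -> A (x^-1)%g & generated A = H].

Fixpoint lower_central H (n : nat) : set G :=
  if n is k.+1 then generated [set [~ x, y]%g | x in lower_central H k & y in H]
  else H.

Definition nilpotent H : Prop := exists n, lower_central H n = [set 1%g].

Definition finite_index H K : Prop :=
  K `<=` H /\ finite_set [set [set (x * k)%g | k in K] | x in H].

Definition virtually_cyclic H : Prop :=
  exists c : G, finite_index H (generated [set c]).

End Subgroups.

Definition finitely_generated (G : groupType) : Prop :=
  exists S : set G, finite_generating_set setT S.

(** * Word length and quasigeodesics *)

Section Words.
Variable G : groupType.
Implicit Types (S : set G) (w u : seq G) (g : G).

Definition words S : set (seq G) := [set w | forall s, s \in w -> S s].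

Definition eval w : G := (\prod_(s <- w) s)%g.

(* Junk value 0 when no word over S represents g. *)
Definition word_length S g : nat :=
  xget 0%N [set n | (exists w, [/\ words S w, eval w = g & size w = n]) /\
                    (forall w, words S w -> eval w = g -> (n <= size w)%N)].

Definition quasigeodesic (R : realType) S (lambda eps : R) : set (seq G) :=
  [set w | words S w /\
     forall u, infix u w ->
       ((size u)%:R <= lambda * (word_length S (eval u))%:R + eps)%R].

End Words.

Definition undistorted (R : realType) (G : groupType) (H : set G) : Prop :=
  exists T S : set G,
    [/\ finite_generating_set H T, finite_generating_set setT S &
     exists A B : R, [/\ (1 <= A)%R, (0 <= B)%R &
       forall h, H h ->
         (1 / A * (word_length T h)%:R - B <= (word_length S h)%:R)%R /\
         ((word_length S h)%:R <= A * (word_length T h)%:R + B)%R]].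

Definition chaotic (R : realType) (G : groupType) (S : set G) : Prop :=
  exists lambda0 eps0 : R, [/\ (1 <= lambda0)%R, (0 <= eps0)%R &
    forall L : set (seq G), L `<=` words S -> context_free S L ->
      quasigeodesic S lambda0 eps0 `<=` L ->
      forall lambda eps : R, (1 <= lambda)%R -> (0 <= eps)%R ->
        exists2 w, L w & ~ quasigeodesic S lambda eps w].

Definition chaotic_group (R : realType) (G : groupType) : Prop :=
  forall S : set G, finite_generating_set setT S -> chaotic R S.

Definition QCF (R : realType) (G : groupType) : Prop :=
  finitely_generated G /\
  forall (lambda : rat) (eps : R) (S : set G),
    (1 <= lambda)%R -> (0 <= eps)%R -> finite_generating_set setT S ->
    context_free S (quasigeodesic S (ratr lambda) eps).

(** * Groups given by generators and relations *)

(* The letter (x, false) stands for the generator x and (x, true) for its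
   inverse; an element (l, r) of E is the relation l = r. *)
Section Presentation.
Variables (X : choiceType) (E : set (seq (X * bool) * seq (X * bool))).
Local Notation word := (seq (X * bool)).

Inductive pres_step : word -> word -> Prop :=
| pres_cancel u v x b : pres_step (u ++ [:: (x, b); (x, ~~ b)] ++ v) (u ++ v)
| pres_rel u v l r : E (l, r) -> pres_step (u ++ l ++ v) (u ++ r ++ v).

Definition pres_eq : word -> word -> Prop := clos_refl_sym_trans word pres_step.

Definition pres_eqb : rel word := fun u v => `[< pres_eq u v >].

Lemma pres_eqb_equiv : equiv_class_of pres_eqb.
Proof.
split=> [u|u v|v u w].
- by apply/asboolP; apply: rst_refl.
- by apply/asboolP/asboolP; apply: rst_sym.
- by move=> /asboolP uv /asboolP vw; apply/asboolP; apply: rst_trans uv vw.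
Qed.

Canonical pres_equiv := EquivRelPack pres_eqb_equiv.

Definition presented := {eq_quot pres_equiv}.
HB.instance Definition _ := Choice.on presented.
HB.instance Definition _ := EqQuotient.on presented.

Definition winv (u : word) : word := rev [seq (p.1, ~~ p.2) | p <- u].

Lemma pres_eq_ctx p q u v : pres_eq u v -> pres_eq (p ++ u ++ q) (p ++ v ++ q).
Proof.
elim=> {u v} [u v []||u v _ IH|u v w _ IH1 _ IH2].
- move=> u0 v0 x b; apply: rst_step.
  by have := pres_cancel (p ++ u0) (v0 ++ q) x b; rewrite -!catA.
- move=> u0 v0 l r Elr; apply: rst_step.
  by have := pres_rel (p ++ u0) (v0 ++ q) Elr; rewrite -!catA.
- by move=> u; apply: rst_refl.
- exact: rst_sym.
- exact: rst_trans IH1 IH2.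
Qed.

Lemma pres_eq_cat u u' v v' :
  pres_eq u u' -> pres_eq v v' -> pres_eq (u ++ v) (u' ++ v').
Proof.
move=> /(pres_eq_ctx [::] v) /= uu' /(pres_eq_ctx u' [::]).
by rewrite !cats0; apply: rst_trans.
Qed.

Lemma winvK : involutive winv.
Proof.
move=> u; rewrite /winv map_rev revK -map_comp map_id_in // => -[x b] _ /=.
by rewrite negbK.
Qed.

Lemma winv_cat u v : winv (u ++ v) = winv v ++ winv u.
Proof. by rewrite /winv map_cat rev_cat. Qed.

Lemma pres_eq_mulwV u : pres_eq (u ++ winv u) [::].
Proof.
elim: u => [|[x b] u IH]; first exact: rst_refl.
rewrite -cat1s winv_cat -catA [u ++ _]catA.
apply: rst_trans (pres_eq_ctx _ _ IH) _ => /=.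
exact/rst_step/(pres_cancel [::] [::] x b).
Qed.

Lemma pres_eq_mulVw u : pres_eq (winv u ++ u) [::].
Proof. by have := pres_eq_mulwV (winv u); rewrite winvK. Qed.

Definition pclass (u : word) : presented := \pi_presented u.

Lemma pclassP u v : pclass u = pclass v <-> pres_eq u v.
Proof.
split=> [/eqquotP h|h]; first by apply/asboolP; exact: h.
by apply/eqquotP/asboolP.
Qed.

Lemma pres_eq_repr u : pres_eq (repr (pclass u)) u.
Proof. by apply/pclassP; rewrite /pclass reprK. Qed.

Definition pres_mul (x y : presented) : presented := pclass (repr x ++ repr y).
Definition pres_inv (x : presented) : presented := pclass (winv (repr x)).

Lemma pres_mulA : associative pres_mul.
Proof.
move=> x y z; apply/pclassP.
apply: (rst_trans _ _ _ (repr x ++ repr y ++ repr z)).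
  exact/(pres_eq_cat (rst_refl _ _ _))/pres_eq_repr.
rewrite catA; apply: pres_eq_cat (rst_refl _ _ _).
exact/rst_sym/pres_eq_repr.
Qed.

Lemma pres_mul1 : left_id (pclass [::]) pres_mul.
Proof.
move=> x; rewrite -[RHS](@reprK _ presented); apply/pclassP.
exact: pres_eq_cat (pres_eq_repr [::]) (rst_refl _ _ (repr x)).
Qed.

Lemma pres_mulr1 : right_id (pclass [::]) pres_mul.
Proof.
move=> x; rewrite -[RHS](@reprK _ presented); apply/pclassP.
by have := pres_eq_cat (rst_refl _ _ (repr x)) (pres_eq_repr [::]); rewrite cats0.
Qed.

Lemma pres_mulV : left_inverse (pclass [::]) pres_inv pres_mul.
Proof.
move=> x; apply/pclassP; apply: rst_trans (pres_eq_mulVw (repr x)).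
exact: pres_eq_cat (pres_eq_repr _) (rst_refl _ _ _).
Qed.

Lemma pres_mulrV : right_inverse (pclass [::]) pres_inv pres_mul.
Proof.
move=> x; apply/pclassP; apply: rst_trans (pres_eq_mulwV (repr x)).
exact: pres_eq_cat (rst_refl _ _ _) (pres_eq_repr _).
Qed.

HB.instance Definition _ := isGroup.Build presented
  pres_mulA pres_mul1 pres_mulr1 pres_mulV pres_mulrV.

End Presentation.

(** * Baumslag--Solitar groups *)

(* x ^ k as a word, for an integer exponent k. *)
Definition wpow (X : Type) (x : X) (k : int) : seq (X * bool) :=
  nseq `|k|%N (x, (k < 0)%R).

(* The generators a and t are encoded as [false] and [true]. *)
Definition BS (m n : int) : groupType :=
  let a := false in let t := true in
  presented [set (wpow t 1 ++ wpow a m ++ wpow t (-1), wpow a n)].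

Definition isomorphic_to (K G : groupType) (H : set G) : Prop :=
  exists f : {multiplicative K -> G}, injective f /\ range f = H.

(* Main.v *)
(* Let x^n sit in the middle of a word U x^n V of a context-free language, with
   n large.  Ogden's argument with the letters of x^n marked pumps a power of x,
   and what is pumped changes at most one of U and V: for some p > 0, either all
   words U x^(n+pi) V'_i or all words U'_i x^(n+pi) V are in the language.  Hence
   (G,S) is chaotic as soon as there are uniformly quasigeodesic words U x^n V,
   with n arbitrarily large, such that U x^N and x^N V have factors which are as
   far from quasigeodesic as one wishes.

   If x and z commute, x is undistorted and no nontrivial power of z is a power
   of x, then the words x^-N g_1 x^n g_2 x^-N will do, where g_1 and g_2 are
   shortest elements of their cosets of <x> in <x,z>, and the lengths of g_1, g_2
   and of the coset g_1 g_2 <x> are comparable to n and form a nondegenerate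
   triangle: the factors x^-N g_1 x^N and x^N g_2 x^-N represent the short
   elements g_1 and g_2.  A nilpotent group that is not virtually cyclic contains
   such a pair, with x of infinite order in the abelianization; a rational
   character that does not vanish on x shows that x is undistorted.  In BS(m,n)
   with |m| = |n| the pair t^2, a^(m^2) works.

   In BS(m,n) with |m| <> |n| replace t by its square and let x = t^-1.  A power
   w of a of size exponential in N has a spelling t^N a^e v of length linear in N.
   As it commutes with a, the word w a^-1 v^-1 a^-e, which represents a^-1 t^N, is
   a possible U, and a w a^-1 v^-1, which represents t^N a^e, a possible V: then
   U x^N = a^-1 and x^N V = a^e are short elements.
   Lower bounds on lengths come from the affine action of BS(m,n) on the line, in
   which a is y -> y + 1: an element of length d has height at most d, and its
   translation part has absolute value and denominator at most exponential in d. *)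

Require Import Defs.
From Stdlib Require Import Relation_Operators Operators_Properties.
From mathcomp Require Import all_boot all_order all_algebra.
From mathcomp Require Import boolp classical_sets functions cardinality reals.
From mathcomp Require Import zify lra.

Set Implicit Arguments.
Unset Strict Implicit.
Unset Printing Implicit Defensive.

Import Order.TTheory GRing.Theory Num.Theory.
Local Open Scope classical_set_scope.
Local Open Scope nat_scope.

(** * Pumping context-free languages *)

Section Pumping.
Variables (A : eqType) (D : cfg A).
Local Notation N := (nonterminal D).
Local Notation symbols := (seq (N + A)).
Local Notation derives := (clos_refl_trans symbols (@cfg_step A D)).
Implicit Types (s r : symbols) (u v w : seq A) (B C : N).

Definition letters w : symbols := map inr w.

Lemma letters_cat u v : letters (u ++ v) = letters u ++ letters v.
Proof. exact: map_cat. Qed.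

Lemma derives_ctx r1 r2 s s' : derives s s' -> derives (r1 ++ s ++ r2) (r1 ++ s' ++ r2).
Proof.
elim=> {s s'} [s s' [x [y [p [pD -> ->]]]]|s|s s1 s2 _ IH1 _ IH2].
- by apply: rt_step; exists (r1 ++ x), (y ++ r2), p; split=> //; rewrite -!catA.
- exact: rt_refl.
- exact: rt_trans IH1 IH2.
Qed.

Lemma derives_cat s1 s1' s2 s2' :
  derives s1 s1' -> derives s2 s2' -> derives (s1 ++ s2) (s1' ++ s2').
Proof.
move=> /(derives_ctx [::] s2) /= d1 /(derives_ctx s1' [::]).
by rewrite !cats0; apply: rt_trans.
Qed.

Lemma derives_rule B r : (B, r) \in rules D -> derives [:: inl B] r.
Proof. by move=> BD; apply: rt_step; exists [::], [::], (B, r); rewrite cats0. Qed.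

(* [generates n s w]: a forest of parse trees with [n] nodes and leaves [w],
   whose roots are labelled by the symbols of [s]. *)
Inductive generates : nat -> symbols -> seq A -> Prop :=
| Gen_nil : generates 0 [::] [::]
| Gen_letter n a s w : generates n s w -> generates n.+1 (inr a :: s) (a :: w)
| Gen_node n1 n2 B r s w1 w2 : (B, r) \in rules D -> generates n1 r w1 ->
    generates n2 s w2 -> generates (n1 + n2).+1 (inl B :: s) (w1 ++ w2).

Lemma generates_derives n s w : generates n s w -> derives s (letters w).
Proof.
elim=> {n s w} [|n a s w _ IH|n1 n2 B r s w1 w2 BD _ IH1 _ IH2].
- exact: rt_refl.
- by apply: (derives_cat (s1 := [:: inr a]) (s1' := [:: inr a])) IH; apply: rt_refl.
- rewrite letters_cat; apply: (derives_cat (s1 := [:: inl B])) IH2.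
  exact: rt_trans (derives_rule BD) IH1.
Qed.

Lemma generates_cat n1 n2 s1 s2 w1 w2 : generates n1 s1 w1 ->
  generates n2 s2 w2 -> exists n, generates n (s1 ++ s2) (w1 ++ w2).
Proof.
move=> g1 g2; elim: g1 => {n1 s1 w1} [|n a s w _ [k IH]|m1 m2 B r s w1' w2' BD g _ _ [k IH]].
- by exists n2.
- by exists k.+1; apply: Gen_letter.
- by exists (m1 + k).+1; rewrite -catA /=; apply: Gen_node BD g IH.
Qed.

Lemma generates_nilP n w : generates n [::] w -> w = [::].
Proof. by move=> g; case Es: _ _ / g. Qed.

Lemma generates_letterP n a s w : generates n (inr a :: s) w ->
  exists n' w', [/\ n = n'.+1, w = a :: w' & generates n' s w'].
Proof.
move=> g; case Es: _ _ / g => [|m a' s' w' g'|] //.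
by case: Es => -> ->; exists m, w'.
Qed.

Lemma generates_nodeP n B s w : generates n (inl B :: s) w ->
  exists n1 n2 r w1 w2, [/\ (B, r) \in rules D, generates n1 r w1,
    generates n2 s w2, n = (n1 + n2).+1 & w = w1 ++ w2].
Proof.
move=> g; case Es: _ _ / g => [||n1 n2 B' r s' w1 w2 BD g1 g2] //.
by case: Es BD => -> ->; exists n1, n2, r, w1, w2.
Qed.

Lemma generates_split n s1 s2 w : generates n (s1 ++ s2) w ->
  exists n1 n2 w1 w2, [/\ generates n1 s1 w1, generates n2 s2 w2 & w = w1 ++ w2].
Proof.
elim: s1 n w => [|[B|a] s1 IH] n w /= g.
- by exists 0%N, n, [::], w; split=> //; apply: Gen_nil.
- have [m1 [m2 [r [w1 [w2 [BD g1 g2 _ ->]]]]]] := generates_nodeP g.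
  have [n1 [n2 [w3 [w4 [g3 g4 ->]]]]] := IH _ _ g2.
  exists (m1 + n1).+1, n2, (w1 ++ w3), w4; rewrite catA; split=> //.
  exact: Gen_node BD g1 g3.
- have [m [w' [_ -> g']]] := generates_letterP g.
  have [n1 [n2 [w3 [w4 [g3 g4 ->]]]]] := IH _ _ g'.
  by exists n1.+1, n2, (a :: w3), w4; split=> //; apply: Gen_letter.
Qed.

Lemma letters_generates w : exists n, generates n (letters w) w.
Proof.
elim: w => [|a w [n IH]]; first by exists 0%N; apply: Gen_nil.
by exists n.+1; apply: Gen_letter.
Qed.

Lemma derives_generates s w : derives s (letters w) -> exists n, generates n s w.
Proof.
move=> /clos_rt_rt1n_iff; move Ew: (letters w) => s' d.
elim: d w Ew => {s s'} [s|s s1 s' [x [y [[B r] [pD -> ->]]]] _ IH] w Ew.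
- by rewrite -Ew; apply: letters_generates.
- have [n] := IH _ Ew => /generates_split[n1 [n2 [w1 [w2 [g1]]]]].
  move=> /generates_split[n3 [n4 [w3 [w4 [g3 g4 -> ->]]]]].
  by apply: (generates_cat g1 (Gen_node pD g3 g4)).
Qed.

(** * Ogden's lemma, with labelled positions *)

Section Chains.
Variables (L : finType) (label : nat -> L) (f : nat -> nat).
Hypothesis f_nondecreasing : {homo f : i j / i <= j}.
Hypothesis f_step : forall i, f i.+1 <= (f i).+1.

(* The number of marked letters in the factor [w] at position [i] of a word,
   where [f i] is the number of marked letters before position [i]. *)
Let content i w := f (i + size w) - f i.

Lemma content_cat i u v : content i (u ++ v) = content i u + content (i + size u) v.
Proof.
have := f_nondecreasing (leq_addr (size u) i).
have := f_nondecreasing (leq_addr (size v) (i + size u)).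
by rewrite /content size_cat addnA; lia.
Qed.

(** These are Ogden's branch points: [k] nested nodes on one path of a parse tree, at each of which
    the marked content of the yield drops strictly. Only the derivations between consecutive nodes
    are recorded, which is what pumping consists of. *)
Fixpoint chain k B i w : Prop :=
  if k is k'.+1 then
    exists C w1 w' w2, [/\ w = w1 ++ w' ++ w2,
      derives [:: inl B] (letters w1 ++ inl C :: letters w2),
      content (i + size w1) w' < content i w & chain k' C (i + size w1) w']
  else derives [:: inl B] (letters w).

Lemma generates_heavy_part n s w i : generates n s w -> 0 < size s ->
  exists s1 X s2 w1 w' w2 n', [/\ s = s1 ++ X :: s2, w = w1 ++ w' ++ w2,
    derives s1 (letters w1) /\ derives s2 (letters w2),
    generates n' [:: X] w' /\ n' <= n &
    content i w <= size s * content (i + size w1) w'].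
Proof.
move=> g; elim: g i => {n s w} [//|n a s w g IH|n1 n2 B r s w1 w2 BD g1 _ g2 IH] i _.
- case: (ltnP 0 (size s)) => [s0|]; last first.
    case: s g {IH} => // g _; exists [::], (inr a), [::], [::], [:: a], w, 1%N.
    have w0 := generates_nilP g.
    rewrite w0 addn0; split=> //; first by split; apply: rt_refl.
    + by split=> //; apply: (Gen_letter _ Gen_nil).
    + by rewrite mul1n.
  have [s1 [X [s2 [v1 [v' [v2 [n' [Es Ew [d1 d2] [gX nX] le]]]]]]]] := IH (i + 1) s0.
  subst s w.
  case: (leqP (content i [:: a]) (content (i + 1 + size v1) v')) => cmp.
    exists (inr a :: s1), X, s2, (a :: v1), v', v2, n'; split=> //.
    + split=> //; apply: (derives_cat (s1 := [:: inr a]) (s1' := [:: inr a])) d1.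
      exact: rt_refl.
    + by split=> //; apply: leqW.
    + rewrite [content i _](content_cat i [:: a]) mulSn.
      by have -> : i + size (a :: v1) = i + 1 + size v1; [rewrite /=; lia|apply: leq_add].
  exists [::], (inr a), (s1 ++ X :: s2), [::], [:: a], (v1 ++ v' ++ v2), 1%N.
  rewrite addn0; split=> //.
  + split; first exact: rt_refl.
    exact: generates_derives g.
  + by split=> //; apply: (Gen_letter _ Gen_nil).
  + rewrite [content i _](content_cat i [:: a]) mulSn leq_add2l.
    by apply: leq_trans le _; rewrite leq_mul2l ltnW ?orbT.
- have gB : generates n1.+1 [:: inl B] w1.
    by have := Gen_node BD g1 Gen_nil; rewrite addn0 cats0.
  case: (ltnP 0 (size s)) => [s0|]; last first.
    case: s g2 {IH} => // g2 _; exists [::], (inl B), [::], [::], w1, w2, n1.+1.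
    have w0 := generates_nilP g2.
    rewrite w0 addn0 cats0; split=> //; first by split; apply: rt_refl.
    + by split=> //; rewrite ltnS leq_addr.
    + by rewrite mul1n.
  have [s1 [X [s2 [v1 [v' [v2 [n' [Es Ew [d1 d2] [gX nX] le]]]]]]]] := IH (i + size w1) s0.
  subst s w2.
  case: (leqP (content i w1) (content (i + size w1 + size v1) v')) => cmp.
    exists (inl B :: s1), X, s2, (w1 ++ v1), v', v2, n'; split=> //.
    + by rewrite -catA.
    + split=> //; rewrite letters_cat; apply: (derives_cat (s1 := [:: inl B])) d1.
      exact: generates_derives gB.
    + by split=> //; apply: leqW; apply: leq_trans nX (leq_addl _ _).
    + rewrite content_cat size_cat addnA mulSn.
      exact: leq_add.
  exists [::], (inl B), (s1 ++ X :: s2), [::], w1, (v1 ++ v' ++ v2), n1.+1.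
  rewrite addn0; split=> //.
  + split; first exact: rt_refl.
    exact: generates_derives g2.
  + by split=> //; rewrite ltnS leq_addr.
  + rewrite content_cat mulSn leq_add2l.
    by apply: leq_trans le _; rewrite leq_mul2l ltnW ?orbT.
Qed.

Variable b : nat.
Hypothesis b_gt1 : 1 < b.
Hypothesis b_rules : forall p, p \in rules D -> size p.2 <= b.

(** Descend from the root into the heaviest child. This divides the marked content by at most [b],
    so a content above [b ^ k] survives [k] branch points. The derivation in the conclusion leads
    down to the top of the chain. *)
Lemma long_chain n B w i k : generates n [:: inl B] w -> b ^ k < content i w ->
  exists C w1 w' w2, [/\ w = w1 ++ w' ++ w2,
    derives [:: inl B] (letters w1 ++ inl C :: letters w2) &
    chain k C (i + size w1) w'].
Proof.
elim/ltn_ind: n B w i k => n IH B w i k g lt.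
have [n1 [n2 [r [w1 [w2 [BD g1 /generates_nilP-> En Ew]]]]]] := generates_nodeP g.
move: Ew lt IH; rewrite En cats0 => {n w g En} -> lt IH.
case: k => [|k] in lt *.
  exists B, [::], w1, [::]; rewrite cats0; split=> //; first exact: rt_refl.
  exact: rt_trans (derives_rule BD) (generates_derives g1).
have r0 : 0 < size r.
  case: r BD g1 => // _ /generates_nilP w10.
  by move: lt; rewrite w10 /content addn0 subnn.
have [s1 [X [s2 [v1 [v' [v2 [n' [Er Ew [d1 d2] [gX nX] le]]]]]]]] :=
  generates_heavy_part i g1 r0.
have ltv : b ^ k < content (i + size v1) v'.
  have := leq_trans le (leq_mul (b_rules BD) (leqnn _)) => /(leq_trans lt).
  by rewrite expnS ltn_pmul2l // ltnW.
(* A single letter has content at most 1, too little for [ltv]. *)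
case: X => [C|a] in Er gX; last first.
  have [m [w' [_ Ev /generates_nilP w'0]]] := generates_letterP gX.
  move: ltv; rewrite Ev w'0 /content addn1 => ltv.
  have : 0 < b ^ k by rewrite expn_gt0 ltnW.
  by have := f_step (i + size v1); lia.
have dB (v : symbols) : derives [:: inl C] v -> derives [:: inl B] (letters v1 ++ v ++ letters v2).
  move=> d; apply: rt_trans (derives_rule BD) _; rewrite Er.
  by apply: derives_cat d1 (derives_cat (s1 := [:: inl C]) d d2).
have sub u u' (E : N) : derives [:: inl C] (letters u ++ inl E :: letters u') ->
    derives [:: inl B] (letters (v1 ++ u) ++ inl E :: letters (u' ++ v2)).
  by move=> /dB; rewrite !letters_cat -!catA.
have nn : n' < (n1 + n2).+1 by rewrite ltnS; apply: leq_trans nX (leq_addr _ _).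
(* If the child loses marked letters, this node is a branch point and joins the chain. Otherwise the
   child still has content above [b ^ k.+1], and the search goes on below it for a chain of the same
   length. *)
case: (ltnP (content (i + size v1) v') (content i w1)) => [lt'|le'].
  have [E [u1 [u' [u2 [Ev d ch]]]]] := IH _ nn _ _ _ _ gX ltv.
  exists B, [::], w1, [::]; rewrite cats0 addn0; split=> //; first exact: rt_refl.
  exists E, (v1 ++ u1), u', (u2 ++ v2); split.
  - by rewrite Ew Ev -!catA.
  - exact: sub.
  - rewrite size_cat addnA; apply: leq_ltn_trans lt'.
    by rewrite Ev !content_cat; lia.
  - by rewrite size_cat addnA.
have [E [u1 [u' [u2 [Ev d ch]]]]] := IH _ nn _ _ _ _ gX (leq_trans lt le').
exists E, (v1 ++ u1), u', (u2 ++ v2); split.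
- by rewrite Ew Ev -!catA.
- exact: sub.
- by rewrite size_cat addnA.
Qed.

(** The last condition says that [v] or [y] contains a marked letter; the label conditions say that
    the two ends of [v] look alike, and so do those of [y]. *)
Definition pumpable S0 W := exists u B v x y z,
  [/\ W = u ++ v ++ x ++ y ++ z,
      derives [:: inl S0] (letters u ++ inl B :: letters z) /\
      derives [:: inl B] (letters v ++ inl B :: letters y),
      derives [:: inl B] (letters x),
      label (size u) = label (size (u ++ v)) /\
      label (size (u ++ v ++ x)) = label (size (u ++ v ++ x ++ y)) &
      content (size (u ++ v)) x < content (size u) (v ++ x ++ y)].

Lemma chain_derives k B i w : chain k B i w -> derives [:: inl B] (letters w).
Proof.
elim: k B i w => //= k IH B i w [C [w1 [w' [w2 [-> d _ /IH dC]]]]].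
apply: rt_trans d _; rewrite !letters_cat.
by apply: derives_ctx dC.
Qed.

Lemma derives_nest B C E u1 u2 v1 v2 :
  derives [:: inl B] (letters u1 ++ inl C :: letters u2) ->
  derives [:: inl C] (letters v1 ++ inl E :: letters v2) ->
  derives [:: inl B] (letters (u1 ++ v1) ++ inl E :: letters (v2 ++ u2)).
Proof.
move=> d1 d2; apply: rt_trans d1 _.
by have := derives_ctx (letters u1) (letters u2) d2; rewrite !letters_cat /= -!catA.
Qed.

(** [F] collects the nonterminals of the ancestors together with the labels at both ends of their
    yields. The current node either repeats an element of [F], which gives the pumping, or is added
    to [F]. A chain with as many steps as the complement of [F] has elements must run into a
    repetition. *)
Lemma chain_pumpable (S0 : N) W k B u w z (F : {set N * L * L}) :
  chain k B (size u) w -> W = u ++ w ++ z ->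
  derives [:: inl S0] (letters u ++ inl B :: letters z) ->
  #|~: F| <= k ->
  (forall t, t \in F -> exists u0 v y z0, [/\ u = u0 ++ v /\ z = y ++ z0,
     derives [:: inl S0] (letters u0 ++ inl t.1.1 :: letters z0),
     derives [:: inl t.1.1] (letters v ++ inl B :: letters y),
     label (size u0) = t.1.2 /\ label (size (u0 ++ v ++ w ++ y)) = t.2 &
     content (size u) w < content (size u0) (v ++ w ++ y)]) ->
  pumpable S0 W.
Proof.
elim: k B u w z F => [|k IH] B u w z F ch EW dS cF anc;
  have dB := chain_derives ch;
  have seen : (B, label (size u), label (size (u ++ w))) \in F -> pumpable S0 W;
  try by move=> /anc[u0 [v [y [z0 [[Eu Ez] /= d0 d [l1 l2] lt]]]]];
    exists u0, B, v, w, y, z0; rewrite -Eu; split=> //;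
      rewrite ?EW ?Eu ?Ez -?catA //; split; rewrite ?l1 ?l2 ?Eu -?catA.
- by apply: seen; move: cF; rewrite leqn0 cards_eq0 -finset.setCT (inj_eq (@finset.setC_inj _)) => /eqP->; rewrite inE.
- case: (boolP (_ \in F)) seen => [_ /(_ isT)//|tF _].
  case: ch => C [w1 [w' [w2 [Ew d lt ch]]]].
  apply: (IH C (u ++ w1) w' (w2 ++ z) ((B, label (size u), label (size (u ++ w))) |: F)).
  + by rewrite size_cat.
  + by rewrite EW Ew -!catA.
  + exact: derives_nest dS d.
  + move: cF; rewrite finset.setCU (cardsD1 (B, label (size u), label (size (u ++ w))) (~: F)).
    by rewrite inE tF add1n ltnS finset.setIC finset.setDE.
  + move=> t /setU1P[->/=|/anc[u0 [v [y [z0 [[Eu Ez] d0 d' [l1 l2] lt']]]]]].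
      exists u, w1, w2, z; split=> //; first by rewrite -Ew.
      by rewrite size_cat -Ew.
    exists u0, (v ++ w1), (w2 ++ y), z0; split=> //.
    * by rewrite Eu Ez -!catA.
    * exact: derives_nest d' d.
    * by move: l2; rewrite Ew -!catA.
    * have -> : (v ++ w1) ++ w' ++ w2 ++ y = v ++ w ++ y by rewrite Ew -!catA.
      by apply: ltn_trans lt'; rewrite size_cat.
Qed.

Lemma heavy_pumpable S0 W n : generates n [:: inl S0] W ->
  b ^ #|{: N * L * L}| < content 0 W -> pumpable S0 W.
Proof.
move=> g /(long_chain g)[C [w1 [w' [w2 [EW d ch]]]]].
apply: (chain_pumpable (F := finset.set0) ch EW d) => [|t]; last by rewrite inE.
by rewrite finset.setC0 cardsT.
Qed.

End Chains.

End Pumping.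

Section Repeat.
Variable A : Type.
Implicit Types (x r v z : seq A).

Definition repeat n x : seq A := flatten (nseq n x).

Lemma repeatD m n x : repeat (m + n) x = repeat m x ++ repeat n x.
Proof. by rewrite /repeat nseqD flatten_cat. Qed.

Lemma repeatS n x : repeat n.+1 x = x ++ repeat n x.
Proof. by []. Qed.

Lemma size_repeat n x : size (repeat n x) = n * size x.
Proof. by elim: n => // n IH; rewrite repeatS size_cat IH. Qed.

Lemma eq_cat_split (a b c d : seq A) : a ++ b = c ++ d -> size a <= size c ->
  exists e, c = a ++ e /\ b = e ++ d.
Proof.
elim: a c => [|y a IH] [|y' c] //= E le; try by [exists [::]|exists (y' :: c)].
by case: E => -> /IH /(_ le)[e [-> ->]]; exists e.
Qed.

Lemma take_repeat k m n x : k <= m * size x -> m <= n ->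
  take k (repeat n x) = take k (repeat m x).
Proof.
by move=> km /subnKC<-; rewrite repeatD takel_cat // size_repeat.
Qed.

(** A factor of [x^n] whose length is a multiple of [size x] is a power of a conjugate of [x]. Hence
    [r ++ v] equals [x^p ++ r], and every further copy of [v] inserts one more [x^p]. *)
Lemma repeat_pump x n p r v z w : repeat n x ++ w = r ++ v ++ z ->
  size r + size v <= n * size x -> size v = p * size x ->
  forall i, r ++ repeat i.+1 v ++ z = repeat (n + p * i) x ++ w.
Proof.
case: (posnP (size x)) => [x0|x0] E le Ev i.
  have v0 : v = [::] by apply/size0nil; rewrite Ev x0 muln0.
  have /size0nil x0' := x0; rewrite x0' in E *.
  have e k : repeat k [::] = [::] :> seq A by apply/size0nil; rewrite size_repeat muln0.
  by move: E; rewrite v0 !e.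
have pn : p <= n.
  rewrite -(leq_pmul2r x0) -Ev; apply: leq_trans le; exact: leq_addl.
have rle : size r <= (n - p) * size x by rewrite mulnBl -Ev; lia.
have rv : r ++ v = repeat p x ++ r.
  have Er : r = take (size r) (repeat n x).
    rewrite -(takel_cat w); first by rewrite E take_size_cat.
    by rewrite size_repeat; lia.
  have -> : r ++ v = take (size (r ++ v)) (repeat n x).
    rewrite -(takel_cat w); first by rewrite E catA take_size_cat.
    by rewrite size_repeat size_cat.
  rewrite {2}Er (take_repeat rle (leq_subr _ _)).
  rewrite -{1}(subnKC pn) repeatD take_cat size_repeat size_cat Ev.
  by rewrite ltnNge leq_addl /= addnK.
have {}rv k : r ++ repeat k v = repeat (p * k) x ++ r.
  elim: k => [|k IH]; first by rewrite muln0 cats0.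
  by rewrite repeatS catA rv -catA IH catA -repeatD mulnS.
rewrite -(addn1 i) repeatD -catA catA rv -catA (cats0 v : repeat 1 v = v) -E catA -repeatD.
by rewrite addnC.
Qed.

End Repeat.

Section PumpPower.
Variables (A : eqType) (D : cfg A).
Local Notation letters := (letters D).
Local Notation derives := (clos_refl_trans _ (@cfg_step A D)).

Lemma derives_repeat (S0 B : nonterminal D) (u v x y z : seq A) i :
  derives [:: inl S0] (letters u ++ inl B :: letters z) ->
  derives [:: inl B] (letters v ++ inl B :: letters y) ->
  derives [:: inl B] (letters x) ->
  derives [:: inl S0] (letters (u ++ repeat i v ++ x ++ repeat i y ++ z)).
Proof.
move=> d1 d2 dx.
have dv : derives [:: inl B] (letters (repeat i v ++ x ++ repeat i y)).
  elim: i => [|i IH]; first by rewrite cats0.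
  rewrite repeatS -(addn1 i) repeatD [repeat 1 y]cats0.
  apply: rt_trans d2 _; have := derives_ctx (letters v) (letters y) IH.
  by rewrite !letters_cat -!catA.
apply: rt_trans d1 _; have := derives_ctx (letters u) (letters z) dv.
by rewrite !letters_cat -!catA.
Qed.

(* Ogden's argument with the letters of [x^n] marked.  Besides a nonterminal,
   each node remembers on which side of [x^n], or at which position modulo
   [size x], its endpoints lie: this forces a pumped factor which meets [x^n]
   to be, up to conjugation, a power of [x]. *)
Lemma cfg_pump_power (x : seq A) : 0 < size x ->
  exists K, forall n (U V : seq A), K <= n ->
    cfg_language D (U ++ repeat n x ++ V) -> exists2 p, 0 < p &
      (forall i, exists V', cfg_language D (U ++ repeat (n + p * i) x ++ V')) \/
      (forall i, exists U', cfg_language D (U' ++ repeat (n + p * i) x ++ V)).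
Proof.
move=> x0; pose X := size x.
pose L : finType := 'I_X.+2.
pose b := (\max_(p <- rules D) size p.2).+2.
have b_rules p : p \in rules D -> size p.2 <= b.
  by move=> pD; do 2!apply: leqW; exact: leq_bigmax_seq.
exists (b ^ #|{: nonterminal D * L * L}|).+1 => n U V Kn.
set W := U ++ _ => /derives_generates[k g].
pose lo := size U; pose hi := lo + n * X.
(* Up to the constant [lo], this counts the letters of [x^n] before position [i]; only differences
   of [f] matter. *)
pose f i := minn (maxn i lo) hi.
have EW : W = U ++ repeat n x ++ V by [].
pose label i : L := if i < lo then inord 0 else if hi < i then inord 1
  else inord ((i - lo) %% X + 2).
have label_eq i j : i <= j -> label i = label j ->
    [\/ j < lo, hi < i | [/\ lo <= i, j <= hi & exists p, j - i = p * X]].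
  have loh : lo <= hi by apply: leq_addr.
  have mX l : (l - lo) %% X < X by apply: ltn_pmod.
  move=> ij; rewrite /label => /(congr1 val).
  case: (ltnP i lo) => i1; case: (ltnP j lo) => j1 //=; try by constructor 1.
  - by case: (ltnP hi j) => j2; rewrite !inordK ?addn2 // ?ltnS.
  - case: (ltnP hi i) => i2; first by constructor 2.
    case: (ltnP hi j) => j2; rewrite !inordK ?addn2 ?ltnS //.
    move=> /succn_inj/succn_inj Em; constructor 3; split=> //.
    exists ((j - lo) %/ X - (i - lo) %/ X).
    have -> : j - i = (j - lo) - (i - lo) by lia.
    rewrite {1}(divn_eq (j - lo) X) {1}(divn_eq (i - lo) X) Em mulnBl; lia.
have fh : {homo f : i j / i <= j} by move=> i j ij; rewrite /f; lia.
have fS i : f i.+1 <= (f i).+1 by rewrite /f; lia.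
have W_heavy : b ^ #|{: nonterminal D * L * L}| < f (0 + size W) - f 0.
  apply: (leq_trans Kn); rewrite /W !size_cat size_repeat -/X -/lo /f /hi.
  have : n * 1 <= n * X by rewrite leq_mul2l x0 orbT.
  lia.
have [u [B [v [x0' [y [z [EW' [d1 d2] d3 [l1 l2] lt]]]]]]] :=
  heavy_pumpable label fh fS (isT : 1 < b) b_rules g W_heavy.
have dr i := derives_repeat i d1 d2 d3.
move: lt; rewrite !size_cat addnA => lt {W_heavy Kn fh fS b_rules g}.
have := label_eq _ _ _ l1; rewrite !size_cat => /(_ (leq_addr _ _)).
have := label_eq _ _ _ l2; rewrite !size_cat !addnA => /(_ (leq_addr _ _)).
have E : U ++ repeat n x ++ V = u ++ v ++ x0' ++ y ++ z by [].
move: lt; rewrite /f !addnA => lt {l1 l2 label_eq}.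
(* Equal labels keep each of [v] and [y] on one side of [x^n] or inside it, and one of them contains
   a marked letter. This leaves three of the nine cases. *)
case=> [t1|t1|[t1 t2 [q Eq]]]; (case=> [s1|s1|[s1 s2 [p Ep]]]); try (exfalso; lia).
- (* only v meets x^n *)
  move: Ep; rewrite addKn => Ep.
  have p0 : 0 < p by case: (posnP p) => // p0; move: Ep lt; rewrite p0; lia.
  exists p => //; left => i.
  have [|r [E1 E2]] := eq_cat_split (a := U) (b := repeat n x ++ V) (c := u)
    (d := v ++ x0' ++ y ++ z) E; first by [].
  have [||z0 [E3 E4]] := eq_cat_split (a := repeat n x) (b := V) (c := r ++ v ++ x0')
    (d := y ++ z); first by rewrite E2 -!catA.
    have : size u = lo + size r by rewrite E1 size_cat.
    by rewrite size_repeat !size_cat; move: t1; rewrite /hi -/X; lia.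
  exists (z0 ++ repeat i.+1 y ++ z).
  have su : size u = lo + size r by rewrite E1 size_cat.
  have := repeat_pump (esym E3) _ Ep => /(_ _ i) Ei; rewrite [repeat _ x ++ _]catA -Ei; last first.
    by move: s2; rewrite /hi -/X; lia.
  by have := dr i.+1; rewrite E1 -!catA.
- (* only y meets x^n *)
  move: Eq; rewrite addKn => Eq.
  have q0 : 0 < q by case: (posnP q) => // q0; move: Eq lt; rewrite q0; lia.
  exists q => //; right => i.
  have [||z0 [E1 E2]] := eq_cat_split (a := u ++ v) (b := x0' ++ y ++ z) (c := U)
    (d := repeat n x ++ V); first by rewrite -catA E.
    by rewrite size_cat; lia.
  have [||r [E3 E4]] := eq_cat_split (a := z0) (b := repeat n x ++ V) (c := x0')
    (d := y ++ z); first by rewrite E2.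
    have := congr1 size E1; rewrite !size_cat -/lo; lia.
  have sz : size U = size u + size v + size z0 by rewrite E1 !size_cat.
  have sx : size x0' = size z0 + size r by rewrite E3 size_cat.
  exists (u ++ repeat i.+1 v ++ z0).
  rewrite -(repeat_pump E4 _ Eq); last first.
    by move: t2; rewrite /hi /lo -/X; lia.
  by have := dr i.+1; rewrite E3 -!catA.
- (* both do *)
  move: Ep Eq; rewrite !addKn => Ep Eq.
  exists (p + q); first by case: (posnP (p + q)) => // /eqP; rewrite addn_eq0 =>
    /andP[/eqP p0 /eqP q0]; move: Ep Eq lt; rewrite p0 q0; lia.
  left => i; exists V.
  have [|r [E1 E2]] := eq_cat_split (a := U) (b := repeat n x ++ V) (c := u)
    (d := v ++ x0' ++ y ++ z) E; first by [].
  have su : size u = lo + size r by rewrite E1 size_cat.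
  have E3 : repeat n x ++ V = (r ++ v ++ x0') ++ y ++ z by rewrite E2 -!catA.
  have := repeat_pump E3 _ Eq => /(_ _ i) E4.
  have {}E4 : repeat (n + q * i) x ++ V = r ++ v ++ (x0' ++ repeat i.+1 y ++ z).
    by rewrite -E4 -?catA // !size_cat; move: t2; rewrite /hi -/X; lia.
  have := repeat_pump E4 _ Ep => /(_ _ i).
  rewrite -addnA -mulnDl [q + p]addnC => <-; last first.
    by rewrite -/X mulnDl; move: s2; rewrite /hi; lia.
  by have := dr i.+1; rewrite E1 -!catA.
Qed.

End PumpPower.

(** * Subgroups and word length *)

Section SubgroupTheory.
Variables (G : groupType) (H : set G).

Lemma subgroupP : subgroup H <->
  [/\ H 1%g, forall x y, H x -> H y -> H (x * y)%g & forall x, H x -> H (x^-1)%g].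
Proof.
split=> [sH|[H1 HM HV]].
- have [H1 _] := sH; have HV := group_closedV sH; have HM := group_closedM sH.
  split=> [|x y Hx Hy|x Hx]; first by rewrite inE in H1.
    by have := HM x y; rewrite !inE; apply.
  by have := HV x; rewrite !inE; apply.
- split; first by rewrite inE.
  by move=> x y; rewrite !inE => Hx Hy; apply: HM => //; apply: HV.
Qed.

Hypothesis sH : subgroup H.

Lemma subgroup1 : H 1%g. Proof. by case/subgroupP: sH. Qed.

Lemma subgroupM x y : H x -> H y -> H (x * y)%g.
Proof. by case/subgroupP: sH => _ + _; apply. Qed.

Lemma subgroupV x : H x -> H (x^-1)%g.
Proof. by case/subgroupP: sH => _ _; apply. Qed.

Lemma subgroupX x n : H x -> H (x ^+ n)%g.
Proof.
move=> Hx; elim: n => [|n IH]; first exact: subgroup1.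
by rewrite expgS; apply: subgroupM.
Qed.

Lemma subgroupVr x : H (x^-1)%g -> H x.
Proof. by rewrite -{2}[x]invgK; apply: subgroupV. Qed.

Lemma subgroupMl x y : H y -> H (x * y)%g -> H x.
Proof. by move=> Hy Hxy; rewrite -(mulgK y x); apply: subgroupM => //; apply: subgroupV. Qed.

Lemma subgroupJ x y : H x -> H y -> H (x ^ y)%g.
Proof.
move=> Hx Hy; rewrite conjgE.
by apply: subgroupM; [apply: subgroupV|apply: subgroupM].
Qed.

Lemma subgroupR x y : H x -> H y -> H [~ x, y]%g.
Proof.
by move=> Hx Hy; rewrite commgEl; apply: subgroupM; [apply: subgroupV|apply: subgroupJ].
Qed.

End SubgroupTheory.

Section Generated.
Variable G : groupType.
Implicit Types (A B H : set G) (g x y : G).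

Lemma subgroup_generated A : subgroup (generated A).
Proof.
apply/subgroupP; split=> [B [sB _]|x y Ax Ay B [sB AB]|x Ax B [sB AB]].
- exact: subgroup1 sB.
- by apply: subgroupM => //; [apply: Ax|apply: Ay].
- by apply: subgroupV => //; apply: Ax.
Qed.

Lemma sub_generated A : A `<=` generated A.
Proof. exact: sub_gen_smallest. Qed.

Lemma generated_sub A H : subgroup H -> A `<=` H -> generated A `<=` H.
Proof. exact: smallest_sub. Qed.

Lemma generated_subset A B : A `<=` B -> generated A `<=` generated B.
Proof.
by move=> AB; apply: generated_sub; [apply: subgroup_generated|
  apply: subset_trans AB (@sub_generated B)].
Qed.

Lemma eval_nil : eval ([::] : seq G) = 1%g. Proof. exact: big_nil. Qed.

Lemma eval_cons x w : eval (x :: w) = (x * eval w)%g. Proof. exact: big_cons. Qed.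

Lemma eval_cat (u v : seq G) : eval (u ++ v) = (eval u * eval v)%g.
Proof. exact: big_cat. Qed.

Lemma eval1 x : eval [:: x] = x. Proof. by rewrite eval_cons eval_nil mulg1. Qed.

Lemma eval_nseq n x : eval (nseq n x) = (x ^+ n)%g.
Proof. by elim: n => [|n IH]; rewrite ?eval_nil //= eval_cons IH expgS. Qed.

Lemma words_cat A (u v : seq G) : words A (u ++ v) <-> words A u /\ words A v.
Proof.
split=> [Auv|[Au Av] x]; last by rewrite mem_cat => /orP[/Au|/Av].
by split=> x xu; apply: Auv; rewrite mem_cat xu ?orbT.
Qed.

Lemma eval_words A H w : subgroup H -> A `<=` H -> words A w -> H (eval w).
Proof.
move=> sH AH; elim: w => [|x w IH] Aw; first by rewrite eval_nil; apply: subgroup1.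
rewrite eval_cons; apply: subgroupM => //; first by apply/AH/Aw; rewrite mem_head.
by apply: IH => y yw; apply: Aw; rewrite inE yw orbT.
Qed.

Lemma words_rev A w : (forall x, A x -> A (x^-1)%g) -> words A w ->
  words A (rev ([seq (x^-1)%g | x <- w])).
Proof. by move=> AV Aw x; rewrite mem_rev => /mapP[y /Aw Ay ->]; apply: AV. Qed.

Lemma eval_rev w : eval (rev ([seq (x^-1)%g | x <- w])) = ((eval w)^-1)%g.
Proof.
elim: w => [|x w IH] /=; first by rewrite eval_nil invg1.
by rewrite rev_cons -cats1 eval_cat IH eval1 eval_cons invgM.
Qed.

Lemma generated_words A g : (forall x, A x -> A (x^-1)%g) -> generated A g ->
  exists2 w, words A w & eval w = g.
Proof.
move=> AV; apply: (@generated_sub A [set g | exists2 w, words A w & eval w = g]).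
- apply/subgroupP; split=> [|x y [u Au <-] [v Av <-]|x [u Au <-]].
  + by exists [::] => //; apply: eval_nil.
  + by exists (u ++ v); [apply/words_cat|apply: eval_cat].
  + by exists (rev ([seq (x^-1)%g | x <- u])); [apply: words_rev|apply: eval_rev].
- move=> x Ax; exists [:: x]; last exact: eval1.
  by move=> y; rewrite inE => /eqP->.
Qed.

Definition geodesic A g : seq G :=
  xget [::] [set w | [/\ words A w, eval w = g & size w = word_length A g]].

Section Length.
Variables (H A : set G).
Hypothesis genA : finite_generating_set H A.
Local Notation len := (word_length A).

Lemma fgs_symm x : A x -> A (x^-1)%g. Proof. by case: genA => _ + _; apply. Qed.

Lemma fgs_generated : generated A = H. Proof. by case: genA. Qed.

Lemma fgs_subgroup : subgroup H.
Proof. rewrite -fgs_generated; exact: subgroup_generated. Qed.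

Lemma fgs_sub : A `<=` H.
Proof. rewrite -fgs_generated; exact: sub_generated. Qed.

Lemma fgs_words g : H g -> exists2 w, words A w & eval w = g.
Proof. by rewrite -fgs_generated; apply: generated_words; apply: fgs_symm. Qed.

Lemma words_fgs w : words A w -> H (eval w).
Proof. exact: eval_words fgs_subgroup fgs_sub. Qed.

Lemma word_lengthP g : H g ->
  (exists w, [/\ words A w, eval w = g & size w = len g ]) /\
  (forall w, words A w -> eval w = g -> len g <= size w).
Proof.
move=> /fgs_words[w0 Aw0 Ew0]; rewrite /word_length.
have ex : exists n, `[< exists w, [/\ words A w, eval w = g & size w = n] >].
  by exists (size w0); apply/asboolP; exists w0.
apply: (xgetPex 0 (P := [set n | (exists w, [/\ words A w, eval w = g & size w = n]) /\
  (forall w, words A w -> eval w = g -> n <= size w)])).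
case: (ex_minnP ex) => n /asboolP wn nmin; exists n; split=> // w Aw Ew.
by apply: nmin; apply/asboolP; exists w.
Qed.

Lemma word_length_le w : words A w -> len (eval w) <= size w.
Proof. by move=> Aw; apply: (word_lengthP (words_fgs Aw)).2. Qed.

Lemma geodesicP g : H g ->
  [/\ words A (geodesic A g), eval (geodesic A g) = g & size (geodesic A g) = len g ].
Proof.
move=> /word_lengthP[ex _]; rewrite /geodesic.
exact: (xgetPex [::] (P := [set w | [/\ words A w, eval w = g & size w = len g ]])).
Qed.

Lemma word_lengthM g h : H g -> H h -> len (g * h)%g <= len g + len h.
Proof.
move=> /geodesicP[Ag Eg <-] /geodesicP[Ah Eh <-].
rewrite -size_cat -{1}Eg -{1}Eh -eval_cat; apply: word_length_le.
exact/words_cat.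
Qed.

Lemma word_length1 : len 1%g = 0.
Proof.
apply/eqP; rewrite -leqn0 -[1%g]eval_nil; exact: (@word_length_le [::]).
Qed.

Lemma word_lengthV g : H g -> len (g^-1)%g = len g.
Proof.
suff le h : H h -> len (h^-1)%g <= len h.
  move=> Hg; apply/eqP; rewrite eqn_leq le //= -{1}[g]invgK le //.
  exact: subgroupV fgs_subgroup _ Hg.
move=> /geodesicP[Ag Eg <-].
rewrite -{1}Eg -eval_rev -[X in _ <= X](size_map (fun x : G => (x^-1)%g)) -size_rev.
by apply: word_length_le; apply: words_rev => //; apply: fgs_symm.
Qed.

Lemma word_length_eq0 g : H g -> (len g == 0) = (g == 1%g).
Proof.
move=> Hg; apply/eqP/eqP => [|->]; last exact: word_length1.
by have [_ Eg <-] := geodesicP Hg => /size0nil E; rewrite -Eg E eval_nil.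
Qed.

Lemma word_length_letter x : A x -> len x <= 1.
Proof.
move=> Ax; rewrite -[x in len x]eval1; apply: (@word_length_le [:: x]).
by move=> y; rewrite inE => /eqP->.
Qed.

Lemma word_lengthX g n : H g -> len (g ^+ n)%g <= n * len g.
Proof.
move=> Hg; elim: n => [|n IH]; first by rewrite expg0 word_length1.
rewrite expgS mulSn; apply: leq_trans (word_lengthM _ _) _ => //.
- exact: (subgroupX fgs_subgroup n Hg).
- by rewrite leq_add2l.
Qed.

Lemma word_lengthMr g h : H g -> H h -> len g <= len (g * h)%g + len h.
Proof.
move=> Hg Hh; rewrite -(word_lengthV Hh) -{1}[g](mulgK h).
have := fgs_subgroup => sH.
by apply: word_lengthM; [apply: subgroupM|apply: subgroupV].
Qed.

Lemma word_lengthMl g h : H g -> H h -> len h <= len (g * h)%g + len g.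
Proof.
move=> Hg Hh; rewrite -(word_lengthV Hg) -{1}[h](mulKg g) addnC.
have := fgs_subgroup => sH.
by apply: word_lengthM; [apply: subgroupV|apply: subgroupM].
Qed.

Lemma geodesic_letters g x : H g -> x \in geodesic A g -> x != 1%g /\ A x.
Proof.
move=> Hg xg; have [Ag Eg sg] := geodesicP Hg; split; last exact: Ag.
apply/eqP => x1; case/splitPr: xg Ag Eg sg => u v Ag Eg sg.
have Auv : words A (u ++ v).
  by move=> y; rewrite mem_cat => yuv; apply: Ag; rewrite mem_cat inE orbCA yuv orbT.
have := word_length_le Auv.
rewrite eval_cat -[eval v]mul1g -{1}x1 -eval_cons -eval_cat Eg -sg !size_cat /=.
lia.
Qed.

Lemma geodesic_factor g u v w : H g -> geodesic A g = u ++ v ++ w ->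
  len (eval v) = size v.
Proof.
move=> Hg E; have [Ag Eg sg] := geodesicP Hg.
have := Ag; rewrite E => /words_cat[Au /words_cat[Av Aw]].
apply/eqP; rewrite eqn_leq word_length_le //=.
have := words_fgs Au; have := words_fgs Av; have := words_fgs Aw => Hw Hv Hu.
have := word_lengthM Hu (subgroupM fgs_subgroup Hv Hw).
have := word_lengthM Hv Hw; have := word_length_le Au; have := word_length_le Aw.
rewrite -!eval_cat -E Eg -sg E !size_cat; lia.
Qed.

Lemma fgs_bound (f : G -> nat) : exists C, forall x, A x -> f x <= C.
Proof.
have [s As] : exists s : seq G, forall x, A x -> x \in s.
  have [/finite_seqP[s ->] _ _] := genA.
  by exists s.
exists (\max_(x <- s) f x) => x /As xs; exact: leq_bigmax_seq.
Qed.

End Length.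

End Generated.

Section LengthComparison.
Variable G : groupType.
Implicit Types (A B H S : set G).

Lemma word_length_eval H A w c : finite_generating_set H A ->
  (forall x, x \in w -> H x /\ word_length A x <= c) ->
  H (eval w) /\ word_length A (eval w) <= c * size w.
Proof.
move=> genA; elim: w => [|x w IH] Hw.
  by rewrite eval_nil (word_length1 genA); split=> //; apply: subgroup1 (fgs_subgroup genA).
have [Hx xc] := Hw x (mem_head _ _).
have [|Hw' wc] := IH; first by move=> y yw; apply: Hw; rewrite inE yw orbT.
rewrite eval_cons mulnS; split; first exact: (subgroupM (fgs_subgroup genA) Hx Hw').
by apply: leq_trans (word_lengthM genA Hx Hw') (leq_add xc wc).
Qed.

Lemma word_length_change H A B : finite_generating_set H A ->
  finite_generating_set H B ->
  exists C, forall h, H h -> word_length B h <= C * word_length A h.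
Proof.
move=> genA genB; have [C CP] := fgs_bound genA (word_length B).
exists C => h /(geodesicP genA)[Ah Eh <-]; rewrite -{1}Eh.
apply: (word_length_eval genB _).2 => x /Ah Ax; split; last exact: CP.
exact: (fgs_sub genA).
Qed.

Lemma undistorted_word_length (R : realType) H S : undistorted R H ->
  finite_generating_set setT S -> exists2 T, finite_generating_set H T &
    exists C, forall h, H h -> word_length T h <= C * word_length S h + C.
Proof.
move=> [T [S0 [genT genS0 [A [B [A1 B0 HAB]]]]]] genS; exists T => //.
have [c cP] := word_length_change genS genS0.
have A0 : (0 < A)%R by apply: lt_le_trans A1.
have [k kP] : exists k : nat, (A * (c%:R + B) <= k%:R)%R.
  exists (Num.bound (A * (c%:R + B))); apply/ltW/archi_boundP.
  by rewrite mulr_ge0 ?addr_ge0 ?ler0n // ltW.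
exists k => h Hh; have [le _] := HAB h Hh.
rewrite -(ler_nat R) natrD natrM.
have {}le : ((word_length T h)%:R <= A * ((word_length S0 h)%:R + B) :> R)%R.
  by rewrite -ler_pdivrMl // -lerBlDr -div1r.
have lec : ((word_length S0 h)%:R <= c%:R * (word_length S h)%:R :> R)%R.
  by rewrite -natrM ler_nat; apply: cP.
set s := (word_length S h)%:R%R in lec *.
have s0 : (0 <= s)%R by apply: ler0n.
have c0 : (0 <= c%:R :> R)%R by apply: ler0n.
apply: le_trans le _; apply: (@le_trans _ _ (A * ((c%:R + B) * s + (c%:R + B)))%R).
  rewrite ler_wpM2l ?(ltW A0) // mulrDl.
  apply: le_trans (lerD lec (lexx B)) _.
  by rewrite -!addrA lerD2l !addrA lerDr addr_ge0 // mulr_ge0.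
rewrite mulrDr mulrA lerD //; exact: ler_wpM2r.
Qed.

(* Lower bounds on word length: [P d h] says that [h] has size at most [d]. *)
Lemma undistorted_filtration (R : realType) H S (P : nat -> G -> Prop) :
  undistorted R H -> finite_generating_set setT S -> P 0 1%g ->
  (forall i j g, i <= j -> P i g -> P j g) ->
  (forall i j g h, H g -> H h -> P i g -> P j h -> P (i + j) (g * h)%g) ->
  (forall h, H h -> exists i, P i h) ->
  exists C, forall h, H h -> P (C * word_length S h + C) h.
Proof.
move=> uH genS P1 Pmono PM Pex.
have [T genT [C CP]] := undistorted_word_length uH genS.
have sH := fgs_subgroup genT.
have ex h : exists i, H h -> P i h.
  by case: (pselect (H h)) => [/Pex[i Pi]|nH]; [exists i|exists 0].
have [f fP] := boolp.choice ex.
have [c cP] := fgs_bound genT f.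
have Pw w : words T w -> P (c * size w) (eval w).
  elim: w => [|x w IH] Tw; first by rewrite eval_nil muln0.
  have Tx : T x by apply: Tw; rewrite mem_head.
  have {}Tw : words T w by move=> y yw; apply: Tw; rewrite inE yw orbT.
  have Hx := fgs_sub genT Tx.
  rewrite eval_cons mulnS; apply: PM => //; first exact: (words_fgs genT Tw).
    exact: Pmono (cP _ Tx) (fP _ Hx).
  exact: IH.
exists (c * C) => h Hh; have [Th Eh sh] := geodesicP genT Hh.
have := Pw _ Th; rewrite Eh sh; apply: Pmono.
by rewrite -mulnA -mulnDr leq_mul2l CP ?orbT.
Qed.

End LengthComparison.

(** * A criterion for being chaotic *)

Section Criterion.
Variables (R : realType) (G : groupType) (S : set G).
Hypothesis genS : finite_generating_set setT S.
Local Notation len := (word_length S).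
Implicit Types (w u W : seq G).

(** Paths are described by words over arbitrary elements of bounded length; they are spelled over
    [S] only here, each letter by a geodesic. *)
Definition expand W := flatten [seq geodesic S g | g <- W].

Lemma expand_cat W1 W2 : expand (W1 ++ W2) = expand W1 ++ expand W2.
Proof. by rewrite /expand map_cat flatten_cat. Qed.

Lemma expand_nseq n g : expand (nseq n g) = repeat n (geodesic S g).
Proof. by rewrite /expand map_nseq. Qed.

Lemma words_expand W : words S (expand W).
Proof.
elim: W => [|g W IH] //; apply/words_cat; split=> //.
by case: (geodesicP genS (I : setT g)).
Qed.

Lemma eval_expand W : eval (expand W) = eval W.
Proof.
elim: W => [|g W IH] //; rewrite [expand _]/(geodesic S g ++ expand W).
by rewrite eval_cat IH eval_cons; case: (geodesicP genS (I : setT g)) => _ ->.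
Qed.

Lemma size_geodesic g : size (geodesic S g) = len g.
Proof. by case: (geodesicP genS (I : setT g)). Qed.

(** The identity has the empty spelling and any other element a nonempty one. This is why only
    nontrivial letters count when a factor is shown to be long. *)
Lemma count_expand W : count (fun g => g != 1%g) W <= size (expand W).
Proof.
elim: W => //= g W IH; rewrite [expand _]/(geodesic S g ++ expand W).
rewrite size_cat size_geodesic leq_add //.
by case: eqP => //= /eqP; rewrite -(word_length_eq0 genS) // -lt0n.
Qed.

Variable c : nat.
Definition bounded_letters W := forall g, g \in W -> len g <= c.

Lemma size_expand W : bounded_letters W -> size (expand W) <= c * size W.
Proof.
elim: W => //= g W IH b; rewrite [expand _]/(geodesic S g ++ expand W) size_cat mulnS.
rewrite size_geodesic leq_add //; first by apply: b; rewrite mem_head.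
by apply: IH => h hW; apply: b; rewrite inE hW orbT.
Qed.

Lemma prefix_expand W u t : bounded_letters W -> expand W = u ++ t ->
  exists W1 W2 v, [/\ W = W1 ++ W2, u = expand W1 ++ v & size v <= c].
Proof.
elim: W u => [|g W IH] u b E.
  by exists [::], [::], [::]; case: u E.
move: E; rewrite [expand _]/(geodesic S g ++ expand W) => E.
have gc : len g <= c by apply: b; rewrite mem_head.
case: (leqP (size u) (size (geodesic S g))) => [le|/ltnW le].
  exists [::], (g :: W), u; split=> //.
  by apply: leq_trans le _; rewrite size_geodesic.
have [u' [-> E']] := eq_cat_split E le.
have [|W1 [W2 [v [-> -> vc]]]] := IH u' _ E'.
  by move=> h hW; apply: b; rewrite inE hW orbT.
by exists (g :: W1), W2, v; rewrite catA.
Qed.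

(** A factor of the spelling cuts at most one letter of [W] at each of its ends, which accounts for
    [v1] and [v2]. *)
Lemma infix_expand W s u t : bounded_letters W -> expand W = s ++ u ++ t ->
  exists W1 W2 W3 v1 v2, [/\ W = W1 ++ W2 ++ W3, u = v1 ++ expand W2 ++ v2,
    size v1 <= c & size v2 <= c].
Proof.
elim: W s => [|g W IH] s b E.
  by exists [::], [::], [::], [::], [::]; case: s u E => [|? ?] [|? ?].
move: E; rewrite [expand _]/(geodesic S g ++ expand W) => E.
have gc : len g <= c by apply: b; rewrite mem_head.
have bW : bounded_letters W by move=> h hW; apply: b; rewrite inE hW orbT.
case: (leqP (size s) (size (geodesic S g))) => [le|/ltnW le].
  have [s1 [Eg E']] := eq_cat_split (esym E) le.
  have s1c : size s1 <= c.
    by apply: leq_trans gc; rewrite -size_geodesic Eg size_cat leq_addl.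
  case: (leqP (size u) (size s1)) => [le'|/ltnW le'].
    exists [::], [::], (g :: W), u, [::]; rewrite !cats0; split=> //.
    exact: leq_trans le' s1c.
  have [u1 [-> E1]] := eq_cat_split (esym E') le'.
  have [W1 [W2 [v [-> -> vc]]]] := prefix_expand bW E1.
  by exists [:: g], W1, W2, s1, v.
have [s' [_ E']] := eq_cat_split E le.
have [W1 [W2 [W3 [v1 [v2 [-> -> c1 c2]]]]]] := IH s' bW E'.
by exists (g :: W1), W2, W3, v1, v2.
Qed.

(** Dropping the two incomplete letters at the ends changes size and value by at most [2 * c], and a
    complete letter has size at most [c]; the constants follow. *)
Lemma expand_quasigeodesic l e W : bounded_letters W ->
  (forall u, infix u W -> size u <= l * len (eval u) + e) ->
  quasigeodesic S ((c * l + 1)%:R : R) ((c * (2 * c * l + e) + 2 * c)%:R) (expand W).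
Proof.
move=> bW qW; split=> [|u /infixP[s [t E]]]; first exact: words_expand.
have := @words_expand W; rewrite E => /words_cat[_ /words_cat[Su _]].
have [W1 [W2 [W3 [v1 [v2 [EW Eu c1 c2]]]]]] := infix_expand bW E.
rewrite -natrM -natrD ler_nat.
have /qW le : infix W2 W by rewrite EW infix_infix.
have bW2 : bounded_letters W2.
  by move=> g gW; apply: bW; rewrite EW !mem_cat gW !orbT.
have le2 := size_expand bW2.
move: Su; rewrite {1}Eu => /words_cat[S1 /words_cat[_ S2]].
have l1 := word_length_le genS S1; have l2 := word_length_le genS S2.
have {}l2 : len (eval W2) <= len (eval u) + 2 * c.
  rewrite {1}Eu !eval_cat eval_expand.
  have := word_lengthMl genS (I : setT (eval v1)) (I : setT (eval W2 * eval v2)%g).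
  have := word_lengthMr genS (I : setT (eval W2)) (I : setT (eval v2)).
  lia.
have : c * size W2 <= c * (l * (len (eval u) + 2 * c) + e).
  by rewrite leq_mul2l; apply/orP; right; apply: leq_trans le _;
    rewrite leq_add2r leq_mul2l l2 orbT.
move=> le3; rewrite {1}Eu !size_cat.
have -> : (c * l + 1) * len (eval u) + (c * (2 * c * l + e) + 2 * c) =
  c * (l * (len (eval u) + 2 * c) + e) + len (eval u) + 2 * c by lia.
lia.
Qed.

Lemma quasigeodesic_infix lambda eps u w : infix u w ->
  quasigeodesic S (lambda : R) eps w -> quasigeodesic S lambda eps u.
Proof.
move=> uw [Sw qw]; split=> [x xu|v vu]; last exact: qw (infix_trans vu uw).
by apply: Sw; apply: mem_infix xu.
Qed.

(** The exponent [n] has to exceed the pumping constant, while [N] belongs to the words obtained by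
    pumping, in which at least one of [U] and [V] is still intact. Either way one of the two bad
    factors shows up. *)
Theorem chaotic_criterion x l e : x != 1%g ->
  (forall n0 C, exists n N U V, [/\ n0 <= n,
     bounded_letters (U ++ nseq n x ++ V),
     (forall u, infix u (U ++ nseq n x ++ V) -> size u <= l * len (eval u) + e),
     (exists2 u, infix u (U ++ nseq N x) &
        C * len (eval u) + C < count (fun g => g != 1%g) u) &
     (exists2 u, infix u (nseq N x ++ V) &
        C * len (eval u) + C < count (fun g => g != 1%g) u)]) ->
  chaotic R S.
Proof.
move=> x1 H; exists ((c * l + 1)%N%:R)%R, ((c * (2 * c * l + e) + 2 * c)%N%:R)%R; split.
- by rewrite ler1n addn1.
- exact: ler0n.
move=> L LS [D [_ LD]] qL lambda eps lam1 eps0; apply: contrapT => noL.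
have {}noL w : L w -> quasigeodesic S lambda eps w.
  by move=> Lw; apply: contrapT => nq; apply: noL; exists w.
have sx : 0 < size (geodesic S x).
  by rewrite size_geodesic lt0n (word_length_eq0 genS).
have [K KP] := cfg_pump_power D sx.
(* With this [C], a factor of size above [C * len + C] violates the bound [lambda * len + eps]. *)
have [C CP] : exists C : nat, (lambda + eps <= C%:R)%R.
  exists (Num.bound (lambda + eps)); apply/ltW/archi_boundP.
  by rewrite addr_ge0 // (le_trans _ lam1).
have [n [N [U [V [Kn bW qW bad1 bad2]]]]] := H K C.
have := qL _ (expand_quasigeodesic bW qW); rewrite LD !expand_cat expand_nseq.
move=> /(KP _ _ _ Kn)[p p0 pump].
have contra W : (exists2 u, infix u W & C * len (eval u) + C < count (fun g => g != 1%g) u) ->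
    quasigeodesic S lambda eps (expand W) -> False.
  move=> [u /infixP[s [t ->]] bad] [_].
  rewrite !expand_cat => /(_ (expand u) (infix_infix _ _ _)).
  apply/negP; rewrite -ltNge eval_expand.
  apply: (@le_lt_trans _ _ ((C * len (eval u) + C)%:R : R)%R).
    have lenu : (0 <= (len (eval u))%:R :> R)%R by apply: ler0n.
    rewrite natrD natrM lerD // ?ler_wpM2r //; apply: le_trans CP.
      by rewrite lerDl.
    by rewrite lerDr (le_trans _ lam1).
  by rewrite ltr_nat; apply: leq_trans bad (count_expand u).
(* Pumping [N] times leaves at least [N] copies of [x] next to the intact side. *)
have np : n + p * N = N + (n + (p - 1) * N).
  by rewrite mulnBl mul1n; have := leq_mul p0 (leqnn N); lia.
case: pump => /(_ N)[W]; rewrite -LD => /noL; rewrite np repeatD => q.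
- apply: (contra _ bad1); rewrite expand_cat expand_nseq.
  apply: quasigeodesic_infix q; apply/infixP.
  by exists [::], (repeat (n + (p - 1) * N) (geodesic S x) ++ W); rewrite -!catA.
- apply: (contra _ bad2); rewrite expand_cat expand_nseq.
  apply: quasigeodesic_infix q; rewrite -repeatD addnC repeatD; apply/infixP.
  by exists (W ++ repeat (n + (p - 1) * N) (geodesic S x)), [::]; rewrite cats0 -!catA.
Qed.

End Criterion.

(** * Commuting elements, one of which is undistorted *)

Section InfixCat.
Variable A : eqType.
Implicit Types (u v w s p : seq A).

Lemma infix_catP u v w : infix u (v ++ w) ->
  [\/ infix u v, infix u w | exists s p, [/\ u = s ++ p, suffix s v & prefix p w]].
Proof.
move=> /infixP[a [b E]]; case: (leqP (size v) (size a)) => [le|/ltnW le].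
  have [a' [_ ->]] := eq_cat_split E le; constructor 2.
  exact: infix_infix.
have [v' [Ev E']] := eq_cat_split (esym E) le.
case: (leqP (size u) (size v')) => [le'|/ltnW le'].
  have [v'' [Ev' _]] := eq_cat_split E' le'; constructor 1.
  by rewrite Ev Ev' infix_infix.
have [p [-> ->]] := eq_cat_split (esym E') le'; constructor 3.
by exists v', p; rewrite Ev suffix_suffix prefix_prefix.
Qed.

Lemma prefix_catP p v w : prefix p (v ++ w) ->
  prefix p v \/ exists2 p', p = v ++ p' & prefix p' w.
Proof.
move=> /prefixP[b E]; case: (leqP (size v) (size p)) => [le|/ltnW le].
  by have [p' [-> ->]] := eq_cat_split E le; right; exists p'; rewrite ?prefix_prefix.
by have [v' [-> _]] := eq_cat_split (esym E) le; left; rewrite prefix_prefix.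
Qed.

Lemma infix_nseqP u n (x : A) : infix u (nseq n x) -> exists2 k, k <= n & u = nseq k x.
Proof.
move=> /infixP[a [b E]]; exists (size u).
  by rewrite -(size_nseq n x) E !size_cat; lia.
apply/all_pred1P; have /all_pred1P : nseq n x = nseq (size (nseq n x)) x by rewrite size_nseq.
by rewrite E !all_cat => /and3P[].
Qed.

End InfixCat.

Section CommutingPair.
Variables (R : realType) (G : groupType) (S : set G).
Hypothesis genS : finite_generating_set setT S.
Local Notation len := (word_length S).

Let lenM g h : len (g * h)%g <= len g + len h.
Proof. exact: (@word_lengthM _ _ _ genS g h I I). Qed.

Let lenV g : len (g^-1)%g = len g.
Proof. exact: (@word_lengthV _ _ _ genS g I). Qed.

Let lenMl g h : len h <= len (g * h)%g + len g.
Proof. exact: (@word_lengthMl _ _ _ genS g h I I). Qed.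

Let lenMr g h : len g <= len (g * h)%g + len h.
Proof. exact: (@word_lengthMr _ _ _ genS g h I I). Qed.

Variables (x : G) (C : nat).
Hypothesis x_undistorted : forall k, k <= C * len (x ^+ k)%g.

(* Powers of [x] with integer exponent [k - i]. *)
Definition shift (i k : nat) : G := locked (x ^- i * x ^+ k)%g.

Lemma shiftE i k : shift i k = (x ^- i * x ^+ k)%g.
Proof. by rewrite /shift -lock. Qed.

Lemma shift_comm e i k : commute x e -> (e * shift i k = shift i k * e)%g.
Proof.
move=> xe; rewrite shiftE; apply/commuteM; last exact/commuteX/commute_sym.
exact/commuteV/commuteX/commute_sym.
Qed.

Lemma shiftM i k i' k' : (shift i k * shift i' k' = shift (i + i') (k + k'))%g.
Proof.
rewrite !shiftE addnC !expgnDr invgM !mulgA; congr (_ * _)%g; rewrite -!mulgA; congr (_ * _)%g.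
by apply/commuteV/commute_sym/commuteX; apply/commute_sym/commuteX.
Qed.

(** The bound on [|k - i|], split in two to stay within the natural numbers. *)
Lemma undistorted_diff i k : k <= C * len (shift i k) + i /\ i <= C * len (shift i k) + k.
Proof.
case: (leqP i k) => [le|/ltnW le].
  have -> : shift i k = (x ^+ (k - i))%g.
    by rewrite shiftE -{1}(subnKC le) expgnDr mulKg.
  by have := x_undistorted (k - i); lia.
have -> : shift i k = (x ^- (i - k))%g.
  by rewrite shiftE -{1}(subnKC le) expgnDr invgM mulgVK.
by rewrite lenV; have := x_undistorted (i - k); lia.
Qed.

Section Path.
Variables (e1 e2 : G) (N rad : nat).
Hypotheses (xe1 : commute x e1) (xe2 : commute x e2).
Local Notation r1 := (len e1).
Local Notation r2 := (len e2).
Local Notation n := (7 * C * rad).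
Variable r3 : nat.
Hypothesis min1 : forall i k, r1 <= len (shift i k * e1)%g.
Hypothesis min2 : forall i k, r2 <= len (shift i k * e2)%g.
Hypothesis min3 : forall i k, r3 <= len (shift i k * (e1 * e2))%g.
Hypotheses (rad_r1 : rad <= r1 <= 3 * rad) (rad_r2 : rad <= r2 <= 3 * rad).
Hypotheses (rad_r3 : rad <= r3) (excess2 : r2 + rad <= r1 + r3) (excess1 : r1 + rad <= r2 + r3).

Let g1 := geodesic S e1.
Let g2 := geodesic S e2.
Let xV := (x^-1)%g.

(** The exponent [7 * C * rad] makes the central power too long to be compensated by [g1] and [g2],
    whose lengths are at most [3 * rad]. The inequalities on [r3] keep the triangle with sides [r1],
    [r2], [r3] from degenerating. *)
Definition detour := nseq N xV ++ g1 ++ nseq n x ++ g2 ++ nseq N xV.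

Let eval_xV k : eval (nseq k xV) = shift k 0.
Proof. by rewrite eval_nseq expVgn shiftE mulg1. Qed.

Let eval_x k : eval (nseq k x) = shift 0 k.
Proof. by rewrite eval_nseq shiftE invg1 mul1g. Qed.

Let c1 i k : (e1 * shift i k = shift i k * e1)%g.
Proof. exact: shift_comm. Qed.

Let c2 i k : (e2 * shift i k = shift i k * e2)%g.
Proof. exact: shift_comm. Qed.

Let Cmul a b : a <= b -> C * a <= C * b. Proof. by rewrite leq_mul2l orbC => ->. Qed.

Let C_gt0 : 0 < C.
Proof. by have := x_undistorted 1; case: C. Qed.

Let geo1 : eval g1 = e1 /\ size g1 = r1.
Proof. by have [] := @geodesicP _ _ _ genS e1 I. Qed.

Let geo2 : eval g2 = e2 /\ size g2 = r2.
Proof. by have [] := @geodesicP _ _ _ genS e2 I. Qed.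

Let prefix_eval e p s : geodesic S e = p ++ s ->
  [/\ e = (eval p * eval s)%g, len (eval p) = size p, len (eval s) = size s &
      len e = size p + size s].
Proof.
have [_ Ee se] := @geodesicP _ _ _ genS e I => E.
have f u v w := @geodesic_factor _ _ _ genS e u v w I; split.
- by rewrite -eval_cat -E Ee.
- exact: (f [::] p s).
- by apply: (f p s [::]); rewrite cats0.
- by rewrite -se E size_cat.
Qed.

Let und i k e : k <= C * len (shift i k * e)%g + C * len e + i /\
  i <= C * len (shift i k * e)%g + C * len e + k.
Proof.
have := undistorted_diff i k; have /Cmul := lenMr (shift i k) e.
by rewrite mulnDr; lia.
Qed.

Let und' i k e : k <= C * len (e * shift i k)%g + C * len e + i /\
  i <= C * len (e * shift i k)%g + C * len e + k.
Proof.
have := undistorted_diff i k; have /Cmul := lenMl e (shift i k).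
by rewrite mulnDr; lia.
Qed.

Let le_Cd d : d <= C * d. Proof. exact: leq_pmull. Qed.

(** Factors inherit minimality: if a power of [x] shortened the prefix [p], it would shorten [e1] as
    well. For suffixes one also uses that [e1] commutes with [x]. *)
Let min1_factor i k p s : geodesic S e1 = p ++ s ->
  size p <= len (shift i k * eval p)%g /\ size s <= len (eval s * shift i k)%g.
Proof.
move=> /prefix_eval[Ee lp ls l1].
have m : r1 <= len (shift i k * eval p * eval s)%g by rewrite -mulgA -Ee; apply: min1.
have := lenM (shift i k * eval p)%g (eval s).
have m' : r1 <= len (eval p * (eval s * shift i k))%g by rewrite mulgA -Ee c1; apply: min1.
by have := lenM (eval p) (eval s * shift i k)%g; split; lia.
Qed.

Let min2_factor i k p s : geodesic S e2 = p ++ s ->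
  size p <= len (shift i k * eval p)%g /\ size s <= len (eval s * shift i k)%g.
Proof.
move=> /prefix_eval[Ee lp ls l1].
have m : r2 <= len (shift i k * eval p * eval s)%g by rewrite -mulgA -Ee; apply: min2.
have := lenM (shift i k * eval p)%g (eval s).
have m' : r2 <= len (eval p * (eval s * shift i k))%g by rewrite mulgA -Ee c2; apply: min2.
by have := lenM (eval p) (eval s * shift i k)%g; split; lia.
Qed.

Let good u := size u <= (100 * C) * len (eval u).

Let good_V k : good (nseq k xV).
Proof. by rewrite /good size_nseq eval_xV; have := undistorted_diff k 0; lia. Qed.

Let good_X k : good (nseq k x).
Proof. by rewrite /good size_nseq eval_x; have := undistorted_diff 0 k; lia. Qed.

Let good_geodesic e p s t : geodesic S e = p ++ s ++ t -> good s.
Proof.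
move=> E; have l := @geodesic_factor _ _ _ genS e p s t I E.
by rewrite /good l; have := le_Cd (size s); lia.
Qed.

Let good_Vg1 k p s : g1 = p ++ s -> good (nseq k xV ++ p).
Proof.
move=> E; have [le _] := min1_factor k 0 E; have [_ lp _ _] := prefix_eval E.
have [_ le'] := und k 0 (eval p); move: le le'.
rewrite /good eval_cat eval_xV size_cat size_nseq lp.
by set d := len _ => le le'; have := le_Cd d; have := Cmul le; lia.
Qed.

Let good_Vg1X i k : k <= n -> good (nseq i xV ++ g1 ++ nseq k x).
Proof.
move=> kn; have := min1 i k; have [le le'] := und i k e1; move: le le'.
have Ed : (shift i 0 * (e1 * shift 0 k) = shift i k * e1)%g.
  by rewrite c1 mulgA shiftM addn0.
rewrite /good !eval_cat eval_xV eval_x !size_cat !size_nseq geo1.1 geo1.2 Ed.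
set d := len _ => le le' m; have := le_Cd d; have := Cmul m.
by have : rad <= d; [lia|move=> /Cmul]; have := Cmul (andP rad_r1).2; lia.
Qed.

Let good_Vg1Xg2 i p s : g2 = p ++ s -> good (nseq i xV ++ g1 ++ nseq n x ++ p).
Proof.
move=> E; have [Ee2 lp ls l2] := prefix_eval E.
have Ed : (shift i 0 * (e1 * (shift 0 n * eval p)) = shift i n * (e1 * eval p))%g.
  by rewrite [(e1 * _)%g]mulgA c1 -[(shift 0 n * e1 * _)%g]mulgA [LHS]mulgA shiftM addn0.
have : r3 <= len (shift i n * (e1 * eval p))%g + len (eval s).
  apply: leq_trans (min3 i n) _; rewrite Ee2 [(e1 * _)%g]mulgA mulgA; exact: lenM.
have : r1 <= len (shift i n * (e1 * eval p))%g + len (eval p).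
  apply: leq_trans (min1 i n) _; rewrite mulgA; exact: lenMr.
have := lenM e1 (eval p); have := und i n (e1 * eval p)%g.
rewrite /good !eval_cat eval_xV eval_x !size_cat !size_nseq geo1.1 geo1.2 Ed.
set d := len (_ * (e1 * eval p))%g => [[h4 h5]] h1 h2 h3.
(* The lower bounds [r3 - size s] and [r1 - size p] for [d] add up to [r1 + r3 - r2], which is at
   least [rad]. *)
have hd : rad <= 2 * d by lia.
have := Cmul hd; have := Cmul h1; have := le_Cd d; have := Cmul (andP rad_r1).2.
by have := Cmul (andP rad_r2).2; have : size p <= r2 by [lia]; move=> /Cmul; lia.
Qed.

Let good_all i j : good (nseq i xV ++ g1 ++ nseq n x ++ g2 ++ nseq j xV).
Proof.
have Ed : (shift i 0 * (e1 * (shift 0 n * (e2 * shift j 0))) = shift (i + j) n * (e1 * e2))%g.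
  rewrite c2 [(shift 0 n * _)%g]mulgA shiftM [(e1 * (_ * e2))%g]mulgA c1.
  by rewrite -[(_ * e1 * _)%g]mulgA [LHS]mulgA shiftM addn0.
have := und (i + j) n (e1 * e2)%g; have := min3 (i + j) n.
rewrite /good !eval_cat !eval_xV eval_x !size_cat !size_nseq geo1.1 geo1.2 geo2.1 geo2.2 Ed.
have := lenM e1 e2; set d := len (_ * (e1 * e2))%g => h1 m3 [h4 h5].
have hd : rad <= d by lia.
have := Cmul hd; have := Cmul h1; have := le_Cd d; have := Cmul (andP rad_r1).2.
by have := Cmul (andP rad_r2).2; lia.
Qed.

Let good_g1X k p s : g1 = p ++ s -> good (s ++ nseq k x).
Proof.
move=> E; have [_ le] := min1_factor 0 k E; have [_ _ ls _] := prefix_eval E.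
have [le' _] := und' 0 k (eval s); move: le le'.
rewrite /good eval_cat eval_x size_cat size_nseq ls.
by set d := len _ => le le'; have := le_Cd d; have := Cmul le; lia.
Qed.

Let good_g1Xg2 p1 s1 p2 s2 : g1 = p1 ++ s1 -> g2 = p2 ++ s2 ->
  good (s1 ++ nseq n x ++ p2).
Proof.
move=> E1 E2; have [_ _ ls1 l1] := prefix_eval E1; have [_ lp2 _ l2] := prefix_eval E2.
rewrite /good !eval_cat eval_x !size_cat size_nseq.
have := undistorted_diff 0 n; have := lenMr (shift 0 n) (eval p2).
have := lenMl (eval s1) (shift 0 n * eval p2)%g; set d := len (eval s1 * _)%g.
set d' := len (shift 0 n * _)%g => h1 h2 [h3 _].
(* As [n = 7 * C * rad] is at most [C * len (shift 0 n)], this leaves [C * rad <= C * d]. *)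
have h : len (shift 0 n) <= d + 6 * rad by lia.
have {}h := Cmul h; have hd : C * rad <= C * d by lia.
by have := le_Cd d; have := le_Cd rad; lia.
Qed.

Let good_g1Xg2V j p s : g1 = p ++ s -> good (s ++ nseq n x ++ g2 ++ nseq j xV).
Proof.
move=> E; have [Ee1 lp ls l1] := prefix_eval E.
have Ed : (eval s * (shift 0 n * (e2 * shift j 0)) = eval s * e2 * shift j n)%g.
  by rewrite c2 [(shift 0 n * _)%g]mulgA shiftM addn0 -c2 mulgA.
have : r3 <= len (eval s * e2 * shift j n)%g + len (eval p).
  apply: leq_trans (min3 j n) _; rewrite mulgA -c1 -mulgA -c2 {1}Ee1 -!mulgA addnC.
  exact: lenM.
have : r2 <= len (eval s * e2 * shift j n)%g + len (eval s).
  apply: leq_trans (min2 j n) _; rewrite -c2 -mulgA; exact: lenMl.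
have := lenM (eval s) e2; have := und' j n (eval s * e2)%g.
rewrite /good !eval_cat eval_xV eval_x !size_cat !size_nseq geo2.1 geo2.2 Ed.
set d := len (_ * e2 * _)%g => [[h4 h5]] h1 h2 h3.
(* The mirror image: the lower bounds for [d] add up to [r2 + r3 - r1]. *)
have hd : rad <= 2 * d by lia.
have := Cmul hd; have := Cmul h1; have := le_Cd d; have := Cmul (andP rad_r1).2.
by have := Cmul (andP rad_r2).2; have : size s <= r1 by [lia]; move=> /Cmul; lia.
Qed.

Let good_Xg2 k p s : g2 = p ++ s -> good (nseq k x ++ p).
Proof.
move=> E; have [le _] := min2_factor 0 k E; have [_ lp _ _] := prefix_eval E.
have [le' _] := und 0 k (eval p); move: le le'.
rewrite /good eval_cat eval_x size_cat size_nseq lp.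
by set d := len _ => le le'; have := le_Cd d; have := Cmul le; lia.
Qed.

Let good_Xg2V i k : k <= n -> good (nseq k x ++ g2 ++ nseq i xV).
Proof.
move=> kn; have := min2 i k; have [le le'] := und i k e2; move: le le'.
have Ed : (shift 0 k * (e2 * shift i 0) = shift i k * e2)%g.
  by rewrite c2 mulgA shiftM addn0.
rewrite /good !eval_cat eval_xV eval_x !size_cat !size_nseq geo2.1 geo2.2 Ed.
set d := len _ => le le' m; have := le_Cd d; have := Cmul m.
by have : rad <= d; [lia|move=> /Cmul]; have := Cmul (andP rad_r2).2; lia.
Qed.

Let good_g2V k p s : g2 = p ++ s -> good (s ++ nseq k xV).
Proof.
move=> E; have [_ le] := min2_factor k 0 E; have [_ _ ls _] := prefix_eval E.
have [_ le'] := und' k 0 (eval s); move: le le'.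
rewrite /good eval_cat eval_xV size_cat size_nseq ls.
by set d := len _ => le le'; have := le_Cd d; have := Cmul le; lia.
Qed.

(** The cases are the pairs of pieces of the path in which the factor begins and ends. *)
Lemma detour_quasigeodesic u : infix u detour -> size u <= 100 * C * len (eval u).
Proof.
rewrite -/(good u) /detour.
have sfx (y : G) k s : suffix s (nseq k y) -> exists2 i, i <= k & s = nseq i y.
  by move=> /suffixW; apply: infix_nseqP.
have pfx (y : G) k s : prefix s (nseq k y) -> exists2 i, i <= k & s = nseq i y.
  by move=> /prefixW; apply: infix_nseqP.
case/infix_catP => [/infix_nseqP[k _ ->]//||[_ [p [-> /sfx[i iN ->]]]]].
- case/infix_catP => [/infixP[a [b /good_geodesic]]//||[s [p [-> /suffixP[a E]]]]].
  + case/infix_catP => [/infix_nseqP[k _ ->]//||[_ [p [-> /sfx[i iN ->]]]]].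
    * case/infix_catP => [/infixP[a [b /good_geodesic]]//|/infix_nseqP[k _ ->]//|].
      by move=> [s [_ [-> /suffixP[a E] /pfx[k _ ->]]]]; apply: good_g2V E.
    * case/prefix_catP => [/prefixP[b E]|[_ -> /pfx[k _ ->]]]; first exact: good_Xg2 E.
      exact: good_Xg2V.
  + case/prefix_catP => [/pfx[k _ ->]|[q -> /prefix_catP[/prefixP[b E']|[_ -> /pfx[k _ ->]]]]].
    * exact: good_g1X E.
    * exact: good_g1Xg2 E E'.
    * exact: good_g1Xg2V E.
- case/prefix_catP => [/prefixP[b E]|[q -> ]]; first exact: good_Vg1 E.
  case/prefix_catP => [/pfx[k kn ->]|[q' -> ]]; first exact: good_Vg1X.
  case/prefix_catP => [/prefixP[b E]|[_ -> /pfx[k _ ->]]]; first exact: good_Vg1Xg2 E.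
  exact: good_all.
Qed.

End Path.

Lemma finite_ball k : finite_set [set g | len g <= k].
Proof.
elim: k => [|k IH].
  apply: (@sub_finite_set _ _ [set 1%g]); last exact: finite_set1.
  by move=> g /=; rewrite leqn0 (@word_length_eq0 _ _ _ genS g I) => /eqP.
have finS : finite_set S by case: genS.
apply: (@sub_finite_set _ _ ([set 1%g] `|` [set (s * h)%g | s in S & h in [set g | len g <= k]])).
  move=> g /= gk; have [Sg Eg sg] := @geodesicP _ _ _ genS g I.
  case: (geodesic S g) Sg Eg sg => [|s w] Sg Eg sg; first by left; rewrite -Eg eval_nil.
  right; exists s; first by apply: Sg; rewrite mem_head.
  exists (eval w); last by rewrite -eval_cons.
  have Sw : words S w by move=> h hw; apply: Sg; rewrite inE hw orbT.
  by apply: leq_trans (word_length_le genS Sw) _; move: sg => /=; lia.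
by rewrite finite_setU; split; [exact: finite_set1|exact: finite_image2].
Qed.

Variable z : G.
Hypothesis xz : commute x z.
Hypothesis z_independent : forall M i k, 0 < M -> (z ^+ M)%g <> shift i k.

Lemma coset_min M : exists e, (exists i k, e = (shift i k * z ^+ M)%g) /\
  forall i k, len e <= len (shift i k * e)%g.
Proof.
have ex : exists l, `[< exists i k, len (shift i k * z ^+ M)%g = l >].
  by exists (len (shift 0 0 * z ^+ M)%g); apply/asboolP; exists 0, 0.
case: (ex_minnP ex) => l /asboolP[i [k El]] lmin.
exists (shift i k * z ^+ M)%g; split=> [|i' k']; first by exists i, k.
by rewrite El mulgA shiftM; apply: lmin; apply/asboolP; do 2!eexists.
Qed.

Lemma shift_comm_zX i k M : commute (z ^+ M)%g (shift i k).
Proof. by apply: shift_comm; apply: commuteX. Qed.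

Lemma shift00 : shift 0 0 = 1%g.
Proof. by rewrite shiftE mulg1 invg1. Qed.

(** Let [e M] be a shortest element in the coset of [z ^+ M] modulo powers of [x]. Its length is
    subadditive in [M], unbounded, and grows by at most [len z] at each step. If it first reaches
    [rad] at [m1] and [3 * rad] at [m2], then the lengths of [e m1], [e (m2 - m1)] and [e m2] form
    the triangle. *)
Lemma coset_min_scales rad : 2 * len z <= rad -> 0 < rad ->
  exists e1 e2 r3, [/\ commute x e1, commute x e2,
    (forall i k, len e1 <= len (shift i k * e1)%g),
    (forall i k, len e2 <= len (shift i k * e2)%g) &
    (forall i k, r3 <= len (shift i k * (e1 * e2))%g)] /\
    [/\ rad <= len e1 <= 3 * rad, rad <= len e2 <= 3 * rad, rad <= r3,
        len e2 + rad <= len e1 + r3 & len e1 + rad <= len e2 + r3].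
Proof.
move=> rad_z rad0.
have [e eP] := boolp.choice coset_min.
have eX M : exists i k, e M = (shift i k * z ^+ M)%g by case: (eP M).
have emin M i k : len (e M) <= len (shift i k * e M)%g by case: (eP M).
have ezmin M i k : len (e M) <= len (shift i k * z ^+ M)%g.
  have [i' [k' E]] := eX M.
  have := emin M (i + k') (k + i'); rewrite {2}E mulgA shiftM.
  have -> : shift (i + k' + i') (k + i' + k') = shift i k.
    rewrite -!addnA [k' + i']addnC -shiftM; suff -> : shift (i' + k') (i' + k') = 1%g by rewrite mulg1.
    by rewrite shiftE mulVg.
  by [].
have e0 : len (e 0) = 0.
  by have := ezmin 0 0 0; rewrite shift00 mulg1 (word_length1 genS) leqn0 => /eqP.
have eM M M' i k : len (e (M + M')) <= len (shift i k * (e M * e M'))%g.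
  have [i1 [k1 ->]] := eX M; have [i2 [k2 ->]] := eX M'.
  rewrite -[(_ * _ * _)%g]mulgA [(z ^+ M * _)%g]mulgA (shift_comm_zX i2 k2 M) -[(_ * z ^+ M * _)%g]mulgA.
  by rewrite -expgnDr [(shift i1 k1 * _)%g]mulgA shiftM mulgA shiftM.
have eS M : len (e M.+1) <= len (e M) + len z.
  have [i [k E]] := eX M; apply: leq_trans (lenM _ _); rewrite E -mulgA -expgSr.
  exact: ezmin.
(* Different powers of [z] lie in different cosets, and balls are finite. *)
have unb rd : exists M, rd <= len (e M).
  apply: contrapT => nex; apply: infinite_nat.
  have f_inj : set_inj [set: nat] e.
    move=> M M' _ _; wlog le : M M' / M <= M' => [W|].
      by case: (leqP M M') => [/W//|/ltnW/W + E]; move/(_ (esym E)).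
    have [i [k ->]] := eX M; have [i' [k' ->]] := eX M'.
    rewrite -{1}(subnK le) expgnDr mulgA => /mulIg E.
    apply/eqP; rewrite eqn_leq le leqNgt; apply/negP => lt.
    apply: (z_independent (M := M' - M) (i := i + k') (k := k + i')); first by rewrite subn_gt0.
    have -> : shift (i + k') (k + i') = (shift k' i' * shift i k)%g.
      by rewrite shiftM addnC [i' + k]addnC.
    rewrite E mulgA shiftM -[LHS]mul1g; congr (_ * _)%g.
    by rewrite shiftE [i' + k']addnC mulVg.
  apply: (@sub_finite_set _ _ (e @^-1` [set g | len g <= rd])).
    move=> M _ /=; rewrite leqNgt; apply/negP => /ltnW le; apply: nex; by exists M.
  apply: finite_preimage; last exact: finite_ball.
  by move=> M M' _ _; apply: f_inj; rewrite inE.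
pose m1 := ex_minn (unb rad); pose m2 := ex_minn (unb (3 * rad)).
have [r1 m1min] : rad <= len (e m1) /\ forall M, rad <= len (e M) -> m1 <= M.
  by rewrite /m1; case: ex_minnP.
have [r2 m2min] : 3 * rad <= len (e m2) /\ forall M, 3 * rad <= len (e M) -> m2 <= M.
  by rewrite /m2; case: ex_minnP.
have m1_gt0 : 0 < m1 by case: m1 r1 {m1min} => //; rewrite e0; lia.
have up1 : len (e m1) < rad + len z.
  have := eS m1.-1; rewrite prednK //.
  suff : len (e m1.-1) < rad by lia.
  by rewrite ltnNge; apply/negP => /m1min; lia.
have m12 : m1 <= m2 by apply: m1min; lia.
(* Since [m1] is positive, [m2 - m1] comes before [m2]. *)
have up2 : len (e (m2 - m1)) < 3 * rad.
  by rewrite ltnNge; apply/negP => /m2min; lia.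
have low2 : 3 * rad <= len (e m1) + len (e (m2 - m1)).
  apply: leq_trans r2 _; rewrite -{1}(subnKC m12); apply: leq_trans (lenM _ _).
  by have := eM m1 (m2 - m1) 0 0; rewrite shift00 mul1g.
have cx M : commute x (e M).
  have [i [k ->]] := eX M; apply: commuteM; last exact: commuteX.
  have := shift_comm i k (commute_refl x) => //.
exists (e m1), (e (m2 - m1)), (len (e m2)); split; split=> //; try lia.
by move=> i k; rewrite -{1}(subnKC m12).
Qed.

Theorem chaotic_commuting : chaotic R S.
Proof.
have x1 : x != 1%g.
  by apply/eqP => x1; have := x_undistorted 1; rewrite x1 expg1 (word_length1 genS) muln0.
have C0 : 0 < C by have := x_undistorted 1; case: C.
apply: (@chaotic_criterion R _ _ genS (len x + 1) x (100 * C) 0 x1) => n0 B.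
pose rad := n0 + 2 * len z + 1.
have [| |e1 [e2 [r3 [[c1 c2 m1 m2 m3] [a1 a2 a3 a4 a5]]]]] := @coset_min_scales rad.
- by rewrite /rad; lia.
- by rewrite /rad; lia.
(* The factors [x^-N g1 x^N] and [x^N g2 x^-N] only represent [e1] and [e2], but contain [2 * N]
   nontrivial letters besides those of the geodesics. *)
pose N := B * (len e1 + len e2) + B + 1.
have [g1 s1] : eval (geodesic S e1) = e1 /\ size (geodesic S e1) = len e1.
  by have [] := @geodesicP _ _ _ genS e1 I.
have [g2 s2] : eval (geodesic S e2) = e2 /\ size (geodesic S e2) = len e2.
  by have [] := @geodesicP _ _ _ genS e2 I.
exists (7 * C * rad), N, (nseq N (x^-1)%g ++ geodesic S e1), (geodesic S e2 ++ nseq N (x^-1)%g).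
have geo e g : g \in geodesic S e -> len g <= len x + 1.
  by move=> /(@geodesic_letters _ _ _ genS e g I)[_ /(word_length_letter genS)]; lia.
have conj e : commute x e -> (x ^- N * (e * x ^+ N) = e)%g /\ (x ^+ N * (e * x ^- N) = e)%g.
  move=> xe; have := shift_comm 0 N xe; have := shift_comm N 0 xe.
  by rewrite !shiftE invg1 mul1g mulg1 => -> ->; rewrite mulKg mulVKg.
split.
- have : 1 * rad <= 7 * C * rad by rewrite leq_mul2r; lia.
  by rewrite /rad; lia.
- move=> g; rewrite !mem_cat !mem_nseq => /orP[/orP[/andP[_ /eqP->]|/geo//]|/orP[/andP[_ /eqP->]|/orP[/geo//|/andP[_ /eqP->]]]];
    rewrite ?lenV; lia.
- move=> u; rewrite addn0 -!catA => uW.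
  exact: (@detour_quasigeodesic e1 e2 N rad c1 c2 r3).
- exists (nseq N (x^-1)%g ++ geodesic S e1 ++ nseq N x); first by rewrite catA infix_refl.
  rewrite !eval_cat g1 !eval_nseq expVgn (conj _ c1).1 !count_cat !count_nseq x1.
  by rewrite invg_eq1 x1 /N; lia.
- exists (nseq N x ++ geodesic S e2 ++ nseq N (x^-1)%g); first by rewrite infix_refl.
  rewrite !eval_cat g2 !eval_nseq expVgn (conj _ c2).2 !count_cat !count_nseq x1.
  by rewrite invg_eq1 x1 /N; lia.
Qed.

End CommutingPair.

(** * Nilpotent groups *)

Lemma nat_pigeonhole (T : Type) (f : nat -> T) (F : set T) : finite_set F ->
  (forall i, F (f i)) -> exists i j, i < j /\ f i = f j.
Proof.
move=> finF fF; apply: contrapT => nex; apply: infinite_nat.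
apply: (@sub_finite_set _ _ (f @^-1` F)) => [i _|]; first exact: fF.
apply: finite_preimage finF => i j _ _ E.
by case: (ltngtP i j) => // lt; case: nex; [exists i, j|exists j, i].
Qed.

(** * Abelian quotients generated by torsion elements *)

Section TorsionMod.
Variable G : groupType.
Implicit Types (A D K : set G) (a b c : G).

Definition torsion_mod K c := exists2 j, 0 < j & K (c ^+ j)%g.

Section AbelianQuotient.
Variables (A K : set G).
Hypotheses (sA : subgroup A) (sK : subgroup K) (KA : K `<=` A).
Hypothesis commAK : forall a b, A a -> A b -> K [~ a, b]%g.

Lemma abelian_swap D a b : subgroup D -> K `<=` D -> A a -> A b -> D (a * b)%g -> D (b * a)%g.
Proof.
by move=> sD KD Aa Ab Dab; rewrite commgC; apply: subgroupM => //; apply/KD/commAK.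
Qed.

(** [D'] consists of the products of powers of [c] with elements of [D]; it is a subgroup because
    [A] is abelian modulo [K]. As [c ^+ j] lies in [D], exponents below [j] represent all cosets of
    [D]. *)
Lemma adjoin_torsion D c : subgroup D -> K `<=` D -> D `<=` A -> A c -> torsion_mod D c ->
  exists D' j, [/\ subgroup D', D `<=` D', D' `<=` A, D' c &
    forall a, D' a -> exists2 i, i < j & D (c ^- i * a)%g].
Proof.
move=> sD KD DA Ac [j j0 Dj].
have Acn i : A (c ^+ i)%g by apply: subgroupX.
have AcV i : A (c ^- i)%g by apply: subgroupV.
exists [set a | A a /\ exists i, D (c ^- i * a)%g], j; split.
- apply/subgroupP; split=> [|a b [Aa [i Da]] [Ab [i' Db]]|a [Aa [i Da]]].
  + by split; [apply: subgroup1|exists 0; rewrite mulg1 invg1; apply: subgroup1].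
  + split; first exact: subgroupM.
    exists (i + i'); rewrite expgnDr invgM -mulgA; apply: abelian_swap => //.
      by apply: subgroupM => //; apply: subgroupM.
    have -> : (c ^- i * (a * b) * c ^- i' = (c ^- i * a) * (b * c ^- i'))%g by rewrite !mulgA.
    apply: subgroupM => //.
    exact: abelian_swap.
  + split; first exact: subgroupV.
    exists (j * i - i); have /abelian_swap Da' : D (a^-1 * c ^+ i)%g.
      by rewrite -[(c ^+ i)%g]invgK -invgM; apply: subgroupV.
    have le : i <= j * i by rewrite leq_pmull.
    have -> : (c ^- (j * i - i) = c ^- (j * i) * c ^+ i)%g.
      by rewrite -{2}(subnKC le) expgnDr invgM mulgVK.
    rewrite -mulgA; apply: subgroupM => //; last by apply: Da' => //; apply: subgroupV.
    by apply: subgroupV => //; rewrite expgnA; apply: subgroupX.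
- by move=> a Da; split; [apply: DA|exists 0; rewrite invg1 mul1g].
- by move=> a [].
- by split=> //; exists 1; rewrite mulVg; apply: subgroup1.
- move=> a [Aa [i Da]]; exists (i %% j); first exact: ltn_pmod.
  have -> : (c ^- (i %% j) * a = c ^+ (i %/ j * j) * (c ^- i * a))%g.
    by rewrite mulgA; congr (_ * _)%g; rewrite {3}(divn_eq i j) addnC expgnDr invgM mulVKg.
  apply: subgroupM => //; rewrite mulnC expgnA; exact: subgroupX.
Qed.

(** A finitely generated abelian torsion group is finite: the generators are adjoined to [K] one by
    one, each time with finite index. *)
Lemma torsion_cosets (Cs : seq G) :
  (forall c, c \in Cs -> A c /\ torsion_mod K c) -> A `<=` generated ([set` Cs] `|` K) ->
  exists2 F : seq G, (forall f, f \in F -> A f) &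
    forall a, A a -> exists2 f, f \in F & K (f^-1 * a)%g.
Proof.
move=> tCs Agen.
suff [D [F [sD KD DA CD [FA Fcov]]]] : exists D (F : seq G), [/\ subgroup D, K `<=` D, D `<=` A,
    (forall c, c \in Cs -> D c) & (forall f, f \in F -> A f) /\
      forall a, D a -> exists2 f, f \in F & K (f^-1 * a)%g].
  exists F => // a /Agen /(generated_sub sD) Da; apply/Fcov/Da => b [/CD|/KD] //.
elim: Cs tCs {Agen} => [|c Cs IH] tCs.
  exists K, [:: 1%g]; split=> //; split=> [f|a Ka]; first by rewrite inE => /eqP->; apply: subgroup1.
  by exists 1%g; rewrite ?mem_head // invg1 mul1g.
have [b bC|D [F [sD KD DA CD [FA Fcov]]]] := IH; first by apply: tCs; rewrite inE bC orbT.
have [Ac [j j0 Kj]] := tCs c (mem_head _ _).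
have [|D' [j' [sD' DD' D'A D'c D'P]]] := adjoin_torsion sD KD DA Ac; first by exists j => //; apply: KD.
exists D', [seq (c ^+ i * f)%g | i <- iota 0 j', f <- F]; split=> //.
- by move=> a /KD/DD'.
- by move=> b; rewrite inE => /orP[/eqP->|/CD/DD'].
- split=> [f /allpairsP[[i g] /= [_ /FA Ag ->]]|a /D'P[i ij /Fcov[f fF Kf]]].
    by apply: subgroupM => //; apply: subgroupX.
  exists (c ^+ i * f)%g; last by rewrite invgM -mulgA.
  by apply/allpairsP; exists (i, f); rewrite mem_iota.
Qed.

End AbelianQuotient.

Lemma finite_by_cosets A K (F : seq G) : finite_set K ->
  (forall a, A a -> exists2 f, f \in F & K (f^-1 * a)%g) -> finite_set A.
Proof.
move=> finK cov.
apply: (@sub_finite_set _ _ [set (f * k)%g | f in [set` F] & k in K]).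
  by move=> a /cov[f fF Kf]; exists f => //; exists (f^-1 * a)%g => //; rewrite mulVKg.
by apply: finite_image2.
Qed.

End TorsionMod.

Lemma commMl (G : groupType) (x y z : G) : ([~ x * y, z] = [~ x, z] ^ y * [~ y, z])%g.
Proof.
by rewrite !commgEl !conjgE !invgM !mulgA; do !rewrite ?mulgK ?mulgVK -?mulgA ?mulKg ?mulVKg.
Qed.

Lemma commMr (G : groupType) (x y z : G) : ([~ x, y * z] = [~ x, z] * [~ x, y] ^ z)%g.
Proof.
by rewrite !commgEl !conjgE !invgM !mulgA; do !rewrite ?mulgK ?mulgVK -?mulgA ?mulKg ?mulVKg.
Qed.

(** * The lower central series and the commuting pair *)

Section LowerCentral.
Variables (G : groupType) (H : set G).
Hypothesis sH : subgroup H.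
Local Notation gamma := (lower_central H).
Implicit Types (g h x y : G).

Lemma subgroup_gamma k : subgroup (gamma k).
Proof. by case: k => [//|k]; apply: subgroup_generated. Qed.

Lemma gamma_comm k x y : gamma k x -> H y -> gamma k.+1 [~ x, y]%g.
Proof. by move=> gx Hy; apply: sub_generated; exists x => //; exists y. Qed.

Lemma gamma_sub k : gamma k `<=` H.
Proof.
elim: k => [//|k IH]; apply: generated_sub => // _ [x /IH Hx [y Hy <-]].
exact: subgroupR.
Qed.

Lemma gamma_conj k x y : gamma k x -> H y -> gamma k (x ^ y)%g.
Proof.
elim: k x => [|k IH] x gx Hy.
  exact: subgroupJ.
pose D := [set z | gamma k.+1 (z ^ y)%g].
have sD : subgroup D.
  have sg := subgroup_gamma k.+1; apply/subgroupP; split=> [|a b|a]; rewrite /D /=.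
  - by rewrite conj1g; apply: subgroup1.
  - by rewrite conjMg; apply: subgroupM.
  - by rewrite conjVg; apply: subgroupV.
apply: (generated_sub sD) gx => _ [a ga [b Hb <-]]; rewrite /D /= conjRg.
by apply: gamma_comm; [apply: IH|apply: subgroupJ].
Qed.

Lemma gammaS k : gamma k.+1 `<=` gamma k.
Proof.
apply: generated_sub (subgroup_gamma k) _ => _ [x gx [y Hy <-]].
have sg := subgroup_gamma k.
by rewrite commgEl; apply: subgroupM; [|apply: subgroupV|apply: gamma_conj].
Qed.

Lemma gamma_le j k : j <= k -> gamma k `<=` gamma j.
Proof.
move=> /subnK<-; elim: (k - j) => [//|i IH]; exact: subset_trans (@gammaS _) IH.
Qed.

(** Modulo [gamma k.+2] the commutators of [gamma k] with [H] are central and depend bilinearly on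
    their entries, so those of generators suffice. *)
Lemma gamma_generators k (Cs Ts : seq G) : H `<=` generated [set` Ts] ->
  (forall t, t \in Ts -> H t) -> (forall c, c \in Cs -> gamma k c) ->
  gamma k `<=` generated ([set` Cs] `|` gamma k.+1) ->
  gamma k.+1 `<=` generated ([set` [seq [~ c, t]%g | c <- Cs, t <- Ts]] `|` gamma k.+2).
Proof.
move=> Hgen TH Ck Cgen; set Q := generated _.
have sQ : subgroup Q by apply: subgroup_generated.
have sg := subgroup_gamma k.+1; have sg0 := subgroup_gamma k.
have Q2 : gamma k.+2 `<=` Q by move=> q q2; apply: sub_generated; right.
have Qg : Q `<=` gamma k.+1.
  apply: generated_sub sg _ => q [/allpairsP[[c t] /= [cC tT ->]]|/gammaS//].
  by apply: gamma_comm; [apply: Ck|apply: TH].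
have QC c t : c \in Cs -> t \in Ts -> Q [~ c, t]%g.
  by move=> cC tT; apply: sub_generated; left; apply/allpairsP; exists (c, t).
clearbody Q.
(* [Q] is normal in [H], as [q ^ y] differs from [q] by a commutator in [gamma k.+2]. *)
have QJ q y : Q q -> H y -> Q (q ^ y)%g.
  move=> Qq Hy; rewrite -[(q ^ y)%g](mulVKg q) -commgEl; apply: subgroupM => //.
  by apply: Q2; apply: gamma_comm => //; apply: Qg.
have gQt a t : gamma k a -> t \in Ts -> Q [~ a, t]%g.
  move=> ga tT; have Ht := TH t tT.
  pose D := [set a | gamma k a /\ Q [~ a, t]%g].
  suff : D a by case.
  have sD : subgroup D.
    apply/subgroupP; split=> [|b c [gb Qb] [gc Qc]|b [gb Qb]].
    - by split; [apply: subgroup1|rewrite comm1g; apply: subgroup1].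
    - split; first exact: subgroupM.
      by rewrite commMl; apply: subgroupM => //; apply: QJ => //; apply: gamma_sub gc.
    - split; first exact: subgroupV.
      have Hb := gamma_sub gb; have := commMl b (b^-1)%g t; rewrite mulgV comm1g => E.
      have -> : ([~ b^-1, t] = ([~ b, t] ^ b^-1)^-1)%g by apply/esym/mulg1_eq.
      by apply: subgroupV => //; apply: QJ => //; apply: subgroupV.
  apply: (generated_sub sD) (Cgen _ ga) => b [bC|gb].
    split; first exact: Ck.
    exact: QC.
  by split; [apply: gammaS|apply: Q2; apply: gamma_comm].
apply: (generated_sub sQ) => _ [a ga [y Hy <-]]; rewrite -/(gamma k a) in ga.
pose D := [set y | H y /\ Q [~ a, y]%g].
suff : D y by case.
have Ha := gamma_sub ga.
have sD : subgroup D.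
  apply/subgroupP; split=> [|b c [Hb Qb] [Hc Qc]|b [Hb Qb]].
  - by split; [apply: subgroup1|rewrite commg1; apply: subgroup1].
  - by split; [exact: subgroupM|rewrite commMr; apply: subgroupM => //; apply: QJ].
  - split; first exact: subgroupV.
    have := commMr a b (b^-1)%g; rewrite mulgV commg1 => E.
    have -> : ([~ a, b^-1] = ([~ a, b] ^ b^-1)^-1)%g by apply: invg_inj; rewrite invgK; apply: mulg1_eq.
    by apply: subgroupV => //; apply: QJ => //; apply: subgroupV.
by apply: (generated_sub sD) (Hgen _ Hy) => t tT; split; [apply: TH|apply: gQt].
Qed.

(** By the same bilinearity, [[~ c, y] ^+ i] and [[~ c ^+ i, y]] agree modulo [gamma k.+2]. *)
Lemma gamma_torsion k c y : gamma k c -> H y -> torsion_mod (gamma k.+1) c ->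
  torsion_mod (gamma k.+2) [~ c, y]%g.
Proof.
move=> gc Hy [j j0 gcj]; exists j => //.
have sg := subgroup_gamma k.+2; have sg1 := subgroup_gamma k.+1.
have Hc := gamma_sub gc; have gw := gamma_comm gc Hy; have Hw := gamma_sub gw.
suff gj i : gamma k.+2 ([~ c, y] ^- i * [~ c ^+ i, y])%g.
  have gcy := gamma_comm gcj Hy.
  have := subgroupM sg gcy (subgroupV sg (gj j)).
  by rewrite invgM invgK mulVKg.
elim: i => [|i IH]; first by rewrite !expg0 comm1g invg1 mulg1; apply: subgroup1.
have gv : gamma k.+1 [~ c ^+ i, y]%g.
  by apply: gamma_comm => //; apply: subgroupX => //; apply: subgroup_gamma.
rewrite !expgSr commMl invgM.
have -> : ([~ c, y]^-1 * [~ c, y] ^- i * ([~ c ^+ i, y] ^ c * [~ c, y]) =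
  ([~ c, y] ^- i * [~ c ^+ i, y] * [~ [~ c ^+ i, y], c]) ^ [~ c, y])%g.
  have aux (a b v d : G) : (a^-1 * b^-1 * (d * a) = a^-1 * ((b^-1 * v * (v^-1 * d)) * a))%g.
    by rewrite -!mulgA mulVKg.
  by rewrite [RHS]conjgE (commgEl [~ c ^+ i, y]%g); apply: aux.
by apply: gamma_conj => //; apply: (subgroupM sg) => //; apply: gamma_comm.
Qed.

(** The last clause carries torsion from the abelianization down to all factors of the series. *)
Lemma gamma_generators_ex (Ts : seq G) : H `<=` generated [set` Ts] ->
  (forall t, t \in Ts -> H t) ->
  forall k, exists Cs : seq G, [/\ forall c, c \in Cs -> gamma k c,
    gamma k `<=` generated ([set` Cs] `|` gamma k.+1) &
    (forall t, t \in Ts -> torsion_mod (gamma 1) t) ->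
      forall c, c \in Cs -> torsion_mod (gamma k.+1) c].
Proof.
move=> Hgen TH; elim=> [|k [Cs [Ck Cgen Ctor]]].
  exists Ts; split=> //; apply: subset_trans Hgen _; apply: generated_subset.
  exact: subsetUl.
exists [seq [~ c, t]%g | c <- Cs, t <- Ts]; split.
- by move=> _ /allpairsP[[c t] /= [cC tT ->]]; apply: gamma_comm; [apply: Ck|apply: TH].
- exact: gamma_generators.
- move=> tor _ /allpairsP[[c t] /= [cC tT ->]].
  by apply: gamma_torsion; [apply: Ck|apply: TH|apply: Ctor].
Qed.

Lemma gamma_cosets k (Cs : seq G) (K : set G) : subgroup K -> gamma k.+1 `<=` K ->
  K `<=` gamma k -> (forall c, c \in Cs -> gamma k c /\ torsion_mod K c) ->
  gamma k `<=` generated ([set` Cs] `|` gamma k.+1) ->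
  exists F : seq G, forall a, gamma k a -> exists2 f, f \in F & K (f^-1 * a)%g.
Proof.
move=> sK gK Kg tC Cgen.
have [| |F _ Fcov] := torsion_cosets (subgroup_gamma k) sK Kg _ tC.
- by move=> a b ga gb; exact: (gK _ (gamma_comm ga (gamma_sub gb))).
- apply: subset_trans Cgen _; apply: generated_subset.
  by move=> a [Ca|/gK Ka]; [left|right].
- by exists F.
Qed.

(** The commutators [[~ x, w ^+ i]] lie in a finite set, and if two of them agree, then so do the
    conjugates of [x] by the two powers of [w]. *)
Lemma commuting_power k w x : finite_set (gamma k.+1) -> gamma k w -> H x ->
  exists2 M, 0 < M & commute x (w ^+ M)%g.
Proof.
move=> fin gw Hx.
have gi i : gamma k.+1 [~ x, w ^+ i]%g.
  rewrite -invgR; apply: (subgroupV (subgroup_gamma k.+1)).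
  by apply: gamma_comm => //; apply: (subgroupX (subgroup_gamma k)).
have [i [j [ij E]]] := nat_pigeonhole fin gi.
exists (j - i); first by rewrite subn_gt0.
apply/commgP/conjg_fixP; apply: (@conjg_inj _ (w ^+ i)%g).
rewrite -conjgM -expgnDr subnK ?(ltnW ij) //.
by move: E; rewrite !commgEl => /mulgI.
Qed.

(** [x] is a generator of infinite order in the abelianization; if there were none, all factors of
    the series would be finite, and [H] too. [z] is a power of an element [w] of the last infinite
    term of the series; some power of [w] commutes with [x] because the next term is finite. *)
Lemma commuting_pair T : finite_generating_set H T -> nilpotent H -> ~ virtually_cyclic H ->
  exists x z, [/\ H x, commute x z, ~ torsion_mod (gamma 1) x &
    forall M i k, 0 < M -> (z ^+ M)%g <> shift x i k].
Proof.
move=> genT [nc gnc] nvc.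
have [/finite_seqP[Ts ET] _ _] := genT.
have TH t : t \in Ts -> H t by move=> tT; apply: (fgs_sub genT); rewrite ET.
have Hgen : H `<=` generated [set` Ts] by rewrite -ET (fgs_generated genT).
have gens := gamma_generators_ex Hgen TH.
have infH : ~ finite_set H.
  move=> finH; apply: nvc; exists 1%g; split; last exact: finite_image.
  by apply: generated_sub => // _ ->; apply: subgroup1.
have descend k : (forall t, t \in Ts -> torsion_mod (gamma 1) t) ->
    finite_set (gamma k.+1) -> finite_set (gamma k).
  move=> tor fin; have [Cs [Ck Cgen /(_ tor) Ctor]] := gens k.
  have [F Fcov] := gamma_cosets (subgroup_gamma k.+1) (@subset_refl _ _) (@gammaS k)
    (fun c cC => conj (Ck c cC) (Ctor c cC)) Cgen.
  exact: finite_by_cosets fin Fcov.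
have [x xT xtor] : exists2 x, x \in Ts & ~ torsion_mod (gamma 1) x.
  apply: contrapT => nex; apply: infH.
  have tor t : t \in Ts -> torsion_mod (gamma 1) t.
    by move=> tT; apply: contrapT => nt; apply: nex; exists t.
  suff : forall k, finite_set (gamma (nc - k)) by move=> /(_ nc); rewrite subnn.
  elim=> [|k IH]; first by rewrite subn0 gnc.
  case: (ltnP k nc) => [lt|ge]; last by have -> : nc - k.+1 = nc - k by lia.
  by apply: descend => //; have -> : (nc - k.+1).+1 = nc - k by lia.
have Hx := TH x xT.
have [k [inf fin]] : exists k, ~ finite_set (gamma k) /\ finite_set (gamma k.+1).
  apply: contrapT => nex; suff : ~ finite_set (gamma nc) by rewrite gnc.
  elim: nc {gnc} => [//|k IH] fin; apply: nex; by exists k.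
have [Cs [Ck Cgen _]] := gens k.
have sg1 := subgroup_gamma 1.
have shift_pow i j : exists M, shift x i j = (x ^+ M)%g \/ shift x i j = (x ^- M)%g.
  rewrite shiftE; case: (leqP i j) => [le|/ltnW le].
    by exists (j - i); left; rewrite -{1}(subnKC le) expgnDr mulKg.
  by exists (i - j); right; rewrite -{1}(subnKC le) expgnDr invgM mulgVK.
(* If this term lies in [gamma 1], a power of [w] that is a power of [x] must be trivial, since [x]
   is not torsion modulo [gamma 1]. But [w] has infinite order modulo the next term. *)
case: k => [|k] in inf fin Ck Cgen *; last first.
  have [w wC wtor] : exists2 w, w \in Cs & ~ torsion_mod (gamma k.+2) w.
    apply: contrapT => nex; apply: inf.
    have [F Fcov] := gamma_cosets (subgroup_gamma k.+2) (@subset_refl _ _) (@gammaS k.+1)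
      (fun c cC => conj (Ck c cC) (contrapT (fun nt => nex (ex_intro2 _ _ c cC nt)))) Cgen.
    exact: finite_by_cosets fin Fcov.
  have [M0 M00 cw] := commuting_power fin (Ck w wC) Hx.
  exists x, (w ^+ M0)%g; split=> // M i j M_gt0; rewrite -expgnA => E.
  have g1 : gamma 1 (shift x i j).
    by rewrite -E; apply: (subgroupX sg1); apply: (@gamma_le 1 k.+1) => //; apply: Ck.
  have [[|l] sl] := shift_pow i j.
    apply: wtor; exists (M0 * M); first by rewrite muln_gt0 M00.
    rewrite E; suff -> : shift x i j = 1%g by apply: (subgroup1 (subgroup_gamma k.+2)).
    by case: sl => ->; rewrite ?invg1.
  apply: xtor; exists l.+1 => //; case: sl => sl; first by rewrite -sl.
  by apply: (subgroupVr sg1); rewrite -sl.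
(* In the remaining case [gamma 1] is finite. If all generators were torsion modulo [B], then [B],
   and with it the cyclic group of [x], would have finite index in [H]. *)
pose B := generated ([set x] `|` gamma 1).
have sB : subgroup B by apply: subgroup_generated.
have xB : B x by apply: sub_generated; left.
have gB : gamma 1 `<=` B by move=> g g1; apply: sub_generated; right.
have BH : B `<=` H by apply: generated_sub => // g [->//|]; apply: gamma_sub.
have [w wC wtor] : exists2 w, w \in Cs & ~ torsion_mod B w.
  apply: contrapT => nex; apply: nvc; exists x.
  have [F Fcov] := gamma_cosets sB gB BH
    (fun c cC => conj (Ck c cC) (contrapT (fun nt => nex (ex_intro2 _ _ c cC nt)))) Cgen.
  have sX : subgroup (generated [set x]) by apply: subgroup_generated.
  have xX : generated [set x] x by apply: sub_generated.
  split; first by apply: generated_sub => // _ ->.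
  have Bcov b : B b -> exists2 g, gamma 1 g & generated [set x] (g^-1 * b)%g.
    pose D := [set b | H b /\ exists2 g, gamma 1 g & generated [set x] (g^-1 * b)%g].
    have XH : generated [set x] `<=` H by apply: generated_sub => // _ ->.
    have sD : subgroup D.
      apply/subgroupP; split=> [|a c [Ha [g ga Xa]] [Hc [h hc Xc]]|a [Ha [g ga Xa]]].
      - split; first exact: subgroup1.
        by exists 1%g; rewrite ?invg1 ?mulg1; [apply: (subgroup1 sg1)|apply: subgroup1].
      - split; first exact: subgroupM.
        exists (g * h ^ (g^-1 * a)^-1)%g.
          apply: (subgroupM sg1) => //; apply: gamma_conj => //.
          by apply: subgroupV => //; apply: XH.
        have -> : ((g * h ^ (g^-1 * a)^-1)^-1 * (a * c) = (g^-1 * a) * (h^-1 * c))%g.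
          by rewrite conjgE !invgM !invgK -!mulgA; do !rewrite ?mulKg ?mulVKg.
        exact: (subgroupM sX).
      - split; first exact: subgroupV.
        exists (g^-1 ^ (g^-1 * a))%g.
          by apply: gamma_conj; [apply: (subgroupV sg1)|apply: XH].
        have -> : ((g^-1 ^ (g^-1 * a))^-1 * a^-1 = (g^-1 * a)^-1)%g.
          by rewrite conjgE !invgM !invgK -!mulgA; do !rewrite ?mulKg ?mulVKg ?mulgV ?mulg1.
        exact: (subgroupV sX).
    have : B `<=` D.
      apply: generated_sub => // a [->|g1].
        split=> //; exists 1%g; first exact: (subgroup1 sg1).
        by rewrite invg1 mul1g.
      split; first exact: gamma_sub g1.
      by exists a => //; rewrite mulVg; apply: (subgroup1 sX).
    by move=> BD /BD[].
  apply: (@sub_finite_set _ _ [set [set (y * k)%g | k in generated [set x]] |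
      y in [set (f * g)%g | f in [set` F] & g in gamma 1]]).
    move=> _ [h Hh <-]; have [f fF Bf] := Fcov h Hh.
    have [g g1 Xg] := Bcov _ Bf; exists (f * g)%g; first by exists f => //; exists g.
    have Eh : h = (f * g * (g^-1 * (f^-1 * h)))%g by rewrite -mulgA mulVKg mulVKg.
    apply/seteqP; split=> _ [a Xa <-].
      exists ((g^-1 * (f^-1 * h))^-1 * a)%g; first by apply: (subgroupM sX) => //; apply: (subgroupV sX).
      by rewrite {1}Eh -mulgA mulVKg.
    exists (g^-1 * (f^-1 * h) * a)%g; first exact: (subgroupM sX).
    by rewrite {2}Eh !mulgA.
  by apply: finite_image; apply: finite_image2.
have [M0 M00 cw] := commuting_power fin (Ck w wC) Hx.
exists x, (w ^+ M0)%g; split=> // M i j M_gt0; rewrite -expgnA => E.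
apply: wtor; exists (M0 * M); first by rewrite muln_gt0 M00.
by rewrite E shiftE; apply: (subgroupM sB); [apply: (subgroupV sB)|]; apply: (subgroupX sB).
Qed.

End LowerCentral.

(** * Rational characters and their extension *)

Section RationalCharacter.
Variables (G : groupType) (H : set G).
Hypothesis sH : subgroup H.
Local Notation gamma1 := (lower_central H 1).

Definition additive_on (K : set G) (chi : G -> rat) :=
  forall a b, K a -> K b -> chi (a * b)%g = (chi a + chi b)%R.

Section Additive.
Variables (K : set G) (chi : G -> rat).
Hypotheses (sK : subgroup K) (chiM : additive_on K chi).

Lemma additive_on1 : chi 1%g = 0%R.
Proof.
by have := chiM (subgroup1 sK) (subgroup1 sK); rewrite mulg1; lra.
Qed.

Lemma additive_onV a : K a -> chi (a^-1)%g = (- chi a)%R.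
Proof.
move=> Ka; have := chiM Ka (subgroupV sK Ka); rewrite mulgV additive_on1; lra.
Qed.

Lemma additive_onX a n : K a -> chi (a ^+ n)%g = (n%:R * chi a)%R.
Proof.
move=> Ka; elim: n => [|n IH]; first by rewrite expg0 additive_on1 mul0r.
rewrite expgS chiM //; last exact: subgroupX.
by rewrite IH -natr1 mulrDl mul1r addrC.
Qed.

End Additive.

(** This is the divisibility of the rationals: the value [sigma] at [s] is forced if some positive
    power of [s] lies in [K], and is taken to be 1 otherwise. *)
Lemma extend_character K chi s : subgroup K -> gamma1 `<=` K -> K `<=` H -> H s ->
  additive_on K chi -> (forall g, gamma1 g -> chi g = 0%R) ->
  exists K' chi', [/\ subgroup K', K `<=` K', K' `<=` H, K' s & additive_on K' chi'] /\
    ((forall a, K a -> chi' a = chi a) /\ (~ torsion_mod K s -> chi' s = 1%R)).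
Proof.
move=> sK gK KH Hs chiM chi_g.
have sg := subgroup_gamma sH 1.
have Hsh i k : H (shift s i k).
  by rewrite shiftE; apply: (subgroupM sH); [apply: (subgroupV sH)|]; apply: (subgroupX sH).
have [sigma sigma_tor sigma1] : exists2 sigma : rat,
    (forall j, 0 < j -> K (s ^+ j)%g -> chi (s ^+ j)%g = (j%:R * sigma)%R) &
    ~ torsion_mod K s -> sigma = 1%R.
  case: (pselect (torsion_mod K s)) => [[j j0 Kj]|nt]; last first.
    by exists 1%R => // j j0 Kj; case: nt; exists j.
  exists (chi (s ^+ j)%g / j%:R)%R => [i i0 Ki|[]]; last by exists j.
  have := additive_onX sK chiM j Ki; have := additive_onX sK chiM i Kj.
  rewrite -!expgnA mulnC => -> E.
  have j0' : (j%:R != 0 :> rat)%R by rewrite pnatr_eq0 -lt0n.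
  by apply: (mulfI j0'); rewrite -E mulrCA [(j%:R * _)%R]mulrC divfK.
have chi_shift i k : K (shift s i k) -> chi (shift s i k) = ((k%:R - i%:R) * sigma)%R.
  rewrite shiftE; case: (ltngtP i k) => [lt|lt|->].
  - have -> : (s ^- i * s ^+ k = s ^+ (k - i))%g.
      by rewrite -{1}(subnKC (ltnW lt)) expgnDr mulKg.
    by move=> Kk; rewrite sigma_tor ?subn_gt0 // natrB // ltnW.
  - have -> : (s ^- i * s ^+ k = s ^- (i - k))%g.
      by rewrite -{1}(subnKC (ltnW lt)) expgnDr invgM mulgVK.
    move=> /(subgroupVr sK) Kk; rewrite (additive_onV sK chiM) // sigma_tor ?subn_gt0 //.
    by rewrite natrB ?(ltnW lt) // -mulNr opprB.
  - by rewrite mulVg (additive_on1 sK chiM) subrr mul0r.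
pose K' := [set a | H a /\ exists p : nat * nat, K (shift s p.1 p.2 * a)%g].
have ex_shift a : exists p : nat * nat, K' a -> K (shift s p.1 p.2 * a)%g.
  by case: (pselect (K' a)) => [[_ [p Kp]]|nK]; [exists p|exists (0, 0)].
have [f fP] := boolp.choice ex_shift.
(* [f a] is one choice of exponents carrying [a] into [K]; by [chi'E] any other choice gives the
   same value. *)
pose chi' a := (chi (shift s (f a).1 (f a).2 * a)%g + ((f a).1%:R - (f a).2%:R) * sigma)%R.
have chi'E a i k : K' a -> K (shift s i k * a)%g ->
    chi' a = (chi (shift s i k * a)%g + (i%:R - k%:R) * sigma)%R.
  move=> K'a Ka; rewrite /chi'; have := fP _ K'a; case: (f a) => i' k' /= Ka'.
  have E : (shift s i' k' * a = shift s (i' + k) (k' + i) * (shift s i k * a))%g.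
    rewrite mulgA shiftM; congr (_ * _)%g.
    have -> : shift s (i' + k + i) (k' + i + k) = (shift s i' k' * shift s (k + i) (k + i))%g.
      by rewrite shiftM; congr (shift s _ _); lia.
    by rewrite [shift s (k + i) _]shiftE mulVg mulg1.
  have Ks : K (shift s (i' + k) (k' + i)).
    by move: Ka'; rewrite E; apply: (subgroupMl sK).
  by rewrite E chiM // (chi_shift _ _ Ks) !natrD; lra.
have shift00 : shift s 0 0 = 1%g by rewrite shiftE mulg1 invg1.
have KK' : K `<=` K'.
  by move=> a Ka; split; [apply: KH|exists (0, 0); rewrite shift00 mul1g].
have mulK a b i k i' k' : H a -> H b -> K (shift s i k * a)%g -> K (shift s i' k' * b)%g ->
    exists2 g, gamma1 g & (shift s (i + i') (k + k') * (a * b) =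
      (shift s i k * a) * (shift s i' k' * b) * g)%g.
  move=> Ha Hb Ka Kb; exists ([~ shift s i' k', a] ^ b)%g.
    by apply: (gamma_conj sH) => //; apply: (@gamma_comm _ H 0).
  rewrite -(shiftM s i k) conjgE commgEl conjgE -!mulgA.
  by do !rewrite ?mulKg ?mulVKg.
have K'M a b : K' a -> K' b -> K' (a * b)%g /\ chi' (a * b)%g = (chi' a + chi' b)%R.
  move=> K'a K'b; have [Ha [[i k] /= Ka]] := K'a; have [Hb [[i' k'] /= Kb]] := K'b.
  have [g gg E] := mulK _ _ _ _ _ _ Ha Hb Ka Kb.
  have Kab : K (shift s (i + i') (k + k') * (a * b))%g.
    by rewrite E; apply: (subgroupM sK); [apply: (subgroupM sK)|apply: gK].
  have K'ab : K' (a * b)%g.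
    by split; [apply: (subgroupM sH)|exists (i + i', k + k')].
  split=> //; rewrite (chi'E _ _ _ K'ab Kab) (chi'E _ _ _ K'a Ka) (chi'E _ _ _ K'b Kb).
  rewrite E (chiM _ _ (subgroupM sK Ka Kb) (gK _ gg)) (chiM _ _ Ka Kb).
  by rewrite (chi_g _ gg) !natrD; lra.
have K'V a : K' a -> K' (a^-1)%g.
  move=> [Ha [[i k] /= Ka]]; split; first exact: (subgroupV sH).
  exists (k, i) => /=.
  have := subgroupV sK Ka; rewrite invgM => Ka'.
  have -> : (shift s k i * a^-1 = a^-1 * (shift s i k)^-1 * [~ (shift s i k)^-1, a^-1])%g.
    rewrite -commgC; congr (_ * _)%g.
    by rewrite !shiftE invgM invgK.
  apply: (subgroupM sK) => //; apply: gK; apply: (@gamma_comm _ H 0).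
    exact: (subgroupV sH).
  exact: (subgroupV sH).
have K's : K' s.
  split=> //; exists (1, 0); rewrite /= shiftE expg1 mulg1 mulVg.
  exact: (subgroup1 sK).
exists K', chi'; split; split=> //.
- apply/subgroupP; split=> [|a b K'a K'b|]; [|by case: (K'M _ _ K'a K'b)|exact: K'V].
  by apply: KK'; apply: (subgroup1 sK).
- by move=> a [].
- by move=> a b K'a K'b; case: (K'M _ _ K'a K'b).
- move=> a Ka; rewrite (chi'E a 0 0) ?shift00 ?mul1g //; last exact: KK'.
  by rewrite subrr mul0r addr0.
- move=> /sigma1 s1; rewrite (chi'E s 1 0) //; last first.
    by rewrite shiftE expg1 mulg1 mulVg; apply: (subgroup1 sK).
  by rewrite shiftE expg1 mulg1 mulVg (additive_on1 sK chiM) s1 subr0 mul1r add0r.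
Qed.

(** Start from the zero character on [gamma1], extend it to [x] with value 1, and then to the
    generators one at a time. *)
Lemma character_ex T x : finite_generating_set H T -> H x -> ~ torsion_mod gamma1 x ->
  exists2 chi, additive_on H chi & chi x = 1%R.
Proof.
move=> genT Hx ntx.
have [/finite_seqP[Ts ET] _ _] := genT.
have sg := subgroup_gamma sH 1.
have [||K0 [chi0 [[sK0 gK0 K0H K0x chi0M] [chi0g chi0x]]]] :=
  @extend_character gamma1 (fun=> 0%R) x sg (@subset_refl _ _) (gamma_sub sH (k := 1)) Hx.
- by move=> a b _ _; rewrite addr0.
- by [].
have [K [chi [[sK gK KH KT] [chiM chig chix]]]] : exists K chi,
    [/\ subgroup K, gamma1 `<=` K, K `<=` H & (forall t, t \in Ts -> K t)] /\
    [/\ additive_on K chi, forall g, gamma1 g -> chi g = 0%R & K x /\ chi x = 1%R].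
  have : forall t, t \in Ts -> H t by move=> t tT; apply: (fgs_sub genT); rewrite ET.
  elim: Ts {ET} => [|t Ts IH] TH.
    by exists K0, chi0; split; split=> //; split=> //; apply: chi0x.
  have [u uT|K [chi [[sK gK KH KT] [chiM chig [Kx chix]]]]] := IH.
    by apply: TH; rewrite inE uT orbT.
  have [K' [chi' [[sK' KK' K'H K't chi'M] [chi'E _]]]] :=
    extend_character sK gK KH (TH _ (mem_head _ _)) chiM chig.
  exists K', chi'; split; split=> //.
  - exact: subset_trans gK KK'.
  - by move=> u; rewrite inE => /orP[/eqP->//|/KT/KK'].
  - by move=> g gg; rewrite chi'E ?chig //; apply: gK.
  - by split; [apply: KK'|rewrite chi'E].
have HK : H `<=` K.
  rewrite -(fgs_generated genT); apply: generated_sub => // t; rewrite ET; exact: KT.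
by exists chi; [move=> a b /HK Ka /HK Kb; apply: chiM|case: chix].
Qed.

End RationalCharacter.

Section Nilpotent.
Variables (R : realType) (G : groupType) (H S : set G).
Hypotheses (undistH : undistorted R H) (genS : finite_generating_set setT S).

Lemma character_undistorted chi x : subgroup H -> additive_on H chi -> H x -> chi x = 1%R ->
  exists C, forall k, k <= C * word_length S (x ^+ k)%g.
Proof.
move=> sH chiM Hx chix.
pose P i g := (`|chi g| <= i%:R)%R.
have [||||C CP] := undistorted_filtration (P := P) undistH genS.
- by rewrite /P (additive_on1 sH chiM) normr0.
- by move=> i j g ij; rewrite /P => /le_trans; apply; rewrite ler_nat.
- move=> i j g h Hg Hh; rewrite /P chiM // natrD => Pg Ph.
  by apply: le_trans (ler_normD _ _) (lerD Pg Ph).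
- move=> h Hh; exists (Num.bound `|chi h|); apply/ltW/archi_boundP; exact: normr_ge0.
(* The factor 2 absorbs the additive constant, because [x ^+ k] has positive length for [k > 0]. *)
exists (2 * C) => k; have := CP _ (subgroupX sH k Hx).
rewrite /P (additive_onX sH chiM) // chix mulr1 ger0_norm // ler_nat => le.
case: k => [//|k] in le *.
have : 0 < word_length S (x ^+ k.+1)%g.
  rewrite lt0n (word_length_eq0 genS) //; apply/eqP => x1.
  have := additive_onX sH chiM k.+1 Hx; rewrite x1 (additive_on1 sH chiM) chix mulr1.
  by move=> /eqP; rewrite eq_sym pnatr_eq0.
by move=> l0; have : C * 1 <= C * word_length S (x ^+ k.+1)%g; [rewrite leq_mul2l l0 orbT|lia].
Qed.

Lemma nilpotent_chaotic : nilpotent H -> ~ virtually_cyclic H -> chaotic R S.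
Proof.
move=> nilH nvc; have [T [_ [genT _ _]]] := undistH.
have sH := fgs_subgroup genT.
have [x [z [Hx xz ntx ind]]] := commuting_pair sH genT nilH nvc.
have [chi chiM chix] := character_ex sH genT Hx ntx.
have [C und] := character_undistorted sH chiM Hx chix.
exact: (chaotic_commuting R genS und xz ind).
Qed.

End Nilpotent.

(** * Baumslag--Solitar groups *)

Section Localization.
Variable m : int.
Hypothesis m_neq0 : m != 0%R.
Implicit Types x y : rat.
Local Open Scope ring_scope.

(* The ring Z[1/m]. *)
Definition localized x := exists s (k : int), x * m%:~R ^+ s = k%:~R.

Let m0 : (m%:~R != 0 :> rat). Proof. by rewrite intr_eq0. Qed.

Lemma localized_int (k : int) : localized k%:~R.
Proof. by exists 0%N, k; rewrite mulr1. Qed.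

Lemma localizedM x y : localized x -> localized y -> localized (x * y).
Proof.
move=> [s [k kE]] [r [l lE]]; exists (s + r)%N, (k * l).
by rewrite rmorphM /= -kE -lE exprD mulrACA.
Qed.

Lemma localizedD x y : localized x -> localized y -> localized (x + y).
Proof.
move=> [s [k kE]] [r [l lE]]; exists (s + r)%N, (k * m ^+ r + l * m ^+ s).
by rewrite rmorphD !rmorphM !rmorphXn /= -kE -lE exprD; lra.
Qed.

Lemma localizedN x : localized x -> localized (- x).
Proof. by move=> Lx; rewrite -mulN1r; apply: localizedM => //; apply: (localized_int (-1)). Qed.

Lemma localizedB x y : localized x -> localized y -> localized (x - y).
Proof. by move=> Lx Ly; apply: localizedD => //; apply: localizedN. Qed.

Lemma localizedX x i : localized x -> localized (x ^+ i).
Proof.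
move=> Lx; elim: i => [|i IH]; first exact: (localized_int 1).
by rewrite exprS; apply: localizedM.
Qed.

Lemma localizedV i : localized (m%:~R ^- i).
Proof. by exists i, 1; rewrite mulVf // expf_neq0. Qed.

(** After clearing denominators [n] divides a power of [m], to which it is coprime. *)
Lemma localized_coprime (n : int) i : coprimez n m -> localized (m%:~R ^+ i / n%:~R) ->
  n != 0 -> `|n|%N = 1%N.
Proof.
move=> cop [s [k kE]] n0.
have n0' : (n%:~R != 0 :> rat) by rewrite intr_eq0.
have E : k * n = m ^+ (i + s).
  by apply: (@intr_inj rat); rewrite rmorphM rmorphXn /= -kE exprD mulrAC divfK.
have : (n %| m ^+ (i + s))%Z by rewrite -E dvdz_mull.
rewrite -[m ^+ _]mul1r Gauss_dvdzl ?dvdz1; last exact: coprimezXr.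
by move/eqP.
Qed.

End Localization.

(** * The detour as a path of levels and abscissas *)

Section DetourPath.
Local Open Scope ring_scope.
Variables (u v : int) (B : rat) (b : nat).
Hypotheses (v0 : v != 0) (cop : coprimez u v) (u1 : (1 < `|u|)%N).
Let q0 : rat := u%:~R / v%:~R.
Let q : rat := q0 ^+ 2.
Hypotheses (q1 : 1 < q) (B1 : 1 <= B) (Bq : B <= q ^+ b).

Let u0' : u%:~R != 0 :> rat. Proof. by rewrite intr_eq0; apply: contraTneq u1 => ->. Qed.
Let v0' : v%:~R != 0 :> rat. Proof. by rewrite intr_eq0. Qed.
Let q_gt0 : 0 < q. Proof. exact: lt_trans q1. Qed.
Let q_neq0 : q != 0. Proof. exact: lt0r_neq0. Qed.
Let qX_gt0 i : 0 < q ^+ i. Proof. exact: exprn_gt0. Qed.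
Let qX_neq0 i : q ^+ i != 0. Proof. by rewrite expf_neq0. Qed.

Let qX_ge1 i : 1 <= q ^+ i. Proof. by rewrite exprn_ege1 // ltW. Qed.

Let localized_q i : localized v (q ^+ i).
Proof.
apply: localizedX; rewrite /q /q0 exprMn exprVn; apply: localizedM.
  exact/localizedX/localized_int.
exact: localizedV.
Qed.

Let q_fact i : exists2 r, localized v r & q ^+ i.+1 = u%:~R * r.
Proof.
exists (u%:~R * v%:~R ^- 2 * q ^+ i).
  apply: localizedM (localized_q i); apply: localizedM; first exact: localized_int.
  exact: localizedV.
by rewrite exprS {1}/q /q0 exprMn exprVn [_ ^+ 2]expr2 !mulrA.
Qed.

(* The pairs [(i, X)] stand for the group elements with height [2 i] and
   translation part [X]; [near d] is what word length [d] imposes on the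
   difference of two such elements. *)
Definition near d i1 (X1 : rat) i2 (X2 : rat) :=
  [/\ (i1 * 2 <= i2 * 2 + d)%N, (i2 * 2 <= i1 * 2 + d)%N,
      `|X2 - X1| <= B ^+ d * q ^+ i1 &
      localized v (u%:~R ^+ d * (X2 - X1) / q ^+ i1)].

(* [lia] without the hypotheses about rational numbers, which slow it down. *)
Ltac nat_lia := intros; repeat match goal with
  | H : near _ _ _ _ _ |- _ => clear H
  | H : is_true (@Order.le _ _ _ _) |- _ => clear H
  | H : is_true (@Order.lt _ _ _ _) |- _ => clear H
  | H : is_true (_ && _) |- _ => clear H
  | H : is_true (negb _) |- _ => clear H
  | H : localized _ _ |- _ => clear H
  | H : @eq rat _ _ |- _ => clear H
  | H : forall _ : _, _ |- _ => clear H
  end; lia.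

(** Moving far sideways requires a high level: from level [i1], length [d] allows a displacement of
    at most [B ^+ d * q ^+ i1], and [B] is at most [q ^+ b]. *)
Lemma near_large d i1 X1 i2 X2 k : near d i1 X1 i2 X2 -> q ^+ k <= `|X2 - X1| ->
  (k <= i1 + b.+1 * d)%N /\ (k <= i2 + b.+1 * d)%N.
Proof.
move=> [l1 l2 le _] ge.
have : q ^+ k <= q ^+ (b * d + i1).
  apply: le_trans ge _; apply: le_trans le _; rewrite exprD exprM.
  by rewrite ler_pM2r ?qX_gt0 // lerXn2r // nnegrE ?(le_trans ler01) // ltW // qX_gt0.
by rewrite ler_eXn2l //; nat_lia.
Qed.

(** A displacement that is [q ^+ e] times a unit modulo [u] cannot be made far above level [e]:
    otherwise [u] would be invertible in Z[1/v], although it is coprime to [v] and not a unit. *)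
Lemma near_unit d i1 X1 i2 X2 e (s : bool) (r : rat) : near d i1 X1 i2 X2 ->
  localized v r -> X2 - X1 = q ^+ e * ((-1) ^+ s + u%:~R * r) ->
  (i1 <= e + d)%N /\ (i2 <= e + d)%N.
Proof.
move=> [l1 l2 _ loc] Lr E.
suff : (i1 * 2 <= e * 2 + d)%N by nat_lia.
rewrite leqNgt; apply/negP => lt.
pose j := (i1 * 2 - e * 2 - d).-1; have Ei : (i1 = e + (i1 - e))%N by nat_lia.
have Ed : ((i1 - e) * 2 = d + j.+1)%N by rewrite /j; nat_lia.
set U : rat := u%:~R in loc E *; set V : rat := v%:~R in loc *.
have U0 : U != 0 := u0'; have V0 : V != 0 := v0'.
set c := (_ + U * r)%R in E *; set y := (_ / _)%R in loc.
have Ey : y * U ^+ (d + j.+1) = U ^+ d * c * V ^+ (d + j.+1).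
  have Eq : q ^+ (i1 - e) * V ^+ (d + j.+1) = U ^+ (d + j.+1).
    by rewrite /q -exprM mulnC Ed /q0 exprMn exprVn divfK // expf_neq0.
  rewrite -Eq mulrA; congr (_ * _); apply: (mulfI (qX_neq0 e)).
  have -> : q ^+ e * (y * q ^+ (i1 - e)) = y * q ^+ i1 by rewrite {2}Ei exprD mulrCA.
  by rewrite /y divfK // E mulrCA.
(* It turns out that [w * c] lies in Z[1/v]. So does [w * U], and [c] is plus or minus 1 modulo [U];
   hence [w] itself lies in Z[1/v]. *)
pose w := V ^+ (d + j.+1) / U; have wU : V ^+ (d + j.+1) = w * U by rewrite divfK.
have {}Ey : y * U ^+ j = w * c.
  apply: (mulIf (mulf_neq0 (expf_neq0 d U0) U0)).
  by move: Ey; rewrite wU exprD exprSr; lra.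
have {}loc : localized v (w * c).
  by rewrite -Ey; apply: localizedM => //; apply/localizedX/localized_int.
have : localized v w.
  have -> : w = (-1) ^+ s * (w * c - V ^+ (d + j.+1) * r).
    by rewrite wU /c; case: (s); rewrite ?expr1 ?expr0; lra.
  apply: localizedM; first exact/localizedX/(localized_int v (-1)).
  by apply: localizedB => //; apply: localizedM => //; apply/localizedX/localized_int.
move=> /(localized_coprime cop) E1; move: u1; rewrite E1 //.
by rewrite -(intr_eq0 rat).
Qed.

(** Invariance under left translation by an element of level [c] and abscissa [Y]. *)
Lemma near_shift d c i1 X1 i2 X2 Y : near d (c + i1) (Y + q ^+ c * X1) (c + i2) (Y + q ^+ c * X2) ->
  near d i1 X1 i2 X2.
Proof.
have E : Y + q ^+ c * X2 - (Y + q ^+ c * X1) = q ^+ c * (X2 - X1) by lra.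
rewrite /near E => -[l1 l2 le loc]; split; [nat_lia|nat_lia| |].
- move: le; rewrite normrM (gtr0_norm (qX_gt0 c)) exprD mulrCA.
  by rewrite ler_pM2l ?qX_gt0.
- move: loc; have -> // : u%:~R ^+ d * (q ^+ c * (X2 - X1)) / q ^+ (c + i1) =
    u%:~R ^+ d * (X2 - X1) / q ^+ i1.
  by rewrite exprD mulrCA -mulf_div divff // mul1r.
Qed.

Variables (N k : nat) (M : nat -> nat) (E : rat).
Hypotheses (kN : (2 * k <= N)%N) (k0 : (0 < k)%N).
(** The abscissa of [t^i a^(M (N - i))], the vertex at level [i] of the descent. By the two
    hypotheses that follow, it is of the order of [q ^+ N] at every level. *)
Let qM i : rat := q ^+ i * (M (N - i))%:R.
Hypothesis M_low : forall i, (i <= N)%N -> 2 * q ^+ N <= qM i.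
Hypothesis M_up : forall i, (i <= N)%N -> qM i <= E * q ^+ N.
Hypothesis NkE : E + 1 <= q ^+ (N - k).

Let qM_fact i : (0 < i)%N -> exists2 r, localized v r & qM i = u%:~R * r.
Proof.
case: i => // i _; have [r Lr E'] := q_fact i.
exists (r * (M (N - i.+1))%:R); last by rewrite /qM E' mulrA.
by apply: localizedM => //; apply: (localized_int v (Posz _)).
Qed.

Let qM_ge i : (i <= N)%N -> q ^+ N <= qM i - 1 /\ 1 <= q ^+ N.
Proof. by move=> /M_low; have := qX_ge1 N; lra. Qed.

(** In the names [near_ij] the digits number pieces of the path: 1 is the first ascent, 2 the
    descent, 3 the second ascent, 4 the [k] steps down at abscissa -1, and 5 the ascent that begins
    the translated copy. The bounds come from displacements that are large, or that are units modulo
    [u] up to a power of [q]. *)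
Let near_12 d i1 i2 : (i2 <= N)%N -> near d i1 0 i2 (qM i2) ->
  (N <= i1 + b.+1 * d)%N /\ (N <= i2 + b.+1 * d)%N.
Proof.
move=> iN nr; apply: (near_large nr); have [] := qM_ge iN.
by rewrite subr0 => h1 h2; rewrite ger0_norm; lra.
Qed.

Let near_13 d i1 i3 : (i3 <= N)%N -> near d i1 0 i3 (-1 + qM i3) ->
  [/\ (N <= i1 + b.+1 * d)%N, (N <= i3 + b.+1 * d)%N & i3 = 0 \/ (i3 <= d)%N].
Proof.
move=> iN nr; have [] := qM_ge iN => h1 h2.
have [|l1 l3] := near_large (k := N) nr; first by rewrite subr0 ger0_norm; lra.
split=> //; case: (posnP i3) => i30; [by left|right].
have [r Lr Er] := qM_fact i30.
have [|//] := near_unit (e := 0) (s := true) nr Lr; first by rewrite Er expr0; lra.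
Qed.

Let near_23 d i2 i3 : near d i2 (qM i2) i3 (-1 + qM i3) -> (i2 <= d)%N /\ (i3 <= d)%N.
Proof.
move=> nr; have [l1 l2 _ _] := nr.
case: (posnP i2) => i20; first by nat_lia.
case: (posnP i3) => i30; first by nat_lia.
have [r Lr Er] := qM_fact i20; have [r' Lr' Er'] := qM_fact i30.
have := near_unit (e := 0) (s := true) nr (localizedB Lr' Lr).
by rewrite !add0n; apply; rewrite Er Er' expr0; lra.
Qed.

Let near_14 d i1 i4 : near d i1 0 i4 (-1) -> (i4 <= d)%N.
Proof.
move=> nr; have := near_unit (e := 0) (s := true) nr (localized_int v 0).
by rewrite !add0n => h; apply: (h _).2; rewrite expr0; lra.
Qed.

Let near_24 d i2 i4 : near d i2 (qM i2) i4 (-1) -> (i4 <= d)%N.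
Proof.
move=> nr; have [l1 l2 _ _] := nr.
case: (posnP i2) => i20; first by nat_lia.
have [r Lr Er] := qM_fact i20.
have := near_unit (e := 0) (s := true) nr (localizedN Lr).
by rewrite !add0n => h; apply: (h _).2; rewrite Er expr0; lra.
Qed.

Let near_34 d i3 i4 : (i3 <= N)%N -> near d i3 (-1 + qM i3) i4 (-1) ->
  (N <= i3 + b.+1 * d)%N /\ (N <= i4 + b.+1 * d)%N.
Proof.
move=> iN nr; apply: (near_large nr); have [] := qM_ge iN => h1 h2.
by rewrite ler0_norm; lra.
Qed.

Let Nk0 : (0 < N - k)%N. Proof. nat_lia. Qed.

Let near_15 d i1 i5 : near d i1 0 (N - k + i5) (-1 + q ^+ (N - k)) -> (N - k + i5 <= d)%N.
Proof.
move=> nr; have [r Lr Er] := q_fact (N - k).-1; rewrite prednK // in Er.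
have := near_unit (e := 0) (s := true) nr Lr.
by rewrite !add0n => h; apply: (h _).2; rewrite Er expr0; lra.
Qed.

Let near_25 d i2 i5 : near d i2 (qM i2) (N - k + i5) (-1 + q ^+ (N - k)) ->
  (N - k + i5 <= d)%N.
Proof.
move=> nr; have [l1 l2 _ _] := nr; case: (posnP i2) => i20; first by nat_lia.
have [r Lr Er] := q_fact (N - k).-1; rewrite prednK // in Er.
have [r' Lr' Er'] := qM_fact i20.
have := near_unit (e := 0) (s := true) nr (localizedB Lr Lr').
by rewrite !add0n => h; apply: (h _).2; rewrite Er Er' expr0; lra.
Qed.

Let near_35 d i3 i5 : (i3 <= N)%N -> near d i3 (-1 + qM i3) (N - k + i5) (-1 + q ^+ (N - k)) ->
  [/\ (N <= i3 + b.+1 * d)%N, (i5 <= d)%N & (i3 <= N - k + d)%N].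
Proof.
move=> iN nr; have [l1 l2 _ _] := nr; have [] := qM_ge iN => h1 h2.
have [|r1 _] := near_large (k := N) nr.
  have := M_low iN; have : q ^+ (N - k) <= q ^+ N by rewrite ler_eXn2l //; nat_lia.
  by move=> h3 h4; rewrite ler0_norm; lra.
(* Above level [N - k] the displacement is [q ^+ (N - k)] times a number congruent to 1 modulo
   [u]. *)
case: (leqP i3 (N - k)) => i3N; first by split; nat_lia.
have [r Lr Er] := q_fact (i3 - (N - k)).-1; rewrite prednK ?subn_gt0 // in Er.
have LM : localized v (- (r * (M (N - i3))%:R)).
  by apply/localizedN/localizedM => //; apply: (localized_int v (Posz _)).
have [|u3 u5] := near_unit (e := N - k) (s := false) nr LM; last by split; nat_lia.
rewrite {1}/qM (_ : q ^+ i3 = q ^+ (N - k) * (u%:~R * r)); last first.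
  by rewrite -Er -exprD subnKC // ltnW.
by rewrite expr0; lra.
Qed.

Let near_45 d i4 i5 : near d i4 (-1) (N - k + i5) (-1 + q ^+ (N - k)) ->
  (i4 <= N - k + d)%N /\ (i5 <= d)%N.
Proof.
move=> nr; have [|u3 u5] := near_unit (e := N - k) (s := false) nr (localized_int v 0).
  by rewrite expr0; lra.
by nat_lia.
Qed.

(** Past its ascent the translated copy has abscissas of the order of [q ^+ (N - k) * q ^+ N], far
    away from the first part. Then [2 * k <= N] turns a bound on [N - k] into one on [N]. *)
Let near_far d i X i' X' : (i <= N)%N -> -1 <= X <= E * q ^+ N ->
  -1 + q ^+ (N - k) * (2 * q ^+ N) <= X' -> near d i X i' X' -> (N <= 2 * (b.+1 * d))%N.
Proof.
move=> iN /andP[X1 X2] X'1 nr.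
have : E * q ^+ N + q ^+ N <= q ^+ (N - k) * q ^+ N.
  by have := NkE; rewrite -(ler_pM2r (qX_gt0 N)); lra.
have := qX_ge1 N => h1 h2.
have [|l1 _] := near_large (k := N - k + N) nr; last by nat_lia.
by rewrite exprD ger0_norm; lra.
Qed.

(* Vertex [s] of the path with label [U x^k V] is [(level s, abscissa s)].  The
   first [3 N + 3] vertices climb [t^N], descend to [a^(M N)] and, after the letter
   [a^-1], climb back in parallel with the descent.  Then come [k] steps down on
   the line of abscissa [-1], the letter [a] and a translate of the first part. *)
Definition level3 s : nat :=
  if (s <= N)%N then s else if (s <= 2 * N + 1)%N then (2 * N + 1 - s)%N
  else (s - (2 * N + 2))%N.

Definition abscissa3 s : rat :=
  if (s <= N)%N then 0 else if (s <= 2 * N + 1)%N then qM (level3 s) else -1 + qM (level3 s).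

Let level3_le s : (s < 3 * N + 3)%N -> (level3 s <= N)%N.
Proof.
by rewrite /level3; case: (leqP s N) => // c1; case: (leqP s (2 * N + 1)) => c2; nat_lia.
Qed.

(** On each piece the level determines the position, so bounds on levels, or on [N] as a whole,
    become bounds on [s' - s]. *)
Lemma near_detour3 d s s' : (s <= s')%N -> (s' < 3 * N + 3)%N ->
  near d (level3 s) (abscissa3 s) (level3 s') (abscissa3 s') ->
  (s' - s <= 20 * (b.+1 * d) + 20)%N.
Proof.
rewrite /abscissa3 /level3 => ss' s'N.
case: (leqP s N) => c1; case: (leqP s' N) => c1'; try by (exfalso; nat_lia) || (case; nat_lia).
- case: (leqP s' (2 * N + 1)) => c2' nr.
    by have [] := near_12 _ nr; nat_lia.
  by have [] := near_13 _ nr; nat_lia.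
- case: (leqP s (2 * N + 1)) => c2; case: (leqP s' (2 * N + 1)) => c2';
    try by (exfalso; nat_lia) || (case; nat_lia).
  by move=> nr; have [] := near_23 nr; nat_lia.
Qed.

Definition level s : nat :=
  if (s < 3 * N + 3)%N then level3 s
  else if (s < 3 * N + 4 + k)%N then (4 * N + 3 - s)%N
  else (N - k + level3 (s - (3 * N + 4 + k)))%N.

Definition abscissa s : rat :=
  if (s < 3 * N + 3)%N then abscissa3 s
  else if (s < 3 * N + 4 + k)%N then -1
  else -1 + q ^+ (N - k) * (1 + abscissa3 (s - (3 * N + 4 + k))).

Let E_ge2 : 2 <= E.
Proof.
have := le_trans (M_low (leqnn N)) (M_up (leqnn N)).
by rewrite ler_pM2r.
Qed.

Lemma near_detour d s s' : (s <= s')%N -> (s' < 6 * N + 7 + k)%N ->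
  near d (level s) (abscissa s) (level s') (abscissa s') ->
  (s' - s <= 20 * (b.+1 * d) + 20)%N.
Proof.
rewrite /abscissa /level => ss' s'N.
case: (ltnP s (3 * N + 3)) => c; case: (ltnP s' (3 * N + 3)) => c'; try by (exfalso; nat_lia).
- exact: near_detour3.
- have lv : (level3 s <= N)%N by apply: level3_le.
  have cs : -1 <= abscissa3 s <= E * q ^+ N.
    rewrite /abscissa3; have := qX_ge1 N; have := M_up lv; have := M_low lv.
    have := E_ge2; have : 0 <= E * q ^+ N by rewrite mulr_ge0 ?(ltW (qX_gt0 N)) //; have := E_ge2; lra.
    by case: ifP => _; [lra|case: ifP => _; lra].
  case: (ltnP s' (3 * N + 4 + k)) => c2'.
    rewrite /abscissa3 /level3; case: (leqP s N) => c1.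
      by move=> /near_14; nat_lia.
    case: (leqP s (2 * N + 1)) => c2; first by move=> /near_24; nat_lia.
    by move=> nr; have [] := near_34 _ nr; nat_lia.
  (* [s2] is the position within the translated copy. Beyond its ascent, [near_far] bounds [N] and
     hence the length of the whole path. *)
  set s2 := (s' - _)%N; case: (leqP s2 N) => c3; last first.
    move=> nr; have : (N <= 2 * (b.+1 * d))%N; last by nat_lia.
    apply: near_far lv cs _ nr.
    have lv2 : (level3 s2 <= N)%N by apply: level3_le; rewrite /s2; nat_lia.
    rewrite {1}/abscissa3 leqNgt c3 /= lerD2l ler_pM2l ?qX_gt0 //.
    by have := M_low lv2; case: ifP => _; lra.
  rewrite {2}/abscissa3 {2}/level3 c3 addr0 mulr1.
  rewrite /abscissa3 /level3; case: (leqP s N) => c1.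
    by move=> /near_15; rewrite /s2 in c3 *; nat_lia.
  case: (leqP s (2 * N + 1)) => c2; first by move=> /near_25; rewrite /s2 in c3 *; nat_lia.
  by move=> nr; have [] := near_35 _ nr; rewrite /s2 in c3 nr *; nat_lia.
case: (ltnP s (3 * N + 4 + k)) => c2; case: (ltnP s' (3 * N + 4 + k)) => c2';
  try by (exfalso; nat_lia) || (case; nat_lia).
- set s2 := (s' - _)%N; case: (leqP s2 N) => c3; last first.
    move=> nr; have : (N <= 2 * (b.+1 * d))%N; last by nat_lia.
    apply: near_far _ _ _ nr; first by nat_lia.
      by rewrite lexx /= (le_trans _ (mulr_ge0 _ _)) // ?(ltW (qX_gt0 N)) //; have := E_ge2; lra.
    have lv2 : (level3 s2 <= N)%N by apply: level3_le; rewrite /s2; nat_lia.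
    rewrite {1}/abscissa3 leqNgt c3 /= lerD2l ler_pM2l ?qX_gt0 //.
    by have := M_low lv2; case: ifP => _; lra.
  rewrite /abscissa3 /level3 c3 addr0 mulr1.
  by move=> /near_45; rewrite /s2 in c3 *; nat_lia.
(* Both vertices lie in the translated copy and are moved back to the first part. *)
- rewrite !mulrDr !mulr1 !addrA => /near_shift/near_detour3.
  by move=> h; have {}h := h ltac:(nat_lia) ltac:(nat_lia); nat_lia.
Qed.

End DetourPath.

(** * Lower bounds on word length from the affine action *)

Section AffineFiltration.
Variables (R : realType) (G : groupType) (H S : set G).
Hypotheses (undistH : undistorted R H) (genS : finite_generating_set setT S).
Variables (u v : int).
Hypotheses (v0 : v != 0%R) (uv : (`|v| <= `|u|)%N).
Let q0 : rat := (u%:~R / v%:~R)%R.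
Variables (h : G -> int) (tau : G -> rat).
Hypothesis hM : forall g g', H g -> H g' -> h (g * g')%g = (h g + h g')%R.
Hypothesis tauM : forall g g', H g -> H g' -> tau (g * g')%g = (tau g + q0 ^ h g * tau g')%R.
Hypothesis tau_loc : forall g, H g -> exists i, localized v (u%:~R ^+ i * tau g)%R.
Let B : rat := (`|u|%N.+1)%:R%R.
Local Open Scope ring_scope.

Let v0' : v%:~R != 0 :> rat. Proof. by rewrite intr_eq0. Qed.
Let u0 : u != 0. Proof. by move: uv v0; rewrite -!absz_eq0 -!lt0n => le lt; exact: leq_trans lt le. Qed.
Let u0' : u%:~R != 0 :> rat. Proof. by rewrite intr_eq0. Qed.
Let B1 : 1 <= B. Proof. by rewrite ler1n. Qed.

Let q0_norm : 1 <= `|q0| <= B.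
Proof.
have v1 : 1 <= `|v%:~R| :> rat.
  by rewrite -intr_norm (ler_int _ 1) -gtz0_ge1 normr_gt0.
rewrite /q0 normrM normfV; apply/andP; split.
  by rewrite ler_pdivlMr ?(lt_le_trans ltr01) // mul1r -!intr_norm ler_int -!abszE lez_nat.
rewrite ler_pdivrMr ?(lt_le_trans ltr01) //; apply: (@le_trans _ _ (`|u|%N%:R)).
  by rewrite natr_absz intr_norm.
apply: (@le_trans _ _ B); first by rewrite ler_nat.
by rewrite ler_peMr // (le_trans ler01).
Qed.

Let q0X_norm i : `|q0 ^ i| <= B ^+ `|i|%N.
Proof.
have [l1 l2] := andP q0_norm.
case: i => k; rewrite ?NegzE -?exprnN /exprz.
  by rewrite normrX lerXn2r // nnegrE // (le_trans ler01).
rewrite normfV normrX; apply: (@le_trans _ _ 1); last by rewrite exprn_ege1.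
by rewrite invf_le1 ?exprn_ege1 // (lt_le_trans ltr01) // exprn_ege1.
Qed.

Let q0X_loc i j : (`|i| <= j)%N -> localized v (u%:~R ^+ j * q0 ^ i).
Proof.
have Lu k : localized v (u%:~R ^+ k : rat) by apply/localizedX/localized_int.
have Lv k : localized v (v%:~R ^+ k : rat) by apply/localizedX/localized_int.
case: i => k; rewrite ?NegzE -?exprnN /exprz => kj.
  rewrite exprMn exprVn; apply: localizedM => //; apply: localizedM => //.
  exact: localizedV.
have -> : u%:~R ^+ j / q0 ^+ k.+1 = u%:~R ^+ (j - k.+1) * v%:~R ^+ k.+1.
  rewrite -{1}(subnK kj) exprD /q0 expr_div_n invf_div -!mulrA; congr (_ * _).
  by rewrite mulrCA divff ?mulr1 // expf_neq0.
exact: localizedM.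
Qed.

(** The bound [B ^+ i - 1] is stable under products: [(B ^+ i - 1) + B ^+ i * (B ^+ j - 1)] is
    [B ^+ (i + j) - 1]. *)
Definition affine_ball i g :=
  [/\ (`|h g| <= i)%N, `|tau g| <= B ^+ i - 1 & localized v (u%:~R ^+ i * tau g)].

Let one_in_H : H 1%g.
Proof. by case: undistH => T [_ [genT _ _]]; apply: subgroup1 (fgs_subgroup genT). Qed.

Lemma height1 : h 1%g = 0.
Proof. by have := hM one_in_H one_in_H; rewrite mulg1; lia. Qed.

Lemma translation1 : tau 1%g = 0.
Proof. by have := tauM one_in_H one_in_H; rewrite mulg1 height1 expr0z; lra. Qed.

Lemma affine_filtration :
  exists C, forall g, H g -> affine_ball (C * word_length S g + C) g.
Proof.
apply: undistorted_filtration undistH genS _ _ _ _.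
- by rewrite /affine_ball height1 translation1 normr0 expr0 subrr mulr0; split=> //; apply: (localized_int v 0).
- move=> i j g ij [h1 h2 h3]; split.
  + exact: leq_trans ij.
  + by apply: le_trans h2 _; rewrite lerD2r ler_weXn2l.
  + rewrite -(subnK ij) exprD -mulrA; apply: localizedM => //.
    exact/localizedX/localized_int.
- move=> i j g g' Hg Hg' [h1 h2 h3] [h1' h2' h3']; split.
  + by rewrite hM //; move: h1 h1'; clear; lia.
  + rewrite tauM //; apply: le_trans (ler_normD _ _) _; rewrite normrM.
    have Bi : 1 <= B ^+ i by rewrite exprn_ege1.
    have Bj : 1 <= B ^+ j by rewrite exprn_ege1.
    have le : `|q0 ^ h g| <= B ^+ i.
      by apply: le_trans (q0X_norm _) _; rewrite ler_weXn2l.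
    have le' : `|q0 ^ h g| * `|tau g'| <= B ^+ i * (B ^+ j - 1) by apply: ler_pM.
    by rewrite exprD; lra.
  + rewrite tauM // exprD mulrDr; apply: localizedD.
      rewrite [u%:~R ^+ i * _]mulrC -mulrA; apply: localizedM => //.
      exact/localizedX/localized_int.
    rewrite mulrACA; apply: localizedM => //; exact: q0X_loc.
- move=> g Hg; have [i Li] := tau_loc Hg.
  pose j := (i + `|h g| + Num.bound (`|tau g|))%N; exists j; split.
  + by rewrite /j; lia.
  + have le : `|tau g| <= j%:R.
      apply: (@le_trans _ _ (Num.bound `|tau g|)%:R); last by rewrite ler_nat /j leq_addl.
      by apply/ltW/archi_boundP; apply: normr_ge0.
    apply: le_trans le _; rewrite lerBrDr natr1 /B -natrX ler_nat.
    elim: j => [|j IH]; first by rewrite expn0.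
    by rewrite expnS; have : (0 < `|u|)%N by [rewrite lt0n absz_eq0]; nia.
  + have -> : j = (`|h g| + Num.bound (`|tau g|) + i)%N by rewrite /j; lia.
    by rewrite exprD -mulrA; apply: localizedM => //; apply/localizedX/localized_int.
Qed.

End AffineFiltration.

Lemma expr_unbounded (q x : rat) : (1 < q)%R -> exists j0, forall j, j0 <= j -> (x <= q ^+ j)%R.
Proof.
move=> q1; have d0 : (0 < q - 1)%R by lra.
have bern j : (1 + j%:R * (q - 1) <= q ^+ j)%R.
  elim: j => [|j IH]; first by rewrite expr0 mul0r addr0.
  rewrite exprS -natr1; have : (0 <= j%:R :> rat)%R by apply: ler0n.
  have : (q * (1 + j%:R * (q - 1)) <= q * q ^+ j)%R by rewrite ler_pM2l //; lra.
  by move=> h1 h2; apply: le_trans h1; have := mulr_ge0 h2 (sqr_ge0 (q - 1)%R); rewrite expr2; lra.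
exists (Num.bound (`|x| / (q - 1))) => j le; apply: le_trans (bern j).
have := archi_boundP (x := `|x| / (q - 1)) (divr_ge0 (normr_ge0 _) (ltW d0)).
rewrite ltr_pdivrMr // => h1.
have : ((Num.bound (`|x| / (q - 1)))%:R * (q - 1) <= j%:R * (q - 1))%R by rewrite ler_pM2r // ler_nat.
by have := ler_norm x; lra.
Qed.

Lemma eval_telescope (G : groupType) (p : nat -> G) n :
  eval (mkseq (fun s => (p s)^-1 * p s.+1)%g n) = ((p 0)^-1 * p n)%g.
Proof.
elim: n => [|n IH]; first by rewrite /mkseq /= eval_nil mulVg.
by rewrite mkseqS -cats1 eval_cat IH eval1 -mulgA mulVKg.
Qed.

(** * The detour as a word in the group *)

Section BaumslagSolitarPair.
Variables (R : realType) (G : groupType) (H S : set G).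
Hypotheses (undistH : undistorted R H) (genS : finite_generating_set setT S).
Local Notation len := (word_length S).
Variables (u v : int).
Hypotheses (v0 : v != 0%R) (cop : coprimez u v) (uv : (`|v| < `|u|)%N).
Let q0 : rat := (u%:~R / v%:~R)%R.
Variables (h : G -> int) (tau : G -> rat).
Hypothesis hM : forall g g', H g -> H g' -> h (g * g')%g = (h g + h g')%R.
Hypothesis tauM : forall g g', H g -> H g' -> tau (g * g')%g = (tau g + q0 ^ h g * tau g')%R.
Hypothesis tau_loc : forall g, H g -> exists i, localized v (u%:~R ^+ i * tau g)%R.
(* [t] is the square of the stable letter, so that it acts by [q0 ^+ 2 > 0]. *)
Variables (a t : G) (mu nu : nat).
Hypotheses (Ha : H a) (Ht : H t) (mu0 : 0 < mu).
Hypotheses (q0E : (q0 ^+ 2 = nu%:R / mu%:R)%R) (rel : (t * a ^+ mu * t^-1 = a ^+ nu)%g).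
Hypotheses (ha : h a = 0%R) (ta : tau a = 1%R) (ht : h t = 2%R) (tt : tau t = 0%R).
Let q : rat := (q0 ^+ 2)%R.
Let B : rat := (`|u|%N.+1)%:R%R.

Let sH : subgroup H.
Proof. by case: undistH => T [_ [genT _ _]]; apply: fgs_subgroup genT. Qed.

Let H1 := subgroup1 sH.
Let HM g g' (Hg : H g) (Hg' : H g') := subgroupM sH Hg Hg'.
Let HV g (Hg : H g) := subgroupV sH Hg.
Let HX g i (Hg : H g) := subgroupX sH i Hg.

Let q1 : (1 < q)%R.
Proof.
rewrite /q /q0 expr_div_n -!rmorphXn /= ltr_pdivlMr ?mul1r ?ltr_int.
  by move: uv; clear; rewrite !expr2; nia.
by rewrite ltr0z exprn_even_gt0.
Qed.

Let q_gt0 : (0 < q)%R. Proof. exact: lt_trans q1. Qed.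

Let qX_gt0 i : (0 < q ^+ i)%R. Proof. exact: exprn_gt0. Qed.

Let mu0' : (mu%:R != 0 :> rat)%R. Proof. by rewrite pnatr_eq0 -lt0n. Qed.

Let tau_one : tau 1%g = 0%R. Proof. exact: (translation1 undistH v0 (ltnW uv) hM tauM). Qed.
Let h_one : h 1%g = 0%R. Proof. exact: (height1 undistH v0 (ltnW uv) hM). Qed.

Let aX M : h (a ^+ M)%g = 0%R /\ tau (a ^+ M)%g = M%:R%R.
Proof.
elim: M => [|M [IH1 IH2]]; first by rewrite expg0 h_one tau_one.
rewrite expgS hM ?tauM //; try exact: HX.
by rewrite IH1 IH2 ha ta expr0z mul1r addr0 -natr1 addrC.
Qed.

Let tX i : h (t ^+ i)%g = (i * 2)%N%:Z%R /\ tau (t ^+ i)%g = 0%R.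
Proof.
elim: i => [|i [IH1 IH2]]; first by rewrite expg0 h_one tau_one.
rewrite expgS hM ?tauM //; try exact: HX.
by rewrite IH1 IH2 ht tt mulr0 addr0; split=> //; lia.
Qed.

Definition point i X g := [/\ H g, h g = (i * 2)%N%:Z%R & tau g = X].

Let q0X i : (q0 ^ (i * 2)%N%:Z)%R = (q ^+ i)%R.
Proof. by rewrite /q -exprM mulnC. Qed.

Let pointM i X g i' X' g' : point i X g -> point i' X' g' ->
  point (i + i') (X + q ^+ i * X')%R (g * g')%g.
Proof.
move=> [Hg hg tg] [Hg' hg' tg']; split; first exact: HM.
- by rewrite hM // hg hg' mulnDl PoszD.
- by rewrite tauM // tg tg' hg q0X.
Qed.

Let point_a M : point 0 M%:R%R (a ^+ M)%g.
Proof. by have [h1 h2] := aX M; split=> //; exact: HX. Qed.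

Let point_t i : point i 0%R (t ^+ i)%g.
Proof. by have [h1 h2] := tX i; split=> //; exact: HX. Qed.

Let point_aV : point 0 (-1)%R (a^-1)%g.
Proof.
split; first exact: HV.
- by have := hM Ha (HV Ha); rewrite mulgV h_one ha; lia.
- by have := tauM Ha (HV Ha); rewrite mulgV tau_one ha ta expr0z; lra.
Qed.

(** The affine bounds are applied to [g1^-1 * g2], whose translation part is
    [(X2 - X1) / q ^+ i1]. *)
Lemma point_near : exists C, forall i1 X1 g1 i2 X2 g2,
  point i1 X1 g1 -> point i2 X2 g2 -> near u v B (C * len (g1^-1 * g2)%g + C) i1 X1 i2 X2.
Proof.
have [C CP] := affine_filtration undistH genS v0 (ltnW uv) hM tauM tau_loc.
exists C => i1 X1 g1 i2 X2 g2 [Hg1 h1 t1] [Hg2 h2 t2].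
have Hg := HM (HV Hg1) Hg2; have [l1 l2 l3] := CP _ Hg.
have := hM Hg1 Hg; have := tauM Hg1 Hg; rewrite mulVKg t1 t2 h1 h2 q0X => Et Eh.
set d := C * _ + C in l1 l2 l3 *; set g := (_ * _)%g in Et Eh l1 l2 l3.
have qi : (q ^+ i1 != 0)%R by rewrite expf_neq0 // gt_eqF.
have EX : (X2 - X1 = q ^+ i1 * tau g)%R by rewrite Et; lra.
split; [by move: l1 Eh; clear; lia|by move: l1 Eh; clear; lia| |]; rewrite EX -/q0 -/q.
- apply: (@le_trans _ _ (q ^+ i1 * B ^+ d)%R); last by rewrite mulrC.
  rewrite normrM (gtr0_norm (qX_gt0 i1)) ler_pM2l ?qX_gt0 //.
  by apply: le_trans l2 _; rewrite gerBl.
- by rewrite [(q ^+ i1 * _)%R]mulrC mulrA mulfK.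
Qed.

(** A multiple of [mu], so that the recursion below can start, and at least 2, so that [digits j]
    stays above [2 * q ^+ j]. *)
Let e := 2 * mu.

(* [a ^+ digits j = t ^+ j * a ^+ e * (t^-1 * a ^+ r_1) * ... * (t^-1 * a ^+ r_j)]
   with [r_i < mu]: powers of [a] of exponential size and linear length. *)
Fixpoint digits j : nat :=
  if j is j'.+1 then
    let c := digits j' %/ mu * nu in c + (mu - c %% mu) %% mu
  else e.

Let digit j := digits j.+1 - digits j %/ mu * nu.

Let digits_dvd j : mu %| digits j.
Proof.
case: j => [|j] /=; first exact: dvdn_mull.
set c := _ * nu; rewrite /dvdn -modnDmr modn_mod modnDmr.
have lt := ltn_pmod c mu0; rewrite -modnDml subnKC ?modnn //; exact: ltnW.
Qed.

Let digitsS j : digits j.+1 = digits j %/ mu * nu + digit j.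
Proof. by rewrite /digit /=; set c := _ * nu; lia. Qed.

Let digit_lt j : digit j < mu.
Proof. by rewrite /digit /=; set c := _ * nu; rewrite addKn ltn_pmod. Qed.

Let digitsSq j : ((digits j.+1)%:R = q * (digits j)%:R + (digit j)%:R :> rat)%R.
Proof.
rewrite digitsS natrD natrM /q q0E -{2}(divnK (digits_dvd j)) natrM; congr (_ + _)%R.
by rewrite mulrCA divfK.
Qed.

Let digits_low j : (2 * q ^+ j <= (digits j)%:R)%R.
Proof.
elim: j => [|j IH].
  by rewrite expr0 mulr1 /= /e natrM; have : (1 <= mu%:R :> rat)%R by [rewrite ler1n]; lra.
rewrite digitsSq exprS; have : (0 <= (digit j)%:R :> rat)%R by apply: ler0n.
have : (q * (2 * q ^+ j) <= q * (digits j)%:R)%R by rewrite ler_pM2l.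
by lra.
Qed.

(** The solution of [K * q = K + mu]: with it, [digits j + K] grows at each step by a factor of at
    most [q]. *)
Let K : rat := (mu%:R / (q - 1))%R.

Let digits_up j : ((digits j)%:R + K <= q ^+ j * (e%:R + K))%R.
Proof.
have EK : (K * q = K + mu%:R)%R.
  by have : (K * (q - 1) = mu%:R)%R; [rewrite /K divfK // subr_eq0 gt_eqF|lra].
elim: j => [|j IH]; first by rewrite expr0 mul1r.
rewrite digitsSq exprS -mulrA; have : ((digit j)%:R <= mu%:R :> rat)%R by rewrite ler_nat ltnW.
have : (q * ((digits j)%:R + K) <= q * (q ^+ j * (e%:R + K)))%R by rewrite ler_pM2l.
by lra.
Qed.

Let K0 : (0 <= K)%R. Proof. by rewrite divr_ge0 // subr_ge0 ltW. Qed.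

Section Detour.
Variables (N k : nat).
Hypothesis kN : 2 * k <= N.

Let M_low i : i <= N -> (2 * q ^+ N <= q ^+ i * (digits (N - i))%:R)%R.
Proof.
move=> iN; rewrite -{1}(subnKC iN) exprD mulrCA ler_pM2l ?qX_gt0 //.
Qed.

Let M_up i : i <= N -> (q ^+ i * (digits (N - i))%:R <= (e%:R + K) * q ^+ N)%R.
Proof.
move=> iN; rewrite -{2}(subnKC iN) exprD [(_ * (q ^+ i * _))%R]mulrC -mulrA ler_pM2l ?qX_gt0 //.
by have := digits_up (N - i); have := K0; lra.
Qed.

Let vertex3 s : G :=
  if s <= N then (t ^+ s)%g
  else if s <= 2 * N + 1 then (t ^+ level3 N s * a ^+ digits (N - level3 N s))%g
  else (a^-1 * (t ^+ level3 N s * a ^+ digits (N - level3 N s)))%g.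

(** The value of [U x^k a] for [x = t^-1], where the translated copy of the first part starts. *)
Let base : G := (a^-1 * (t ^+ (N - k) * a))%g.

Let vertex s : G :=
  if s < 3 * N + 3 then vertex3 s
  else if s < 3 * N + 4 + k then (a^-1 * t ^+ (4 * N + 3 - s))%g
  else (base * vertex3 (s - (3 * N + 4 + k)))%g.

Let point_eq i i' X X' g : point i X g -> i = i' -> X = X' -> point i' X' g.
Proof. by move=> p <- <-. Qed.

Let vertex3_point s : point (level3 N s) (abscissa3 u v N digits s) (vertex3 s).
Proof.
rewrite /vertex3 /abscissa3; case: ifP => c1.
  by rewrite /level3 c1; apply: point_t.
have pta i : point i (q ^+ i * (digits (N - i))%:R)%R (t ^+ i * a ^+ digits (N - i))%g.
  by apply: (point_eq (pointM (point_t i) (point_a _))); rewrite ?addn0 ?add0r.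
case: ifP => c2; first exact: pta.
by apply: (point_eq (pointM point_aV (pta _))); rewrite ?expr0 ?mul1r.
Qed.

Let vertex_point s : point (level N k s) (abscissa u v N k digits s) (vertex s).
Proof.
rewrite /vertex /abscissa /level; case: ifP => c1; first exact: vertex3_point.
case: ifP => c2.
  by apply: (point_eq (pointM point_aV (point_t _))); rewrite ?mulr0 ?addr0.
apply: (point_eq (pointM (pointM point_aV (pointM (point_t (N - k)) (point_a 1))) (vertex3_point _))).
  by rewrite add0n addn0.
by rewrite add0r expr0 mul1r mulr1 !add0n addn0 mulrDr mulr1 addrA.
Qed.

(** The letters are quotients of consecutive vertices, so that the values of prefixes telescope. The
    letter [a ^- e] at the end of [U] leads from the last vertex of the first part to
    [a^-1 * t ^+ N]. *)
Let step3 := mkseq (fun s => (vertex3 s)^-1 * vertex3 s.+1)%g (3 * N + 2).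
Let U := step3 ++ [:: (a ^- e)%g].
Let V := a :: step3.
Let W := U ++ nseq k (t^-1)%g ++ V.

Let vertex3_0 : vertex3 0 = 1%g. Proof. by []. Qed.

Let vertex3_last : vertex3 (3 * N + 2) = (a^-1 * (t ^+ N * a ^+ e))%g.
Proof.
have c1 : (3 * N + 2 <= N) = false by lia.
have c2 : (3 * N + 2 <= 2 * N + 1) = false by lia.
rewrite /vertex3 /level3 c1 c2; have -> : 3 * N + 2 - (2 * N + 2) = N by lia.
by rewrite subnn.
Qed.

Let step3_take s : s <= 3 * N + 2 -> eval (take s step3) = vertex3 s.
Proof.
move=> sN; have -> : take s step3 = mkseq (fun s => (vertex3 s)^-1 * vertex3 s.+1)%g s.
  by rewrite /step3 /mkseq -map_take take_iota (minn_idPl sN).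
by rewrite eval_telescope vertex3_0 invg1 mul1g.
Qed.

Let eval_U : eval U = (a^-1 * t ^+ N)%g.
Proof.
rewrite /U eval_cat eval1 -{1}[step3]take_size size_mkseq step3_take // vertex3_last.
by rewrite -!mulgA mulgV mulg1.
Qed.

Let eval_V : eval V = (t ^+ N * a ^+ e)%g.
Proof.
by rewrite /V eval_cons -{1}[step3]take_size size_mkseq step3_take // vertex3_last mulVKg.
Qed.

Let size_step3 : size step3 = 3 * N + 2. Proof. exact: size_mkseq. Qed.

Let size_W : size W = 6 * N + 6 + k.
Proof. by rewrite /W /U !size_cat size_nseq /= size_step3; lia. Qed.

Let eval_take s : s <= size W -> eval (take s W) = vertex s.
Proof.
rewrite size_W => sW; rewrite /vertex; case: ltnP => c1.
  by rewrite /W /U -catA takel_cat ?size_step3 ?step3_take //; lia.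
rewrite /W take_cat size_cat size_step3 /= ltnNge; have -> /= : 3 * N + 2 + 1 <= s by lia.
rewrite eval_cat eval_U take_cat size_nseq.
case: (ltnP s (3 * N + 4 + k)) => c2.
  have -> : eval (if s - (3 * N + 2 + 1) < k then take (s - (3 * N + 2 + 1)) (nseq k t^-1%g)
     else nseq k t^-1%g ++ take (s - (3 * N + 2 + 1) - k) V) = (t ^- (s - (3 * N + 3)))%g.
    case: ltnP => c3.
      by rewrite take_nseq ?eval_nseq ?expVgn ?(ltnW c3) //; do 2!f_equal; lia.
    have -> : s - (3 * N + 2 + 1) - k = 0 by lia.
    by rewrite take0 cats0 eval_nseq expVgn; do 2!f_equal; lia.
  have {1}-> : N = (4 * N + 3 - s) + (s - (3 * N + 3)) by lia.
  by rewrite expgnDr -!mulgA mulgV mulg1.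
rewrite ifN; last by rewrite -leqNgt; lia.
have -> : s - (3 * N + 2 + 1) - k = (s - (3 * N + 4 + k)).+1 by lia.
rewrite eval_cat eval_nseq expVgn /= eval_cons step3_take; last by lia.
rewrite /base !mulgA; do 2!congr (_ * _)%g; rewrite -!mulgA; congr (_ * _)%g.
by have {1}-> : N = (N - k) + k by [lia]; rewrite expgnDr -mulgA mulgV mulg1.
Qed.

Let bound := len t + (e + mu + 1) * len a.

Let len_aX i : i <= e + mu + 1 -> len (a ^+ i)%g <= (e + mu + 1) * len a.
Proof.
move=> le; apply: leq_trans (word_lengthX genS _ (I : setT a)) _.
by rewrite leq_mul2r le orbT.
Qed.

Let lenV g : len (g^-1)%g = len g. Proof. exact: (@word_lengthV _ _ _ genS g I). Qed.

Let rel_digits j : (t * a ^+ digits j = a ^+ (digits j %/ mu * nu) * t)%g.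
Proof.
have relX i : (t * a ^+ (mu * i) = a ^+ (nu * i) * t)%g.
  rewrite !expgnA; elim: i => [|i IH]; first by rewrite !expg0 mulg1 mul1g.
  have ta_comm : (t * a ^+ mu = a ^+ nu * t)%g by rewrite -rel mulgVK.
  by rewrite !expgS mulgA ta_comm -mulgA IH mulgA.
by rewrite -{1}(divnK (digits_dvd j)) mulnC relX mulnC.
Qed.

(** The relation moves [a ^- digits j] across [t^-1], where it cancels all of [a ^+ digits j.+1]
    except the last digit, which is below [mu]. *)
Let len_down j : len ((a ^- digits j) * (t^-1 * a ^+ digits j.+1))%g <= bound.
Proof.
have -> : (a ^- digits j * (t^-1 * a ^+ digits j.+1) = t^-1 * a ^+ digit j)%g.
  rewrite digitsS expgnDr !mulgA; congr (_ * _)%g; rewrite -invgM rel_digits.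
  by rewrite invgM -mulgA mulVg mulg1.
apply: leq_trans (@word_lengthM _ _ _ genS _ _ I I) _.
by rewrite lenV leq_add2l len_aX // ltnW //; have := digit_lt j; lia.
Qed.

Let level3_mid s : N < s -> s <= 2 * N + 1 -> level3 N s = 2 * N + 1 - s.
Proof. by move=> c1 c2; rewrite /level3 leqNgt c1 c2. Qed.

Let level3_last s : 2 * N + 1 < s -> level3 N s = s - (2 * N + 2).
Proof.
have -> : 2 * N + 1 < s = ~~ (s <= 2 * N + 1) by rewrite ltnNge.
by move=> c; rewrite /level3 (negbTE c); case: leqP => //; lia.
Qed.

Let step3_len g : g \in step3 -> len g <= bound.
Proof.
move=> /mapP[s]; rewrite mem_iota add0n => /= sN ->.
have la1 : len a <= (e + mu + 1) * len a by apply: leq_pmull; lia.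
rewrite /vertex3; case: (ltngtP s N) => c1.
- rewrite expgSr mulKg; exact: leq_addr.
- case: (leqP s.+1 (2 * N + 1)) => c2.
    rewrite ifT; last by lia.
    have -> : level3 N s = (2 * N + 1 - s.+1).+1 by rewrite level3_mid; lia.
    rewrite level3_mid //; last exact: ltnW.
    set i := 2 * N + 1 - s.+1; have -> : N - i = (N - i.+1).+1 by rewrite /i; lia.
    by rewrite invgM expgSr invgM -!mulgA mulKg; apply: len_down.
  case: (leqP s (2 * N + 1)) => c3.
    have -> : level3 N s = 0 by rewrite level3_mid; lia.
    have -> : level3 N s.+1 = 0 by rewrite level3_last; lia.
    rewrite expg0 !mul1g; set d := digits _.
    (* At the foot of the descent the path passes to its parallel copy by one short letter, because
       [a] commutes with its powers. *)
    have -> : (a ^- d * (a^-1 * a ^+ d) = a^-1)%g.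
      by rewrite mulgA -invgM -expgS expgSr invgM mulgVK.
    by rewrite lenV; apply: leq_trans la1 (leq_addl _ _).
  rewrite (level3_last c3).
  have -> : level3 N s.+1 = (s - (2 * N + 2)).+1 by rewrite level3_last; lia.
  (* The second ascent retraces the descent, so its letters are inverses of letters of the
     descent. *)
  set i := s - _; have -> : N - i = (N - i.+1).+1 by rewrite /i; lia.
  rewrite !invgM invgK -!mulgA mulVKg expgSr -mulgA mulKg -lenV !invgM invgK -mulgA.
  exact: len_down.
- rewrite c1 ifT; last by lia.
  have -> : level3 N N.+1 = N by rewrite level3_mid; lia.
  by rewrite subnn mulKg -[digits 0]/e; apply: leq_trans (len_aX _) (leq_addl _ _); lia.
Qed.

Let W_len g : g \in W -> len g <= bound.
Proof.
have la1 : len a <= (e + mu + 1) * len a by apply: leq_pmull; lia.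
rewrite !mem_cat !inE => /orP[/orP[|/eqP->]|/orP[|/orP[/eqP->|]]]; try exact: step3_len.
- by rewrite lenV; apply: leq_trans (len_aX _) (leq_addl _ _); lia.
- by rewrite mem_nseq => /andP[_ /eqP->]; rewrite lenV leq_addr.
- exact: leq_trans la1 (leq_addl _ _).
Qed.

Lemma baumslag_solitar_detour b C : 0 < k -> (B <= q ^+ b)%R ->
  (e%:R + K + 1 <= q ^+ (N - k))%R ->
  (forall i1 X1 g1 i2 X2 g2, point i1 X1 g1 -> point i2 X2 g2 ->
    near u v B (C * len (g1^-1 * g2)%g + C) i1 X1 i2 X2) ->
  exists U V, [/\ forall g, g \in U ++ nseq k (t^-1)%g ++ V -> len g <= bound,
    forall w, infix w (U ++ nseq k (t^-1)%g ++ V) ->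
      size w <= 20 * (b.+1 * C) * len (eval w) + (20 * (b.+1 * C) + 20),
    eval U = (a^-1 * t ^+ N)%g & eval V = (t ^+ N * a ^+ e)%g].
Proof.
move=> k0 Bb NkE nearP; exists U, V; split=> // w /infixP[s1 [s2 E]].
have {}E : W = s1 ++ w ++ s2 by [].
have sz : size s1 + size w + size s2 = size W by rewrite E !size_cat addnA.
have e1 : eval s1 = vertex (size s1).
  by rewrite -eval_take; [rewrite E take_size_cat|lia].
have e2 : (eval s1 * eval w)%g = vertex (size s1 + size w).
  by rewrite -eval_cat -eval_take; [rewrite E catA take_size_cat ?size_cat|lia].
have {e2} -> : eval w = ((vertex (size s1))^-1 * vertex (size s1 + size w))%g.
  by rewrite -e2 -e1 mulKg.
have u1 : 1 < `|u| by move: uv v0; clear; lia.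
have := near_detour v0 cop u1 q1 _ Bb kN k0 M_low M_up NkE (leq_addr (size w) (size s1)) _
  (nearP _ _ _ _ _ _ (vertex_point _) (vertex_point _)).
rewrite ler1n addKn => /(_ isT) le; apply: leq_trans (le _) _.
  by rewrite size_W in sz; lia.
by set l := len _; nia.
Qed.

End Detour.

Lemma baumslag_solitar_chaotic : chaotic R S.
Proof.
have [C CP] := point_near.
have [b0 bP] := expr_unbounded B q1; have [j0 jP] := expr_unbounded (e%:R + K + 1)%R q1.
have t1 : (t^-1)%g != 1%g.
  by rewrite invg_eq1; apply/eqP => t1; move: ht; rewrite t1 h_one.
pose c := len t + (e + mu + 1) * len a.
apply: (@chaotic_criterion R _ _ genS c _ (20 * (b0.+1 * C)) (20 * (b0.+1 * C) + 20) t1) => n0 D.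
(* The summand [j0] secures [e + K + 1 <= q ^+ (N - k)]. The rest makes [N] exceed [D * c + D],
   where [c] bounds the lengths of [a^-1] and [a ^+ e], the values of [U x^N] and [x^N V]. *)
pose k := n0.+1; pose N := 2 * k + j0 + D * c + D + 1.
have kN : 2 * k <= N by rewrite /N; lia.
have [|U [V [bW qW eU eV]]] := @baumslag_solitar_detour N k kN b0 C (ltn0Sn _) (bP _ (leqnn _)) _ CP.
  by apply: jP; rewrite /N; lia.
have ac : len a <= (e + mu + 1) * len a by apply: leq_pmull; lia.
exists k, N, U, V; split=> //.
- exists (U ++ nseq N (t^-1)%g); first exact: infix_refl.
  rewrite eval_cat eU eval_nseq expVgn -mulgA mulgV mulg1 (@word_lengthV _ _ _ genS a I).
  rewrite count_cat count_nseq t1 mul1n.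
  have : D * len a <= D * c by rewrite leq_mul2l /c; lia.
  by rewrite /N; lia.
- exists (nseq N (t^-1)%g ++ V); first exact: infix_refl.
  rewrite eval_cat eV eval_nseq expVgn mulKg.
  rewrite count_cat count_nseq t1 mul1n.
  have ae : len (a ^+ e)%g <= c.
    apply: leq_trans (word_lengthX genS _ (I : setT a)) _.
    by apply: leq_trans _ (leq_addl _ _); rewrite leq_mul2r; lia.
  have : D * len (a ^+ e)%g <= D * c by rewrite leq_mul2l ae orbT.
  by rewrite /N; lia.
Qed.

End BaumslagSolitarPair.

(** * Equal and unequal exponents *)

Section AffineRepresentation.
Variables (R : realType) (G : groupType) (H S : set G).
Hypotheses (undistH : undistorted R H) (genS : finite_generating_set setT S).
Variables (q : rat) (h : G -> int) (tau : G -> rat).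
Hypothesis q0 : q != 0%R.
Hypothesis hM : forall g g', H g -> H g' -> h (g * g')%g = (h g + h g')%R.
Hypothesis tauM : forall g g', H g -> H g' -> tau (g * g')%g = (tau g + q ^ h g * tau g')%R.
Hypothesis tau_loc : forall u v : int, u != 0%R -> v != 0%R ->
  (q = u%:~R / v%:~R)%R \/ (q = v%:~R / u%:~R)%R ->
  forall g, H g -> exists i, localized v (u%:~R ^+ i * tau g)%R.
Variables (a t : G) (mu nu : nat).
Hypotheses (Ha : H a) (Ht : H t) (mu0 : 0 < mu) (nu0 : 0 < nu).
Hypotheses (qE : (q ^+ 2 = nu%:R / mu%:R)%R) (rel : (t * a ^+ mu * t^-1 = a ^+ nu)%g).
Hypotheses (ha : h a = 0%R) (ta : tau a = 1%R) (ht : h t = 2%R) (tt : tau t = 0%R).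

Let sH : subgroup H.
Proof. by case: undistH => T [_ [genT _ _]]; apply: fgs_subgroup genT. Qed.

Let h_one : h 1%g = 0%R.
Proof. by have := hM (subgroup1 sH) (subgroup1 sH); rewrite mulg1; lia. Qed.

Let tau_one : tau 1%g = 0%R.
Proof. by have := tauM (subgroup1 sH) (subgroup1 sH); rewrite mulg1 h_one expr0z; lra. Qed.

Let mu0' : (0 < mu%:R :> rat)%R. Proof. by rewrite ltr0n. Qed.

(** Here [t] commutes with [a ^+ mu], and half the height is a character with value 1 at [t]. A
    power of [a ^+ mu] that is a power of [t] has height 0, so it is trivial, which [tau] allows
    only for the exponent 0. *)
Lemma affine_chaotic_eq : mu = nu -> chaotic R S.
Proof.
move=> mn; pose chi g : rat := ((h g)%:~R / 2)%R.
have chiM : additive_on H chi.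
  by move=> g g' Hg Hg'; rewrite /chi hM // rmorphD mulrDl.
have [C und] : exists C, forall k, k <= C * word_length S (t ^+ k)%g.
  by apply: (character_undistorted undistH genS sH chiM Ht); rewrite /chi ht.
have tz : commute t (a ^+ mu)%g.
  by move: rel; rewrite -mn => E; rewrite /commute -{2}E mulgVK.
apply: (chaotic_commuting R genS und tz) => M i k M0 E.
have HX g j : H g -> H (g ^+ j)%g by apply: subgroupX.
have aX j : h (a ^+ j)%g = 0%R /\ tau (a ^+ j)%g = j%:R%R.
  elim: j => [|j [IH1 IH2]]; first by rewrite expg0 h_one tau_one.
  rewrite expgS hM ?tauM //; try exact: HX.
  by rewrite IH1 IH2 ha ta expr0z mul1r addr0 -natr1 addrC.
have [h1 t1] := aX (mu * M).
have ik : i = k.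
  have chiX j := additive_onX sH chiM j Ht.
  have : chi (shift t i k) = (k%:R - i%:R)%R.
    rewrite shiftE chiM; [|exact: subgroupV sH _ (HX _ _ Ht)|exact: HX].
    by rewrite (additive_onV sH chiM) ?chiX; [rewrite /chi ht; lra|exact: HX].
  rewrite -E -expgnA /chi h1 mul0r => /esym/eqP; rewrite subr_eq0 eqr_nat => /eqP //.
move: t1; rewrite expgnA E ik shiftE mulVg tau_one => /esym/eqP.
by rewrite pnatr_eq0 muln_eq0 !gtn_eqF.
Qed.

Lemma affine_chaotic_lt : mu < nu -> chaotic R S.
Proof.
move=> lt.
have q2 : (1 < q ^+ 2)%R by rewrite qE ltr_pdivlMr // mul1r ltr_nat.
(* Lowest terms provide the coprime pair [u], [v]. *)
have Eq : q = ((numq q)%:~R / (denq q)%:~R)%R by rewrite divq_num_den.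
have num0 : numq q != 0%R by rewrite numq_eq0.
have uv : `|denq q| < `|numq q|.
  move: q2; rewrite {1}Eq; move: (numq q) (denq q) (denq_neq0 q) => u v v0; clear -v0.
  rewrite expr_div_n -!rmorphXn /= ltr_pdivlMr ?mul1r ?ltr_int.
    by rewrite !expr2; nia.
  by rewrite ltr0z exprn_even_gt0.
have cop : coprimez (numq q) (denq q) by apply: coprime_num_den.
apply: (@baumslag_solitar_chaotic R G H S undistH genS (numq q) (denq q) (denq_neq0 q) cop uv h tau
  hM _ _ a t mu nu Ha Ht mu0 _ rel ha ta ht tt); rewrite -?Eq //.
by apply: tau_loc => //; left.
Qed.

End AffineRepresentation.

(** * The affine action on words *)

Section Cocycle.
Variable q : rat.
Hypothesis q0 : q != 0%R.
Implicit Types w : seq (bool * bool).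
Local Open Scope ring_scope.

(* The affine action of the letters on the line: [a] is [x + 1], [t] is [q x]. *)
Definition letter_height (l : bool * bool) : int := if l.1 then (if l.2 then -1 else 1) else 0.
Definition letter_shift (l : bool * bool) : rat := if l.1 then 0 else (if l.2 then -1 else 1).

Fixpoint height w : int := if w is l :: w' then letter_height l + height w' else 0.

Fixpoint translation w : rat :=
  if w is l :: w' then letter_shift l + q ^ letter_height l * translation w' else 0.

Lemma height_cat w1 w2 : height (w1 ++ w2) = height w1 + height w2.
Proof. by elim: w1 => [|l w1 IH]; rewrite ?add0r //= IH addrA. Qed.

Lemma translation_cat w1 w2 :
  translation (w1 ++ w2) = translation w1 + q ^ height w1 * translation w2.
Proof.
elim: w1 => [|l w1 IH] /=; first by rewrite expr0z mul1r add0r.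
by rewrite IH expfzDr // mulrDr addrA mulrA.
Qed.

Lemma height_wpow_a k : height (wpow false k) = 0.
Proof. by rewrite /wpow; elim: `|k|%N => //= i ->. Qed.

Lemma translation_wpow_a k : translation (wpow false k) = k%:~R.
Proof.
have E c i : translation (nseq i (false, c)) = i%:R * letter_shift (false, c).
  by elim: i => [|i IH] /=; rewrite ?mul0r // IH expr0z mul1r -natr1 mulrDl mul1r addrC.
by rewrite /wpow E; case: (intP k) => [|n|n]; rewrite /letter_shift /= ?mul0r ?mulrNz ?abszN
  ?mulr1 ?mulrN1.
Qed.

(** One more factor [u] for each letter clears the denominators. Both forms of [q] are covered
    because [q] is replaced by its inverse when [|n| < |m|]. *)
Lemma localized_translation (u v : int) w : u != 0 -> v != 0 ->
  q = u%:~R / v%:~R \/ q = v%:~R / u%:~R ->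
  exists i, localized v (u%:~R ^+ i * translation w).
Proof.
move=> u0 v0 Eq.
have u0' : u%:~R != 0 :> rat by rewrite intr_eq0.
have v0' : v%:~R != 0 :> rat by rewrite intr_eq0.
have Li (k : int) : localized v (k%:~R : rat) by apply: localized_int.
have Lv : localized v (v%:~R^-1 : rat) by rewrite -[_^-1]expr1 exprVn; apply: localizedV.
have Luv : localized v (u%:~R * (u%:~R / v%:~R) : rat).
  by rewrite mulrA; do 2!apply: localizedM => //.
have Lvu : localized v (u%:~R * (v%:~R / u%:~R) : rat) by rewrite mulrCA divff // mulr1.
have Lq : localized v (u%:~R * q) /\ localized v (u%:~R * q^-1).
  by case: Eq => ->; rewrite invf_div.
elim: w => [|[x c] w [i IH]]; first by exists 0%N; rewrite mulr0; apply: (localized_int v 0).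
exists i.+1; rewrite /= mulrDr; apply: localizedD => //.
  apply: localizedM => //; first by apply: localizedX.
  by rewrite /letter_shift /=; case: ifP => _; [|case: ifP => _];
    [apply: (Li 0)|apply: (Li (-1))|apply: (Li 1)].
rewrite exprSr -mulrA [u%:~R * (_ * _)]mulrA mulrCA; apply: localizedM => //.
rewrite /letter_height /=; case: ifP => _; last by rewrite expr0z mulr1.
by case: ifP => _; [rewrite exprN1|rewrite expr1z]; case: Lq.
Qed.

End Cocycle.

Section BaumslagSolitar.
Variables (R : realType) (G : groupType) (H S : set G).
Hypotheses (undistH : undistorted R H) (genS : finite_generating_set setT S).
Variables (m n : int).
Hypotheses (m0 : m != 0%R) (n0 : n != 0%R).
Variable f : {multiplicative BS m n -> G}.
Hypotheses (f_inj : injective f) (fH : range f = H).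
Let q : rat := (n%:~R / m%:~R)%R.

Local Notation rels := [set (wpow true 1 ++ wpow false m ++ wpow true (-1), wpow false n)].
Local Notation cls w := (pclass rels w : BS m n).

Let q0 : q != 0%R.
Proof. by rewrite mulf_neq0 ?invr_neq0 ?intr_eq0. Qed.

Lemma pclass_cat w1 w2 : cls (w1 ++ w2) = (cls w1 * cls w2)%g.
Proof.
apply/pclassP; apply: pres_eq_cat; apply: rst_sym; exact: pres_eq_repr.
Qed.

(** Both sides of the defining relation act as the translation by [n], since [q * m = n]. *)
Lemma pres_eq_cocycle w1 w2 : pres_eq rels w1 w2 ->
  height w1 = height w2 /\ translation q w1 = translation q w2.
Proof.
elim=> {w1 w2} [w1 w2 st|//|w1 w2 _ [-> ->]//|w1 w2 w3 _ [-> ->] _ [-> ->]//].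
suff key l r : height l = height r -> translation q l = translation q r ->
    forall x y, height (x ++ l ++ y) = height (x ++ r ++ y) /\
      translation q (x ++ l ++ y) = translation q (x ++ r ++ y).
  case: st => [x y l b|x y l r [-> ->]].
    have [h1 h2] : height [:: (l, b); (l, ~~ b)] = 0%R /\
        translation q [:: (l, b); (l, ~~ b)] = 0%R.
      rewrite /= /letter_height /letter_shift /=; case: l; case: b => /=; split;
        rewrite ?expr0z ?exprN1 ?expr1z ?mulr0 ?addr0 ?add0r //; lra.
    by have := key _ [::] h1 h2 x y.
  apply: key; first by rewrite /= !height_cat !height_wpow_a.
  rewrite /= translation_cat // !translation_wpow_a height_wpow_a expr0z mul1r /=.
  by rewrite mulr0 !addr0 add0r expr1z divfK // intr_eq0.
by move=> E1 E2 x y; rewrite !height_cat !translation_cat // E1 E2.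
Qed.

Let repr_ex g : exists w, H g -> f (cls w) = g.
Proof.
case: (pselect (H g)) => [|nH]; last by exists [::].
by rewrite -fH => -[x _ <-]; exists (repr x) => _; rewrite /pclass reprK.
Qed.

Lemma baumslag_solitar_subgroup_chaotic : chaotic R S.
Proof.
have [w wP] := boolp.choice repr_ex.
have sH : subgroup H by case: undistH => T [_ [genT _ _]]; apply: fgs_subgroup genT.
have Hf x : H (f x) by rewrite -fH; exists x.
(* Height and translation part of [g] are read off a chosen word [w g]; as [f] is injective, any
   other word for [g] gives the same values. *)
have clsE w1 g : f (cls w1) = g -> height (w g) = height w1 /\
    translation q (w g) = translation q w1.
  move=> E; apply: pres_eq_cocycle; apply/pclassP; apply: f_inj.
  by rewrite E wP // -E.
pose h g := height (w g); pose tau g := translation q (w g).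
have hM g g' : H g -> H g' -> h (g * g')%g = (h g + h g')%R.
  move=> Hg Hg'; rewrite /h -height_cat; apply: (proj1 (clsE _ _ _)).
  by rewrite pclass_cat gmulfM !wP.
have tauM g g' : H g -> H g' -> tau (g * g')%g = (tau g + q ^ h g * tau g')%R.
  move=> Hg Hg'; rewrite /tau /h -translation_cat //; apply: (proj2 (clsE _ _ _)).
  by rewrite pclass_cat gmulfM !wP.
have tau_loc u v : u != 0%R -> v != 0%R ->
    (q = u%:~R / v%:~R)%R \/ (q = v%:~R / u%:~R)%R ->
    forall g, H g -> exists i, localized v (u%:~R ^+ i * tau g)%R.
  by move=> u0 v0 E g _; apply: localized_translation.
pose a := f (cls [:: (false, false)]); pose t := f (cls [:: (true, false)]).
have Ha : H a by exact: Hf.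
have Ht : H t by exact: Hf.
have [ha ta] : h a = 0%R /\ tau a = 1%R.
  by rewrite /h /tau; have [-> ->] := clsE _ a (erefl _); rewrite /= /letter_shift /= mulr0 addr0.
have [ht tt] : h t = 1%R /\ tau t = 0%R.
  by rewrite /h /tau; have [-> ->] := clsE _ t (erefl _); rewrite /= /letter_shift /= mulr0 addr0.
have f1 : f (cls [::]) = 1%g.
  by apply: (mulgI (f (cls [::]))); rewrite mulg1 -gmulfM -pclass_cat.
have fV x : f (cls [:: (x, true)]) = ((f (cls [:: (x, false)]))^-1)%g.
  apply/esym/mulg1_eq; rewrite -gmulfM -pclass_cat -f1; congr (f _).
  by apply/pclassP; apply/rst_step; exact: (pres_cancel _ [::] [::] x false).
have fnseq x b k : f (cls (nseq k (x, b))) = (f (cls [:: (x, b)]) ^+ k)%g.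
  elim: k => [|k IH]; first exact: f1.
  by rewrite expgS -IH -gmulfM -pclass_cat.
pose apow b k : G := if b then (a ^- k)%g else (a ^+ k)%g.
have f_apow (k : int) : f (cls (wpow false k)) = apow (k < 0)%R `|k|.
  by rewrite /wpow fnseq /apow; case: ifP => _ //; rewrite fV expVgn.
have rel1 : (t * apow (m < 0)%R `|m| * t^-1 = apow (n < 0)%R `|n|)%g.
  rewrite -!f_apow -fV /t -!gmulfM -!pclass_cat; congr (f _).
  by apply/pclassP; apply/rst_step; have := @pres_rel _ rels [::] [::] _ _ erefl; rewrite !cats0 -catA.
pose sg := ((m < 0) (+) (n < 0))%R.
have apowV b k : ((apow b k)^-1 = apow (~~ b) k)%g by rewrite /apow; case: b; rewrite ?invgK.
have rel2 : ((a ^+ `|m|) ^ t^-1 = apow sg `|n|)%g.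
  have E : ((apow (m < 0)%R `|m|) ^ t^-1 = apow (n < 0)%R `|n|)%g.
    by rewrite conjgE invgK mulgA.
  move: E; rewrite /sg; case: (m < 0)%R => //=.
  by rewrite /apow conjVg => E; rewrite -[LHS]invgK E -/(apow _ _) apowV.
(* Conjugation by the stable letter takes [a ^+ |m|] to [a ^+ |n|] up to a sign in the exponent, and
   doing it twice removes the sign. *)
have rel : (t ^+ 2 * a ^+ (`|m| ^ 2) * (t ^+ 2)^-1 = a ^+ (`|n| ^ 2))%g.
  have -> : (t ^+ 2 * a ^+ (`|m| ^ 2) * (t ^+ 2)^-1 = ((a ^+ (`|m| ^ 2)) ^ t^-1) ^ t^-1)%g.
    by rewrite -conjgM conjgE expg2 !invgM !invgK !mulgA.
  rewrite -!mulnn expgnA conjXg rel2 conjXg /apow.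
  have rel3 b : ((apow b `|n| ^+ `|m|) ^ t^-1 = apow (b (+) sg) `|n| ^+ `|n|)%g.
    rewrite /apow; case: b => /=.
      rewrite expVgn conjVg -expgnA mulnC expgnA conjXg rel2 -expVgn; congr (_ ^+ _)%g.
      exact: apowV.
    by rewrite -expgnA mulnC expgnA conjXg rel2.
  by rewrite -conjXg rel3 addbb /apow -expgnA.
have Ht2 : H (t ^+ 2)%g by apply: subgroupX.
have ht2 : h (t ^+ 2)%g = 2%R by rewrite expg2 hM // ht.
have tt2 : tau (t ^+ 2)%g = 0%R by rewrite expg2 tauM // tt mulr0 addr0.
have m2 : 0 < `|m| ^ 2 by rewrite expn_gt0 lt0n absz_eq0 m0.
have n2 : 0 < `|n| ^ 2 by rewrite expn_gt0 lt0n absz_eq0 n0.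
have sqr_abs (k : int) : ((k%:~R) ^+ 2 = (`|k| ^ 2)%N%:R :> rat)%R.
  by rewrite natrX natr_absz intr_norm real_normK // num_real.
have qE : (q ^+ 2 = (`|n| ^ 2)%N%:R / (`|m| ^ 2)%N%:R)%R by rewrite expr_div_n !sqr_abs.
case: (ltngtP (`|m| ^ 2) (`|n| ^ 2)) => cmp.
- exact: (affine_chaotic_lt undistH genS q0 hM tauM tau_loc Ha Ht2 m2 qE rel ha ta ht2 tt2 cmp).
- have HtV : H ((t ^+ 2)^-1)%g by apply: subgroupV.
  have h1 : h 1%g = 0%R by have := hM _ _ (subgroup1 sH) (subgroup1 sH); rewrite mulg1; lia.
  have hV : h ((t ^+ 2)^-1)%g = (-2)%R.
    by have := hM _ _ Ht2 HtV; rewrite mulgV h1 ht2; lia.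
  have tV : tau ((t ^+ 2)^-1)%g = 0%R.
    have t1 : tau 1%g = 0%R.
      by have := tauM _ _ (subgroup1 sH) (subgroup1 sH); rewrite mulg1 h1 expr0z; lra.
    have := tauM _ _ Ht2 HtV; rewrite mulgV t1 tt2 add0r => /esym/eqP.
    by rewrite mulf_eq0 expfz_eq0 (negbTE q0) andbF /= => /eqP.
  (* When [|n| < |m|], the element [t ^+ 2], the number [q] and the height are replaced by their
     inverses and opposite. *)
  apply: (@affine_chaotic_lt R G H S undistH genS (q^-1)%R (fun g => - h g)%R tau _ _ _ _
    a (t ^+ 2)^-1%g _ _ Ha HtV n2 _ _ _ ta _ tV cmp).
  + by rewrite invr_neq0.
  + by move=> g g' Hg Hg'; rewrite hM // opprD.
  + by move=> g g' Hg Hg'; rewrite tauM // exprz_inv opprK.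
  + move=> u v u0 v0 E; apply: tau_loc => //.
    by case: E => E; [right|left]; rewrite -[q]invrK E invf_div.
  + by rewrite exprVn qE invf_div.
  + by move: rel; move: (t ^+ 2)%g => s <-; rewrite invgK -!mulgA mulVg mulg1 mulKg.
  + by rewrite ha oppr0.
  + by rewrite hV opprK.
- exact: (affine_chaotic_eq undistH genS q0 hM tauM Ha Ht2 m2 n2 rel ha ta ht2 cmp).
Qed.

End BaumslagSolitar.

Theorem theorem1p6 (R : realType) (G : groupType) (H : set G) :
  finitely_generated G ->
  subgroup H ->
  undistorted R H ->
  (nilpotent H /\ ~ virtually_cyclic H) \/
  (exists m n : int,
     [/\ m != 0%R, n != 0%R & isomorphic_to (BS m n) H]) ->
  chaotic_group R G /\ ~ QCF R G.
Proof.
move=> [S0 genS0] sH undistH Hcases.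
have chaoticG : chaotic_group R G.
  move=> S genS; case: Hcases => [[nilH nvc]|[m [n [m0 n0 [f [f_inj fH]]]]]].
    exact: nilpotent_chaotic undistH genS nilH nvc.
  exact (baumslag_solitar_subgroup_chaotic undistH genS m0 n0 f_inj fH).
split=> // -[_ qcf].
have [lambda0 [eps0 [lambda0_ge1 eps0_ge0 ch]]] := chaoticG S0 genS0.
(* Rounding [lambda0] up to a rational enlarges the set of quasigeodesic words. This set would be a
   context-free language containing all words with the constants [lambda0], [eps0], yet only words
   that are quasigeodesic for [lambda], [eps0]. *)
pose lambda : rat := (Num.bound lambda0)%:R%R.
have le : (lambda0 <= ratr lambda)%R.
  by rewrite ratr_nat ltW // archi_boundP // (le_trans _ lambda0_ge1).
have lambda_ge1 : (1 <= ratr lambda :> R)%R by apply: le_trans le.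
have lambda_ge1' : (1 <= lambda)%R by rewrite -(ler_rat R) rmorph1.
have [||w Lw nLw] := ch _ _ (qcf lambda eps0 S0 lambda_ge1' eps0_ge0 genS0) _ (ratr lambda) eps0
  lambda_ge1 eps0_ge0.
- by move=> w [].
- move=> w [Sw qw]; split=> // u /qw le'; apply: le_trans le' _.
  by rewrite lerD2r ler_wpM2r // ler0n.
- exact: nLw.
Qed.
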